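(* Let $q\ge 2$ be a prime power and $N\ge 1$ an integer. Let $z$ be an integer with $N^{1/2}\le z\le N-1$ satisfying $N^{1/2}=o(z)$ as $N\to\infty$. Let $f$ be a Steinhaus random multiplicative function over $\mathbb{F}_q[t]$ and let $$\mathcal{A}=\{F\in\mathcal{M}_N:\ P^-(F)>z\}.$$ Then $$\frac{1}{\sqrt{|\mathcal{A}|}}\sum_{F\in\mathcal{A}}f(F)\xrightarrow{d}\mathcal{CN}(0,1)\quad\text{as } N\to\infty.$$
   Context: $\mathcal{M}$ is the set of monic polynomials in $\mathbb{F}_q[t]$ and $\mathcal{M}_N$ is the subset of those of degree $N$. $P^-(F):=\min\{\deg P: P\mid F,\ P\text{ monic irreducible}\}$. A Steinhaus random multiplicative function over $\mathbb{F}_q[t]$ is the random function $f:\mathcal{M}\to\mathbb{C}$ obtained from independent random variables $(f(P))_P$, indexed by the monic irreducible polynomials $P$ and each uniformly distributed on the complex unit circle, by $f(1)=1$ and $f(F)=f(P_1)^{a_1}\cdots f(P_r)^{a_r}$, where $F=P_1^{a_1}\cdots P_r^{a_r}$ is the factorization of $F$ into powers of distinct monic irreducibles. $\xrightarrow{d}$ is convergence in distribution and $\mathcal{CN}(0,1)$ is the standard complex normal distribution (mean 0, variance 1: real and imaginary parts are independent real normals with mean $0$ and variance $1/2$). The parameters $q$ and $z$ may vary arbitrarily with $N$: the limit is along arbitrary sequences of triples $(q,N,z)$ with $N\to\infty$ and $N^{1/2}/z\to0$. *)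

(* Defs.v *)
From HB Require Import structures.
From mathcomp Require Import all_boot all_order all_algebra all_field.
From mathcomp Require Import complex.
From mathcomp Require Import all_classical all_reals all_analysis.

Set Implicit Arguments.
Unset Strict Implicit.
Unset Printing Implicit Defensive.

Import Order.TTheory GRing.Theory Num.Theory.
Import numFieldNormedType.Exports.

Local Open Scope classical_set_scope.
Local Open Scope ring_scope.

Definition monic_irreducible (k : fieldType) (P : {poly k}) : Prop :=
  P \is monic /\ irreducible_poly P.

(* Every monic irreducible divisor of F != 0 has size at most size F and degree
   at most deg F, so neither the finite index type nor the default value deg F
   affects the minimum when deg F >= 1.  For constant F the convention is 0. *)
Definition Pminus (k : finFieldType) (F : {poly k}) : nat :=
  \big[minn/(size F).-1]_(P : {poly_(size F) k} |
      [&& (P : {poly k}) \is monic, irreducibleb P & (P : {poly k}) %| F])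
    (size (P : {poly k})).-1.

Definition monic_of_degree (k : finFieldType) (N : nat) :
    {set {poly_(N.+1) k}} :=
  [set F : {poly_(N.+1) k} |
    ((F : {poly k}) \is monic) && (size (F : {poly k}) == N.+1)]%SET.

Definition rough (k : finFieldType) (N z : nat) : {set {poly_(N.+1) k}} :=
  [set F in monic_of_degree k N | (z < Pminus (F : {poly k}))%N]%SET.

Section ComplexProbability.
Variable R : realType.

(* C is identified with R * R, which carries the Borel sigma-algebra and the
   Euclidean topology. *)
Definition plane (x : R[i]) : R * R := (complex.Re x, complex.Im x).

Lemma two_pi_gt0 : (0 : R) < pi *+ 2.
Proof. by rewrite mulrn_wgt0 // pi_gt0. Qed.

Definition unit_circle_law : set (R * R) -> \bar R :=
  pushforward (uniform_prob two_pi_gt0) (fun t : R => (cos t, sin t)).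

(* The second parameter of normal_prob is the standard deviation.  The type
   measurableTypeR R is R with the same Borel sets; it is the type over which
   the library builds normal_prob. *)
Definition standard_complex_normal :
    probability (measurableTypeR R * measurableTypeR R)%type R :=
  (normal_prob (0 : R) (Num.sqrt 2^-1) \x normal_prob (0 : R) (Num.sqrt 2^-1))%E.

Definition mutually_independent d (T : measurableType d) (P : probability T R)
    d' (U : measurableType d') (I : eqType) (D : set I) (X : I -> T -> U) :
    Prop :=
  forall (s : seq I) (B : I -> set U),
    uniq s -> (forall i, i \in s -> D i) ->
    (forall i, i \in s -> measurable (B i)) ->
    P (\bigcap_(i in [set` s]) (X i @^-1` B i)) =
      (\prod_(i <- s) P (X i @^-1` B i))%E.

(* Only the values of f at monic polynomials are constrained.  The empty
   factorization in the last clause gives f(1) = 1. *)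
Definition steinhaus d (T : measurableType d) (P : probability T R)
    (k : finFieldType) (f : {poly k} -> T -> R[i]) : Prop :=
  [/\ forall Q, monic_irreducible Q ->
        measurable_fun [set: T] (fun w => plane (f Q w)),
      mutually_independent P (@monic_irreducible k)
        (fun Q w => plane (f Q w)),
      forall Q, monic_irreducible Q ->
        forall B : set (R * R), measurable B ->
        P ((fun w => plane (f Q w)) @^-1` B) = unit_circle_law B
    & forall s : seq ({poly k} * nat),
        uniq [seq Qa.1 | Qa <- s] ->
        (forall Qa, Qa \in s -> monic_irreducible Qa.1 /\ (0 < Qa.2)%N) ->
        forall w, f (\prod_(Qa <- s) Qa.1 ^+ Qa.2) w =
          \prod_(Qa <- s) f Qa.1 w ^+ Qa.2].

(* The random elements may live on different probability spaces. *)
Definition cvg_in_distribution (d : nat -> measure_display)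
    (T : forall n, measurableType (d n)) (P : forall n, probability (T n) R)
    (X : forall n, T n -> R[i])
    (mu : probability (measurableTypeR R * measurableTypeR R)%type R) : Prop :=
  forall g : R * R -> R, continuous g ->
    (exists M : R, forall x, `|g x| <= M) ->
    (fun n => 'E_(P n)[fun w => g (plane (X n w))])%E @ \oo -->
      (\int[mu]_x (g x)%:E)%E.

End ComplexProbability.

(* Main.v *)
(* By unique factorization the rough polynomials of degree N are the products of
   irreducibles P_i of degree > z; those divisible by a square are few, so up to an
   L^2-small error the sum is S = sum_I prod_(i in I) x_i over sets I of total
   degree N, where x_i = f(P_i).  Grouping the sets by their largest index j writes
   Re(alpha S) as a sum of martingale differences X_j = Re(x_j Y_j), with Y_j a
   function of the x_i, i < j, and conditional variance |Y_j|^2 / 2.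

   The characteristic function of such a sum is close to that of a normal variable
   as soon as the conditional variance concentrates and sum_j E |Y_j|^4 is small.
   By orthogonality both are controlled by the number of quadruples of sets with
   1_I + 1_J = 1_K + 1_L, max I = max K, max J = max L and I <> K.  Splitting
   the sets into their common parts bounds this number by the sum over n of
   (R(n) R(N - n))^2, where R(m) <= q^m / z is the number of sets of total degree m;
   this is at most N q^(2N) / z^4.  On the other hand the rough polynomials number
   at least q^N / (8 z), so the relative error is O(N / z^2 + z^3 / 2^z).

   Finally, by Bernstein approximation in (1 + sin (c x)) / 2 and second moment
   tightness, convergence of the expectations of cos (s X + t Y + e) to their
   Gaussian values implies convergence in distribution. *)
Require Import Defs.
From HB Require Import structures.
From mathcomp Require Import all_boot all_order all_algebra all_field.
From mathcomp Require Import complex.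
From mathcomp Require Import all_classical all_reals all_analysis.
From mathcomp Require Import measurable_realfun.
From mathcomp Require Import zify ring lra.
Set Implicit Arguments.
Unset Strict Implicit.
Unset Printing Implicit Defensive.
Import Order.TTheory GRing.Theory Num.Theory.
Import numFieldNormedType.Exports.
Local Open Scope classical_set_scope.
Local Open Scope ring_scope.
Local Open Scope complex_scope.

(** * Expectations of bounded random variables *)

(** The irreducibles, their number and the probability spaces all change with n, so no limit theorem
    for one fixed sequence of variables applies: every estimate is an explicit inequality for a
    single triple (q, N, z), and the final bounds are uniform in q because only q >= 2 enters them.
    The error term N / z^2, which comes from the quadruples, is where N^(1/2) = o(z) is needed.
    Conditional expectations are never formed. It is enough that E (H x_j^a) = 0 for a > 0 and every
    bounded H depending on the x_i with i < j. Since |x_j| = 1, this single fact yields the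
    martingale property, the conditional variance and the orthogonality of all monomials.
    Characteristic functions appear as real expectations of cos (s X + t Y + e), whose free phase e
    replaces the complex exponential. The inequality |X| <= (eta + X^2 / eta) / 2 takes the place of
    Cauchy-Schwarz; its parameter eta stays free until the limit, where eta is chosen small first
    and n large afterwards. *)

Section BoundedMeasurable.
Context {R : realType}.

(** The variables of the proof are mostly polynomials in unit complex numbers and bounded functions
    of them. A pointwise bound makes them integrable under every probability and survives sums and
    products. *)
Definition bmeas d (T : measurableType d) (X : T -> R) : Prop :=
  measurable_fun [set: T] X /\ exists M : R, forall x, `|X x| <= M.

Section Closure.
Context d (T : measurableType d).
Implicit Types (X Y : T -> R).

Lemma bmeas_cst (c : R) : bmeas (fun _ : T => c).
Proof. by split; [exact: measurable_cst | exists `|c|]. Qed.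

Lemma bmeasD X Y : bmeas X -> bmeas Y -> bmeas (fun x => X x + Y x).
Proof.
move=> [mX [M hM]] [mY [M' hM']]; split; first exact: measurable_funD.
exists (M + M') => x; apply: le_trans (ler_normD _ _) _.
by rewrite lerD.
Qed.

Lemma bmeasM X Y : bmeas X -> bmeas Y -> bmeas (fun x => X x * Y x).
Proof.
move=> [mX [M hM]] [mY [M' hM']]; split; first exact: measurable_funM.
by exists (M * M') => x; rewrite normrM ler_pM.
Qed.

Lemma bmeasN X : bmeas X -> bmeas (fun x => - X x).
Proof.
move=> hX; rewrite (_ : (fun x => _) = (fun x => -1 * X x)); last first.
  by apply/funext => x; rewrite mulN1r.
exact: bmeasM (bmeas_cst _) hX.
Qed.

Lemma bmeasB X Y : bmeas X -> bmeas Y -> bmeas (fun x => X x - Y x).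
Proof. by move=> hX hY; apply: bmeasD hX (bmeasN hY). Qed.

Lemma bmeas_sum (I : Type) (s : seq I) (P : pred I) (F : I -> T -> R) :
  (forall i, P i -> bmeas (F i)) -> bmeas (fun x => \sum_(i <- s | P i) F i x).
Proof.
move=> h; elim: s => [|i s IH].
  by under eq_fun do rewrite big_nil; exact: bmeas_cst.
under eq_fun do rewrite big_cons.
case: (boolP (P i)) => // /h hi; exact: bmeasD.
Qed.

Lemma bmeas_sum_in (I : eqType) (s : seq I) (P : pred I) (F : I -> T -> R) :
  (forall i, i \in s -> P i -> bmeas (F i)) ->
  bmeas (fun x => \sum_(i <- s | P i) F i x).
Proof.
move=> h; rewrite (_ : (fun x => _) =
  (fun x => \sum_(i <- s | (i \in s) && P i) F i x)); last first.
  by apply/funext => x; rewrite big_seq_cond.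
by apply: bmeas_sum => i /andP[]; exact: h.
Qed.

Lemma bmeasX X n : bmeas X -> bmeas (fun x => X x ^+ n).
Proof.
move=> hX; elim: n => [|n IH]; first by under eq_fun do rewrite expr0; exact: bmeas_cst.
by under eq_fun do rewrite exprS; exact: bmeasM.
Qed.

Lemma bmeas_norm X : bmeas X -> bmeas (fun x => `|X x|).
Proof.
move=> [mX [M hM]]; split; first exact: measurableT_comp.
by exists M => x; rewrite normr_id.
Qed.

Lemma bmeas_comp (h : R -> R) (M : R) X : continuous h -> (forall y, `|h y| <= M) ->
  measurable_fun setT X -> bmeas (fun x => h (X x)).
Proof.
move=> ch hM mX; split; last by exists M.
by apply: measurableT_comp => //; exact: continuous_measurable_fun.
Qed.

Lemma bmeas_cos X : measurable_fun setT X -> bmeas (fun x => cos (X x)).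
Proof. by apply: bmeas_comp => [|y]; [exact: continuous_cos | exact: cos_max]. Qed.

Lemma bmeas_sin X : measurable_fun setT X -> bmeas (fun x => sin (X x)).
Proof. by apply: bmeas_comp => [|y]; [exact: continuous_sin | exact: sin_max]. Qed.

Lemma eq_bmeas X Y : X =1 Y -> bmeas X -> bmeas Y.
Proof. by move=> /funext ->. Qed.

End Closure.

Section Expectation.
Context d (T : measurableType d) (P : probability T R).
Implicit Types (X Y : T -> R).

Definition esp X : R := \int[P]_x X x.

Lemma bmeas_integrable X : bmeas X -> P.-integrable setT (EFin \o X).
Proof.
move=> [mX [M hM]]; apply: measurable_bounded_integrable => //.
  by rewrite -ge0_fin_numE// fin_num_measure.
by exists M; split => [|y My x _]; [exact: num_real | apply: le_trans (hM x) (ltW My)].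
Qed.

Lemma bmeas_expectation X : bmeas X -> ('E_P[X])%E = (esp X)%:E.
Proof.
move=> /bmeas_integrable hX; rewrite unlock /esp /Rintegral fineK//.
exact: integrable_fin_num.
Qed.

Lemma esp_cst c : esp (fun _ => c) = c.
Proof.
rewrite /esp Rintegral_cst// (_ : fine _ = 1) ?mulr1//.
by have /= -> := probability_setT P.
Qed.

Lemma eq_esp X Y : X =1 Y -> esp X = esp Y. Proof. by move=> /funext ->. Qed.

Lemma espD X Y : bmeas X -> bmeas Y -> esp (fun x => X x + Y x) = esp X + esp Y.
Proof. by move=> hX hY; apply: RintegralD => //; exact: bmeas_integrable. Qed.

Lemma espB X Y : bmeas X -> bmeas Y -> esp (fun x => X x - Y x) = esp X - esp Y.
Proof. by move=> hX hY; apply: RintegralB => //; exact: bmeas_integrable. Qed.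

Lemma espZ c X : bmeas X -> esp (fun x => c * X x) = c * esp X.
Proof. by move=> hX; apply: RintegralZl => //; exact: bmeas_integrable. Qed.

Lemma esp_sum (I : Type) (s : seq I) (p : pred I) (F : I -> T -> R) :
  (forall i, p i -> bmeas (F i)) ->
  esp (fun x => \sum_(i <- s | p i) F i x) = \sum_(i <- s | p i) esp (F i).
Proof.
move=> h; elim: s => [|i s IH].
  by rewrite big_nil -[RHS]esp_cst; apply: eq_esp => x; rewrite big_nil.
rewrite big_cons -IH.
rewrite (@eq_esp _ (fun x => if p i then F i x + \sum_(j <- s | p j) F j x
   else \sum_(j <- s | p j) F j x)); last by move=> x; rewrite big_cons.
by case: ifP => // /h hi; rewrite espD//; exact: bmeas_sum.
Qed.

Lemma le_esp X Y : bmeas X -> bmeas Y -> (forall x, X x <= Y x) -> esp X <= esp Y.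
Proof. by move=> hX hY hXY; apply: le_Rintegral => //; exact: bmeas_integrable. Qed.

Lemma esp_norm X : bmeas X -> `|esp X| <= esp (fun x => `|X x|).
Proof. by move=> hX; apply: le_normr_Rintegral => //; exact: bmeas_integrable. Qed.

(** Follows from [0 <= (|X| - c) ^+ 2]. It passes from second to first moments without square roots;
    [c] later becomes the free parameter [eta]. *)
Lemma esp_abs_le X (c : R) : 0 < c -> bmeas X ->
  esp (fun x => `|X x|) <= (c + esp (fun x => X x ^+ 2) / c) / 2.
Proof.
move=> c0 hX; have hX2 := bmeasX 2 hX.
rewrite -{1}(esp_cst c) -[X in _ + X]mulrC -espZ// -espD; last 2 first.
- exact: bmeas_cst.
- exact: bmeasM (bmeas_cst _ _) _.
rewrite mulrC -espZ; last by apply: bmeasD (bmeas_cst _ _) (bmeasM (bmeas_cst _ _) _).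
apply: le_esp => [||x].
- exact: bmeas_norm.
- by apply: bmeasM (bmeas_cst _ _) (bmeasD (bmeas_cst _ _) (bmeasM (bmeas_cst _ _) _)).
rewrite -(@real_normK _ (X x)) ?num_real//.
set a := `|X x|; rewrite -(ler_pM2r c0).
suff : 0 <= (a - c) ^+ 2 / 2.
  have -> : 2^-1 * (c + c^-1 * a ^+ 2) * c = 2^-1 * (c ^+ 2 + a ^+ 2).
    by field; rewrite gt_eqF.
  by move=> h; rewrite -subr_ge0; apply: le_trans h _; rewrite le_eqVlt; apply/orP; left; apply/eqP; field.
by rewrite divr_ge0// sqr_ge0.
Qed.

End Expectation.

(** * Independence, from generators to generated sigma-algebras *)

Section Independence.
Context d (T : measurableType d) (P : probability T R).
Context d1 (U1 : measurableType d1) d2 (U2 : measurableType d2).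
Variables (X : T -> U1) (Y : T -> U2).
Hypotheses (mX : measurable_fun setT X) (mY : measurable_fun setT Y).
Hypothesis XY : forall A B, measurable A -> measurable B ->
  P ((X @^-1` A) `&` (Y @^-1` B)) = (P (X @^-1` A) * P (Y @^-1` B))%E.

Let X' : {mfun T >-> U1} := HB.pack X (isMeasurableFun.Build _ _ _ _ X mX).
Let Y' : {mfun T >-> U2} := HB.pack Y (isMeasurableFun.Build _ _ _ _ Y mY).
Let mZ : measurable_fun setT (fun x => (X x, Y x)).
Proof. exact: measurable_fun_pair. Qed.
Let Z' : {mfun T >-> (U1 * U2)%type} :=
  HB.pack (fun x => (X x, Y x)) (isMeasurableFun.Build _ _ _ _ _ mZ).

(** The law of the pair agrees with the product of the laws on rectangles, hence everywhere, and
    Fubini's theorem splits the integral. *)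
Lemma esp_indep (h1 : U1 -> R) (h2 : U2 -> R) : bmeas h1 -> bmeas h2 ->
  esp P (fun x => h1 (X x) * h2 (Y x)) =
  esp P (fun x => h1 (X x)) * esp P (fun x => h2 (Y x)).
Proof.
move=> b1 b2; pose h (u : U1 * U2) := h1 u.1 * h2 u.2.
have bh : bmeas h.
  case: b1 b2 => m1 [M1 hM1] [m2 [M2 hM2]]; split.
    by apply: measurable_funM; apply: measurableT_comp.
  by exists (M1 * M2) => u; rewrite normrM ler_pM.
have push d' (U : measurableType d') (W : {mfun T >-> U}) (g : U -> R) : bmeas g ->
    esp P (fun x => g (W x)) = esp (distribution P W) g.
  move=> bg; rewrite /esp /Rintegral integral_distribution//.
    by apply/measurable_EFinP; case: bg.
  apply: (@bmeas_integrable _ _ _ (fun x => g (W x))).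
  case: bg => mg [M hM]; split; last by exists M.
  by apply: measurableT_comp.
rewrite (push _ _ X' h1 b1) (push _ _ Y' h2 b2) (push _ _ Z' h bh).
pose m1 : probability U1 R := distribution P X'.
pose m2 : probability U2 R := distribution P Y'.
rewrite -[RHS]/(esp m1 h1 * esp m2 h2).
have -> : esp (distribution P Z') h = \int[(m1 \x m2)%E]_u h u.
  congr fine; apply: eq_measure_integral => A mA _ /=.
  exact/esym/product_measure_unique.
have ih : (m1 \x m2)%E.-integrable setT (EFin \o h).
  exact: bmeas_integrable.
rewrite /Rintegral -integral12_prod_meas1//= /fubini_F.
under eq_integral => x _.
  rewrite (_ : (\int[m2]_y _)%E = (h1 x * esp m2 h2)%:E); last first.
    rewrite -espZ// /esp /Rintegral fineK//.
    by apply: integrable_fin_num => //; apply: bmeas_integrable; exact: bmeasM (bmeas_cst _ _) _.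
  over.
rewrite [RHS]mulrC -espZ// /esp /Rintegral.
by congr fine; apply: eq_integral => x _; rewrite mulrC.
Qed.

End Independence.

(** [esp_indep] is applied with [X] the identity from [T] to [T] equipped with the sigma-algebra
    generated by [G], so that [H] itself plays the part of [h1]. *)
Lemma esp_indep_sigma d (T : measurableType d) (P : probability T R) (G : set (set T))
    d' (U : measurableType d') (Y : T -> U) (H : T -> R) (h : U -> R) :
  setI_closed G -> G setT -> G `<=` measurable -> measurable_fun setT Y ->
  (forall A B, G A -> measurable B ->
     P (A `&` (Y @^-1` B)) = (P A * P (Y @^-1` B))%E) ->
  bmeas (H : g_sigma_algebraType G -> R) -> bmeas h ->
  esp P (fun x => H x * h (Y x)) = esp P H * esp P (fun x => h (Y x)).
Proof.
move=> GI GT Gm mY ind bH bh.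
have sGm : <<s G >> `<=` measurable.
  by apply: smallest_sub => //; exact: sigma_algebra_measurable.
apply: (@esp_indep _ T P _ (g_sigma_algebraType G) _ U id Y) => //.
  by move=> _ A mA; rewrite setTI; exact: sGm.
move=> A B mA mB; rewrite preimage_id.
have mYB : measurable (Y @^-1` B) by rewrite -[_ @^-1` _]setTI; exact: mY.
have c0 : 0 <= fine (P (Y @^-1` B)) by rewrite fine_ge0.
rewrite -[P (Y @^-1` B)]fineK ?fin_num_measure// muleC.
(* Both sides are finite measures in [A], a restriction and a multiple of [P]; agreeing on the
   pi-system [G], they agree on the sigma-algebra it generates. *)
rewrite -[LHS]/(mrestr P mYB A) -[RHS]/(mscale (NngNum c0) P A).
apply: (g_sigma_algebra_measure_unique G Gm (fun=> setT)) => //.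
- by rewrite bigcup_const.
- move=> C GC; apply: eq_trans (ind C B GC mB) _.
  by rewrite -[X in (_ * X)%E]fineK ?fin_num_measure// muleC.
- move=> _; have : (P (setT `&` Y @^-1` B) < +oo)%E by
    rewrite setTI -ge0_fin_numE// fin_num_measure.
  by [].
Qed.

End BoundedMeasurable.

(** * A martingale estimate for characteristic functions *)

Section TaylorCos.
Context {R : realType}.

(** The Taylor bounds below form a ladder: each one, multiplied by a constant to clear denominators,
    has for derivative the bound proved just before. *)
Lemma derive_ge0_le (f df : R -> R) : (forall x : R, is_derive x 1 f (df x)) ->
  (forall x : R, 0 <= x -> 0 <= df x) -> forall x : R, 0 <= x -> f 0 <= f x.
Proof.
move=> hf hdf x x0.
have cf : {within `[0, x], continuous f}.
  apply: continuous_subspaceT => y.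
  by apply/differentiable_continuous/derivable1_diffP; case: (hf y).
have [c] := MVT_segment x0 (fun y _ => hf y) cf.
rewrite in_itv/= subr0 => /andP[c0 _] h; rewrite -subr_ge0 h mulr_ge0// hdf//.
Qed.

Lemma sin_le_id (x : R) : 0 <= x -> sin x <= x.
Proof.
move=> x0; have D (y : R) : is_derive y 1 (id - @sin R) (1 - cos y).
  by apply: is_derive_eq.
have := derive_ge0_le D; rewrite !fctE sin0 subr0 => /(_ _ x x0).
by rewrite subr_ge0; apply=> y _; rewrite subr_ge0 cos_le1.
Qed.

Lemma cos_ge_deg2 (x : R) : 0 <= x -> 1 - x ^+ 2 / 2 <= cos x.
Proof.
move=> x0.
have D (y : R) : is_derive y 1 (fun z : R => z ^+ 2 + cos z + cos z : R) (2 * (y - sin y)).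
  by apply: is_derive_eq; rewrite /GRing.scale/=; ring.
have := derive_ge0_le D _ x0; rewrite cos0 expr0n/= add0r => h.
suff : 1 + 1 <= x ^+ 2 + cos x + cos x :> R by lra.
by apply: h => y y0; rewrite mulr_ge0// subr_ge0 sin_le_id.
Qed.

Lemma sin_ge_deg3 (x : R) : 0 <= x -> x - x ^+ 3 / 6 <= sin x.
Proof.
move=> x0.
have D (y : R) : is_derive y 1 (fun z : R => z ^+ 3 + 6 * (sin z - z) : R)
    (3 * y ^+ 2 + 6 * (cos y - 1)).
  by apply: is_derive_eq; rewrite /GRing.scale/=; ring.
have := derive_ge0_le D _ x0; rewrite sin0 expr0n/= subrr mulr0 addr0 => h.
suff : 0 <= x ^+ 3 + 6 * (sin x - x) :> R by lra.
by apply: h => y y0; have := cos_ge_deg2 y0; lra.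
Qed.

Lemma cos_le_deg4 (x : R) : 0 <= x -> cos x <= 1 - x ^+ 2 / 2 + x ^+ 4 / 24.
Proof.
move=> x0.
have D (y : R) : is_derive y 1 (fun z : R => z ^+ 4 + 12 * (- z ^+ 2) - 24 * cos z : R)
    (4 * (y ^+ 3 - 6 * y) + 24 * sin y).
  by apply: is_derive_eq; rewrite /GRing.scale/=; ring.
have := derive_ge0_le D _ x0; rewrite cos0 !expr0n/= oppr0 mulr0 addr0 => h.
suff : 0 - 24 * 1 <= x ^+ 4 + 12 * (- x ^+ 2) - 24 * cos x :> R by lra.
by apply: h => y y0; have := sin_ge_deg3 y0; lra.
Qed.

Lemma sin_taylor (x : R) : `|sin x - x| <= `|x| ^+ 3.
Proof.
wlog x0 : x / 0 <= x => [h|].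
  have [/h//|xlt0] := lerP 0 x; have := h (- x).
  by rewrite oppr_ge0 ltW// sinN -opprB opprK addrC !normrN => /(_ isT).
rewrite ler0_norm ?subr_le0 ?sin_le_id// ger0_norm//.
have := sin_ge_deg3 x0; have : 0 <= x ^+ 3 by rewrite exprn_ge0.
lra.
Qed.

Lemma cos_taylor (x : R) : `|cos x - (1 - x ^+ 2 / 2)| <= x ^+ 4.
Proof.
wlog x0 : x / 0 <= x => [h|].
  have [/h//|xlt0] := lerP 0 x; have := h (- x).
  have -> : (- x) ^+ 4 = x ^+ 4 by rewrite !(exprM _ 2 2) sqrrN.
  by rewrite oppr_ge0 ltW// cosN sqrrN => /(_ isT).
rewrite ger0_norm ?subr_ge0 ?cos_ge_deg2//.
have := cos_le_deg4 x0; have : 0 <= x ^+ 4 by rewrite exprn_ge0.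
lra.
Qed.

Lemma cosD_taylor (s x : R) :
  `|cos (s + x) - (cos s * (1 - x ^+ 2 / 2) - sin s * x)| <= `|x| ^+ 3 + x ^+ 4.
Proof.
rewrite cosD (_ : _ - _ = cos s * (cos x - (1 - x ^+ 2 / 2)) - sin s * (sin x - x)); last by ring.
rewrite addrC; apply: le_trans (ler_normD _ _) _; rewrite normrN !normrM.
apply: lerD.
  by rewrite (le_trans _ (sin_taylor x))// ler_piMl// sin_max.
by rewrite (le_trans _ (cos_taylor x))// ler_piMl// cos_max.
Qed.

(* The compensator exp (u - c), clipped because the quadratic variation u is
   close to c only with high probability. *)
Definition clipexp (c u : R) : R := expR (Num.min (u - c) 0).

Lemma clipexp_ge0 c u : 0 <= clipexp c u. Proof. exact: expR_ge0. Qed.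

Lemma clipexp_le1 c u : clipexp c u <= 1.
Proof. by rewrite -expR0 ler_expR ge_min lexx orbT. Qed.

Lemma continuous_clipexp c : continuous (clipexp c).
Proof.
move=> u; apply: continuous_comp; last exact: continuous_expR.
apply: continuous_min; last exact: cst_continuous.
by apply: cvgB; [exact: cvg_id|exact: cvg_cst].
Qed.

Lemma clipexp0 c : 0 <= c -> clipexp c 0 = expR (- c).
Proof. by move=> c0; rewrite /clipexp sub0r min_l// oppr_le0. Qed.

Lemma clipexp_near1 c u : `|1 - clipexp c u| <= `|u - c|.
Proof.
rewrite ger0_norm ?subr_ge0 ?clipexp_le1// lerBlDr -lerBlDl.
apply: le_trans (expR_ge1Dx _); rewrite lerD2l.
by rewrite le_min oppr_le0 normr_ge0 andbT lerNl -normrN ler_norm.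
Qed.

Lemma expRN_taylor (x : R) : 0 <= x -> `|1 - x - expR (- x)| <= x ^+ 2.
Proof.
move=> x0; have h1 := expR_ge1Dx (- x); have h2 := expR_ge1Dx x.
have e0 := expR_gt0 (- x).
have h3 : expR (- x) * (1 + x) <= 1.
  by rewrite -[leRHS](expRxMexpNx_1 x) mulrC ler_pM2r.
rewrite ler0_norm; last lra.
have : 0 <= x * (expR (- x) - (1 - x)) by rewrite mulr_ge0//; lra.
rewrite expr2; lra.
Qed.

(** Below the level [c] the error is that of [1 - x] against [expR (- x)]; above it the clipped
    function is constant and the error is the part of the step beyond [c]. That part is written as a
    difference so that its sum telescopes. *)
Lemma clipexp_step (c u x : R) : 0 <= x ->
  `|clipexp c (u + x) * (1 - x) - clipexp c u| <=
  x ^+ 2 + (Num.max (u + x - c) 0 - Num.max (u - c) 0).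
Proof.
move=> x0; rewrite /clipexp.
have [uc|cu] := lerP (u + x - c) 0.
  have uc' : u - c <= 0 by lra.
  rewrite (min_l uc') (max_r uc') subrr addr0.
  rewrite (_ : u - c = (u + x - c) - x); last by ring.
  rewrite [X in _ - X]expRD -mulrBr normrM ger0_norm ?expR_ge0//.
  apply: le_trans (expRN_taylor x0); rewrite ler_piMl//.
  by rewrite -expR0 ler_expR.
rewrite expR0 mul1r.
have [uc|cu'] := lerP (u - c) 0; last first.
  rewrite expR0.
  rewrite (_ : 1 - x - 1 = - x); last by ring.
  rewrite normrN ger0_norm//.
  have := sqr_ge0 x; lra.
rewrite subr0.
have y0 : 0 <= c - u by lra.
have := expRN_taylor y0; rewrite [X in expR X]opprB.
set e := expR _ => h.
rewrite (_ : 1 - x - e = (1 - (c - u) - e) - (u + x - c)); last by ring.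
apply: le_trans (ler_normB _ _) _; apply: lerD; last by rewrite ger0_norm// ltW.
by apply: le_trans h _; rewrite lerXn2r ?nnegrE//; lra.
Qed.

End TaylorCos.

(** * Squared moduli and orthogonality of monomials in unit variables *)

Section ComplexValued.
Context {R : realType}.
Local Notation C := R[i].
Local Notation re := (@complex.Re R).
Local Notation im := (@complex.Im R).

(** Real-valued, unlike the norm of [R[i]], whose values lie in [R[i]]. *)
Definition normsq (u : C) : R := re u ^+ 2 + im u ^+ 2.

Lemma reM (u v : C) : re (u * v) = re u * re v - im u * im v.
Proof. by case: u v => a b [c e]. Qed.
Lemma imM (u v : C) : im (u * v) = re u * im v + im u * re v.
Proof. by case: u v => a b [c e]. Qed.
Lemma reD (u v : C) : re (u + v) = re u + re v.
Proof. by case: u v => a b [c e]. Qed.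
Lemma imD (u v : C) : im (u + v) = im u + im v.
Proof. by case: u v => a b [c e]. Qed.
Lemma re_conj (u : C) : re (conjc u) = re u. Proof. by case: u. Qed.
Lemma im_conj (u : C) : im (conjc u) = - im u. Proof. by case: u. Qed.
Lemma re1 : re 1 = 1. Proof. by []. Qed.
Lemma im1 : im 1 = 0. Proof. by []. Qed.

Lemma re_sum (I : Type) (s : seq I) (P : pred I) (F : I -> C) :
  re (\sum_(i <- s | P i) F i) = \sum_(i <- s | P i) re (F i).
Proof. exact: (big_morph _ reD). Qed.
Lemma complexP (u v : C) : re u = re v -> im u = im v -> u = v.
Proof. by case: u v => a b [c e] /= -> ->. Qed.

Lemma normsq_ge0 u : 0 <= normsq u.
Proof. by rewrite addr_ge0// sqr_ge0. Qed.

Lemma normsqE u : normsq u = re (u * conjc u).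
Proof. by rewrite reM re_conj im_conj mulrN opprK -!expr2. Qed.

Lemma normsqM u v : normsq (u * v) = normsq u * normsq v.
Proof. by rewrite /normsq reM imM; ring. Qed.

Lemma normsqX u n : normsq (u ^+ n) = normsq u ^+ n.
Proof.
elim: n => [|n IH]; first by rewrite !expr0 /normsq expr1n expr0n addr0.
by rewrite !exprS normsqM IH.
Qed.

Lemma mul_conj_unit u : normsq u = 1 -> u * conjc u = 1.
Proof.
rewrite normsqE => h; apply: complexP; rewrite ?re1 ?im1//.
by rewrite imM re_conj im_conj mulrN mulrC addNr.
Qed.

Definition cbmeas d (T : measurableType d) (Z : T -> C) : Prop :=
  bmeas (fun x => re (Z x)) /\ bmeas (fun x => im (Z x)).

Section Closure.
Context d (T : measurableType d).
Implicit Types (Y Z : T -> C).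

Lemma cbmeas_cst (c : C) : cbmeas (fun _ : T => c).
Proof. by split; exact: bmeas_cst. Qed.

Lemma cbmeasD Y Z : cbmeas Y -> cbmeas Z -> cbmeas (fun x => Y x + Z x).
Proof.
move=> [a b] [c e]; split.
  by under eq_fun do rewrite reD; exact: bmeasD.
by under eq_fun do rewrite imD; exact: bmeasD.
Qed.

Lemma cbmeasM Y Z : cbmeas Y -> cbmeas Z -> cbmeas (fun x => Y x * Z x).
Proof.
move=> [a b] [c e]; split.
  by under eq_fun do rewrite reM; apply: bmeasB; exact: bmeasM.
by under eq_fun do rewrite imM; apply: bmeasD; exact: bmeasM.
Qed.

Lemma cbmeas_conj Z : cbmeas Z -> cbmeas (fun x => conjc (Z x)).
Proof.
move=> [a b]; split; first by under eq_fun do rewrite re_conj.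
by under eq_fun do rewrite im_conj; exact: bmeasN.
Qed.

Lemma cbmeasX Z n : cbmeas Z -> cbmeas (fun x => Z x ^+ n).
Proof.
move=> h; elim: n => [|n IH].
  by under eq_fun do rewrite expr0; exact: cbmeas_cst.
by under eq_fun do rewrite exprS; exact: cbmeasM.
Qed.

Lemma cbmeas_sum (I : Type) (s : seq I) (P : pred I) (F : I -> T -> C) :
  (forall i, P i -> cbmeas (F i)) -> cbmeas (fun x => \sum_(i <- s | P i) F i x).
Proof.
move=> h; elim: s => [|i s IH].
  by under eq_fun do rewrite big_nil; exact: cbmeas_cst.
under eq_fun do rewrite big_cons.
case: (boolP (P i)) => // /h hi; exact: cbmeasD.
Qed.

Lemma cbmeas_prod_in (I : eqType) (s : seq I) (P : pred I) (F : I -> T -> C) :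
  (forall i, i \in s -> P i -> cbmeas (F i)) -> cbmeas (fun x => \prod_(i <- s | P i) F i x).
Proof.
elim: s => [|i s IH] h.
  by under eq_fun do rewrite big_nil; exact: cbmeas_cst.
under eq_fun do rewrite big_cons.
have {}IH : cbmeas (fun x => \prod_(i <- s | P i) F i x).
  by apply: IH => j js; apply: h; rewrite in_cons js orbT.
case: (boolP (P i)) => // Pi; apply: cbmeasM => //.
by apply: h => //; rewrite mem_head.
Qed.

Lemma bmeas_normsq Z : cbmeas Z -> bmeas (fun x => normsq (Z x)).
Proof. by move=> [a b]; apply: bmeasD; exact: bmeasX. Qed.

End Closure.

Section Filtration.
Context d (T : measurableType d) (P : probability T R).
Variables (r : nat) (F : nat -> set (set T)) (x : nat -> T -> C).
Implicit Types (X : T -> R) (Y Z : T -> C).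

Definition adapted j X : Prop := bmeas (X : g_sigma_algebraType (F j) -> R).
Definition cadapted j Z : Prop := cbmeas (Z : g_sigma_algebraType (F j) -> C).

Hypothesis F_measurable : forall j, F j `<=` measurable.
Hypothesis F_mono : forall i j, (i <= j)%N -> F i `<=` F j.
Hypothesis x_unit : forall j w, normsq (x j w) = 1.
Hypothesis x_adapted : forall i j, (i < j)%N -> cadapted j (x i).
(* x_j is independent of F_j and has vanishing moments, as for the uniform law
   on the circle. *)
Hypothesis x_orth : forall j a H, (j < r)%N -> (0 < a)%N -> adapted j H ->
  esp P (fun w => H w * re (x j w ^+ a)) = 0 /\
  esp P (fun w => H w * im (x j w ^+ a)) = 0.

Lemma sub_bmeas (G G' : set (set T)) X : G `<=` <<s G' >> ->
  bmeas (X : g_sigma_algebraType G -> R) -> bmeas (X : g_sigma_algebraType G' -> R).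
Proof.
move=> GG' [mX bX]; split=> // _ B mB.
have sub : <<s G >> `<=` <<s G' >>.
  by apply: smallest_sub => //; exact: smallest_sigma_algebra.
by apply: sub; exact: mX.
Qed.

Lemma adapted_le i j X : (i <= j)%N -> adapted i X -> adapted j X.
Proof.
move=> ij; apply: sub_bmeas => A FA; apply: sub_sigma_algebra.
exact: F_mono ij _ FA.
Qed.

Lemma cadapted_le i j Z : (i <= j)%N -> cadapted i Z -> cadapted j Z.
Proof. by move=> ij [a b]; split; exact: adapted_le ij _. Qed.

Lemma adapted_bmeas j X : adapted j X -> bmeas X.
Proof.
move=> [mX bX]; split=> // _ B mB.
have sub : <<s F j >> `<=` measurable.
  apply: smallest_sub => //; exact: sigma_algebra_measurable.
by apply: sub; exact: mX.
Qed.

Lemma cadapted_cbmeas j Z : cadapted j Z -> cbmeas Z.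
Proof. by move=> [a b]; split; exact: (@adapted_bmeas j). Qed.

Lemma x_cbmeas j : cbmeas (x j).
Proof. exact: (@cadapted_cbmeas j.+1) (x_adapted (ltnSn j)). Qed.

Lemma esp_re_mulx j a Z : (j < r)%N -> (0 < a)%N -> cadapted j Z ->
  esp P (fun w => re (Z w * x j w ^+ a)) = 0.
Proof.
move=> jr a0 [h1 h2].
have [e1 _] := x_orth jr a0 h1; have [_ e2] := x_orth jr a0 h2.
under eq_esp do rewrite reM.
have [b1 b2] := cbmeasX a (x_cbmeas j).
rewrite espB ?e1 ?e2 ?subr0//; apply: bmeasM => //; exact: (@adapted_bmeas j).
Qed.

Lemma esp_re_mulx_conj j a Z : (j < r)%N -> (0 < a)%N -> cadapted j Z ->
  esp P (fun w => re (Z w * conjc (x j w ^+ a))) = 0.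
Proof.
move=> jr a0 hZ; rewrite -(esp_re_mulx jr a0 (cbmeas_conj hZ)); apply: eq_esp => w.
by rewrite -re_conj rmorphM/= conjcK.
Qed.

Definition monomial n (m : nat -> nat) (w : T) : C := \prod_(0 <= i < n) x i w ^+ m i.
Definition agree n (m m' : nat -> nat) : bool := [forall i : 'I_n, m i == m' i].

Lemma monomial_adapted n m : cadapted n (monomial n m).
Proof.
apply: cbmeas_prod_in => i; rewrite mem_index_iota => /andP[_ ltin] _.
exact: cbmeasX (x_adapted ltin).
Qed.

Lemma monomial_cbmeas n m : cbmeas (monomial n m).
Proof. exact: cadapted_cbmeas (monomial_adapted n m). Qed.

Lemma agreeS n m m' : agree n.+1 m m' = agree n m m' && (m n == m' n).
Proof.
apply/forallP/andP => [h|[/forallP h /eqP e] i].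
  split; last exact: (h ord_max).
  by apply/forallP => i; exact: (h (widen_ord (leqnSn n) i)).
have [ltin|] := ltnP i n; first exact: (h (Ordinal ltin)).
move=> ni; have iE : i = n :> nat by apply/eqP; rewrite eqn_leq ni -ltnS ltn_ord.
by rewrite iE e.
Qed.

(** Induction peels off the last variable. As [x n] has modulus 1, unequal exponents leave a
    positive power of it, or of its conjugate, next to a factor depending on earlier variables, and
    [x_orth] kills the mean; equal exponents cancel. *)
Lemma esp_monomial n m m' : (n <= r)%N ->
  esp P (fun w => re (monomial n m w * conjc (monomial n m' w))) = (agree n m m')%:R.
Proof.
elim: n => [|n IH] nr.
  rewrite (_ : agree _ _ _ = true) /=; last by apply/forallP => -[].
  under eq_esp do rewrite /monomial !big_geq// mul1r re_conj re1.
  by rewrite esp_cst.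
rewrite agreeS.
have e k w : monomial n.+1 k w = monomial n k w * x n w ^+ k n.
  by rewrite /monomial big_nat_recr.
under eq_esp do rewrite !e rmorphM/= mulrACA.
have hZ : cadapted n (fun w => monomial n m w * conjc (monomial n m' w)).
  by apply: cbmeasM; [|apply: cbmeas_conj]; exact: monomial_adapted.
have unit j w : x n w ^+ j * conjc (x n w ^+ j) = 1.
  by rewrite mul_conj_unit// normsqX x_unit expr1n.
case: (ltngtP (m n) (m' n)) => [lt|gt|eq].
- have a0 : (0 < m' n - m n)%N by rewrite subn_gt0.
  rewrite andbF -[RHS](esp_re_mulx_conj nr a0 hZ).
  apply: eq_esp => w; congr (re (_ * _)).
  by rewrite -{1}(subnK (ltnW lt)) exprD rmorphM/= mulrCA unit mulr1.
- have a0 : (0 < m n - m' n)%N by rewrite subn_gt0.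
  rewrite andbF -[RHS](esp_re_mulx nr a0 hZ).
  apply: eq_esp => w; congr (re (_ * _)).
  by rewrite -{1}(subnK (ltnW gt)) exprD -mulrA unit mulr1.
- rewrite andbT -IH 1?ltnW//; apply: eq_esp => w.
  by rewrite eq unit mulr1.
Qed.

(** Second moments become counts of pairs with equal exponents. Fourth moments are obtained in the
    same way, because a product of two such sums is again a sum of monomials. *)
Lemma esp_normsq_sum (I : finType) (A : pred I) (e : I -> nat -> nat) :
  esp P (fun w => normsq (\sum_(i | A i) monomial r (e i) w)) =
  \sum_(i | A i) \sum_(j | A j) (agree r (e i) (e j))%:R.
Proof.
under eq_esp => w.
  rewrite normsqE rmorph_sum/= big_distrlr/= re_sum.
  under eq_bigr do rewrite re_sum.
  over.
have b i j : bmeas (fun w => re (monomial r (e i) w * conjc (monomial r (e j) w))).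
  by apply: (proj1 (cbmeasM (monomial_cbmeas _ _) (cbmeas_conj (monomial_cbmeas _ _)))).
rewrite esp_sum; last by move=> i _; apply: bmeas_sum => j _; exact: b.
apply: eq_bigr => i _; rewrite esp_sum; last by move=> j _; exact: b.
by apply: eq_bigr => j _; exact: esp_monomial.
Qed.

(** * The compensated cosine *)

Section Martingale.
Variables (Y : nat -> T -> C) (theta kappa : R).
Hypothesis Y_adapted : forall j, (j < r)%N -> cadapted j (Y j).
Hypothesis kappa_ge0 : 0 <= kappa.

Let X j w : R := re (x j w * Y j w).
Let D j w : R := normsq (Y j w) / 4.
Let S j w : R := \sum_(0 <= i < j) X i w.
Let U j w : R := \sum_(0 <= i < j) D i w.
Let Phi j w : R := cos (S j w + theta) * clipexp kappa (U j w).

Let D_ge0 j w : 0 <= D j w.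
Proof. by rewrite divr_ge0// normsq_ge0. Qed.

Let X_adapted i j : (i < j)%N -> (j <= r)%N -> adapted j (X i).
Proof.
move=> ij jr; have iler := leq_trans ij jr.
by case: (cbmeasM (x_adapted ij) (cadapted_le (ltnW ij) (Y_adapted iler))).
Qed.

Let D_adapted i j : (i <= j)%N -> (i < r)%N -> adapted j (D i).
Proof.
move=> ij ir; apply: bmeasM (bmeas_normsq (cadapted_le ij (Y_adapted ir))) _.
exact: bmeas_cst.
Qed.

Let S_adapted j : (j <= r)%N -> adapted j (S j).
Proof.
move=> jr; apply: bmeas_sum_in => i; rewrite mem_index_iota => /andP[_ ij] _.
exact: X_adapted.
Qed.

Let U_adapted j : (j < r)%N -> adapted j (U j.+1).
Proof.
move=> jr; apply: bmeas_sum_in => i; rewrite mem_index_iota ltnS => /andP[_ ij] _.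
by apply: D_adapted => //; exact: leq_ltn_trans jr.
Qed.

Let adapted_clip j (H : T -> R) : adapted j H -> adapted j (fun w => clipexp kappa (H w)).
Proof.
move=> [mZ _]; apply: (bmeas_comp (M := 1)) => //; first exact: continuous_clipexp.
by move=> y; rewrite ger0_norm ?clipexp_ge0 ?clipexp_le1.
Qed.

Let ST j : (j <= r)%N -> adapted j (fun w => S j w + theta).
Proof.
by move=> jr; apply: bmeasD; [exact: S_adapted | exact: bmeas_cst].
Qed.

Let sinA j : (j < r)%N -> adapted j (fun w => sin (S j w + theta) * clipexp kappa (U j.+1 w)).
Proof.
move=> jr; apply: bmeasM; last exact: adapted_clip (U_adapted jr).
by apply: bmeas_sin; case: (ST (ltnW jr)).
Qed.

Let cosA j : (j < r)%N -> adapted j (fun w => cos (S j w + theta) * clipexp kappa (U j.+1 w)).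
Proof.
move=> jr; apply: bmeasM; last exact: adapted_clip (U_adapted jr).
by apply: bmeas_cos; case: (ST (ltnW jr)).
Qed.

Let M j w : R := - (sin (S j w + theta) * clipexp kappa (U j.+1 w) * X j w) -
   cos (S j w + theta) * clipexp kappa (U j.+1 w) * (X j w ^+ 2 / 2 - D j w).

(** From Re(u)^2 = (|u|^2 + Re(u^2)) / 2 with u = x_j Y_j: the fluctuation of X_j^2 / 2 around D_j
    carries the second power of x_j and therefore has mean zero. *)
Let X2E j w : X j w ^+ 2 / 2 - D j w = 4^-1 * re (x j w ^+ 2 * Y j w ^+ 2).
Proof.
have := x_unit j w; rewrite /X /D /normsq [x j w ^+ 2]expr2 [Y j w ^+ 2]expr2 !reM !imM.
move: (re (x j w)) (im (x j w)) (re (Y j w)) (im (Y j w)) => a b c e h.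
apply/eqP; rewrite -subr_eq0; apply/eqP.
transitivity ((c ^+ 2 + e ^+ 2) * ((a ^+ 2 + b ^+ 2) - 1) / 4); first by field.
by rewrite h subrr mulr0 mul0r.
Qed.

Let M_bmeas j : (j < r)%N -> bmeas (M j).
Proof.
move=> jr; have bX : bmeas (X j).
  case: (cbmeasM (x_cbmeas j) (cadapted_cbmeas (Y_adapted jr))) => //.
have bD : bmeas (D j) by exact: (@adapted_bmeas j) (D_adapted _ _).
apply: bmeasB.
  by apply: bmeasN; apply: bmeasM => //; exact: (@adapted_bmeas j) (sinA jr).
apply: bmeasM; first exact: (@adapted_bmeas j) (cosA jr).
apply: bmeasB => //; apply: bmeasM; [exact: bmeasX | exact: bmeas_cst].
Qed.

Let cadapted_real j (H : T -> R) : adapted j H -> cadapted j (fun w => (H w)%:C).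
Proof. by move=> hH; split=> //; exact: bmeas_cst. Qed.

Let re_mulreal (a : R) (u : C) : re (a%:C * u) = a * re u.
Proof. by rewrite reM mul0r subr0. Qed.

Let esp_M j : (j < r)%N -> esp P (M j) = 0.
Proof.
move=> jr; have hY := Y_adapted jr.
pose Z1 w := (sin (S j w + theta) * clipexp kappa (U j.+1 w))%:C * Y j w.
pose Z2 w := (cos (S j w + theta) * clipexp kappa (U j.+1 w) * 4^-1)%:C * Y j w ^+ 2.
have h1 : cadapted j Z1 by apply: cbmeasM => //; exact: cadapted_real (sinA jr).
have h2 : cadapted j Z2.
  apply: cbmeasM (cbmeasX 2 hY).
  by apply: cadapted_real; apply: bmeasM; [exact: cosA | exact: bmeas_cst].
have b1 : bmeas (fun w => re (Z1 w * x j w ^+ 1)).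
  by case: (cbmeasM (cadapted_cbmeas h1) (cbmeasX 1 (x_cbmeas j))).
have b2 : bmeas (fun w => re (Z2 w * x j w ^+ 2)).
  by case: (cbmeasM (cadapted_cbmeas h2) (cbmeasX 2 (x_cbmeas j))).
rewrite (@eq_esp _ _ _ _ _ (fun w => -1 * re (Z1 w * x j w ^+ 1) - re (Z2 w * x j w ^+ 2))).
  rewrite espB ?espZ ?(esp_re_mulx jr)// ?mulr0 ?subr0//.
  by apply: bmeasM => //; exact: bmeas_cst.
move=> w; have Q (a : R) (u v : C) : re (a%:C * u * v) = a * re (v * u).
  by rewrite -mulrA re_mulreal (mulrC u).
by rewrite mulN1r expr1 /M X2E !Q !mulrA.
Qed.

Let step_bound j w : `|Phi j.+1 w - Phi j w - M j w| <=
  `|X j w| ^+ 3 + X j w ^+ 4 + D j w ^+ 2 +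
  (Num.max (U j.+1 w - kappa) 0 - Num.max (U j w - kappa) 0).
Proof.
have ES : S j.+1 w + theta = (S j w + theta) + X j w.
  by rewrite /S big_nat_recr//=; ring.
have EU : U j.+1 w = U j w + D j w by rewrite /U big_nat_recr.
have c1 := clipexp_step kappa (U j w) (D_ge0 j w).
have c2 := cosD_taylor (S j w + theta) (X j w).
rewrite /Phi /M ES; rewrite -EU in c1.
set s := S j w + theta in c2 *; set W := clipexp kappa (U j.+1 w) in c1 *.
set W0 := clipexp kappa (U j w) in c1 *.
have W1 : `|W| <= 1 by rewrite ger0_norm ?clipexp_ge0 ?clipexp_le1.
rewrite (_ : _ - _ - _ = (cos (s + X j w) - (cos s * (1 - X j w ^+ 2 / 2) - sin s * X j w)) * W
   + cos s * (W * (1 - D j w) - W0)); last by ring.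
apply: le_trans (ler_normD _ _) _; rewrite !normrM -[leRHS]addrA; apply: lerD.
  by apply: le_trans c2; rewrite ler_piMr.
by apply: le_trans c1; rewrite ler_piMl ?cos_max.
Qed.

(* Phi_j = cos (S_j + theta) clipexp kappa U_j is a martingale up to third order
   terms: E (X_j ^ 2 | F_j) = |Y_j| ^ 2 / 2 = 2 D_j, so the drift -X_j ^ 2 / 2 of
   the cosine is compensated by the growth of exp U_j.  M_j is the mean zero part
   of the increment. *)
Theorem martingale_cos :
  `|esp P (fun w => cos (S r w + theta)) - expR (- kappa) * cos theta| <=
  esp P (fun w => 2 * `|U r w - kappa| +
     \sum_(0 <= j < r) (`|X j w| ^+ 3 + X j w ^+ 4 + D j w ^+ 2)).
Proof.
have bX j : (j < r)%N -> bmeas (X j).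
  by move=> jr; case: (cbmeasM (x_cbmeas j) (cadapted_cbmeas (Y_adapted jr))).
have bD j : (j < r)%N -> bmeas (D j).
  by move=> jr; exact: (@adapted_bmeas j) (D_adapted _ _).
have bS : bmeas (fun w => cos (S r w + theta)).
  by apply: bmeas_cos; case: (adapted_bmeas (ST (leqnn r))).
have bM : bmeas (fun w => \sum_(0 <= j < r) M j w).
  apply: bmeas_sum_in => j; rewrite mem_index_iota => /andP[_ jr] _; exact: M_bmeas.
have bU : bmeas (U r).
  apply: bmeas_sum_in => j; rewrite mem_index_iota => /andP[_ jr] _; exact: bD.
have bk : bmeas (fun _ : T => expR (- kappa) * cos theta) by exact: bmeas_cst.
have EM : esp P (fun w => \sum_(0 <= j < r) M j w) = 0.
  rewrite (@eq_esp _ _ _ _ _ (fun w => \sum_(j < r) M j w)).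
    by rewrite esp_sum ?big1// => j _; [exact: esp_M|exact: M_bmeas].
  by move=> w; rewrite big_mkord.
have -> : esp P (fun w => cos (S r w + theta)) - expR (- kappa) * cos theta =
    esp P (fun w => cos (S r w + theta) - expR (- kappa) * cos theta -
      \sum_(0 <= j < r) M j w).
  by rewrite espB ?EM ?subr0 ?espB ?esp_cst//; exact: bmeasB.
have bT : bmeas (fun w => cos (S r w + theta) - expR (- kappa) * cos theta -
   \sum_(0 <= j < r) M j w) by apply: bmeasB => //; exact: bmeasB.
apply: le_trans (esp_norm _ bT) _; apply: le_esp => [||w].
- exact: bmeas_norm.
- apply: bmeasD.
    apply: bmeasM; first exact: bmeas_cst.
    by apply/bmeas_norm/bmeasB => //; exact: bmeas_cst.
  apply: bmeas_sum_in => j; rewrite mem_index_iota => /andP[_ jr] _.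
  apply: bmeasD (bmeasX 2 (bD j jr)); apply: bmeasD (bmeasX 4 (bX j jr)).
  exact: bmeasX 3 (bmeas_norm (bX j jr)).
have Phi0 : Phi 0 w = expR (- kappa) * cos theta.
  by rewrite /Phi /S /U !big_geq// add0r clipexp0// mulrC.
have tel : Phi r w - Phi 0 w = \sum_(0 <= j < r) (Phi j.+1 w - Phi j w).
  by rewrite telescope_sumr.
(* The clipped factor differs from 1 at the end by at most [|U r w - kappa|], and the telescoped
   overshoots cost as much again; hence the factor 2 in the bound. *)
have -> : cos (S r w + theta) - expR (- kappa) * cos theta - \sum_(0 <= j < r) M j w =
   cos (S r w + theta) * (1 - clipexp kappa (U r w)) +
   \sum_(0 <= j < r) (Phi j.+1 w - Phi j w - M j w).
  rewrite [X in _ = _ + X]sumrB -tel Phi0 /Phi; ring.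
apply: le_trans (ler_normD _ _) _; rewrite mulr_natl mulr2n -addrA; apply: lerD.
  rewrite normrM; apply: le_trans (clipexp_near1 _ _).
  by rewrite ler_piMl ?cos_max.
apply: le_trans (ler_norm_sum _ _ _) _.
apply: le_trans (ler_sum _ (fun j _ => step_bound j w)) _.
rewrite big_split/= telescope_sumr// addrC lerD2r.
rewrite lerBlDr; apply: (@le_trans _ _ `|U r w - kappa|).
  by rewrite ge_max ler_norm normr_ge0.
by rewrite lerDl le_max lexx orbT.
Qed.

End Martingale.
End Filtration.
End ComplexValued.

(** * The characteristic function of the normal law *)

Section GaussianCharacteristicFunction.
Context {R : realType}.
Local Notation mu := (@lebesgue_measure R).
Local Notation g := (@gauss_fun R).

Lemma is_derive_continuous (f : R -> R) (df : R -> R) :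
  (forall x : R, is_derive x 1 f (df x)) -> continuous f.
Proof.
by move=> h x; apply/differentiable_continuous/derivable1_diffP; case: (h x).
Qed.

Lemma FTC2_global (F f : R -> R) (a b : R) : a < b ->
  (forall x : R, is_derive x 1 F (f x)) -> continuous f ->
  (\int[mu]_(x in `[a, b]) (f x)%:E = (F b - F a)%:E)%E.
Proof.
move=> ab dF cf; have cF := is_derive_continuous dF.
rewrite (continuous_FTC2 (F := F)) ?EFinB//.
- exact: continuous_subspaceT.
- split => [x _||]; first by case: (dF x).
  + exact/cvg_at_right_filter/cF.
  + exact/cvg_at_left_filter/cF.
- by move=> x _; rewrite derive1E; have [_ ->] := dF x.
Qed.

(** The integrals over [[- n, n]] equal [F n - F (- n)] and converge to the full integral by
    dominated convergence. *)
Lemma integral_derive_eq0 (F f : R -> R) :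
  (forall x : R, is_derive x 1 F (f x)) -> continuous f ->
  mu.-integrable setT (EFin \o f) ->
  F n%:R @[n --> \oo] --> (0 : R) -> F (- n%:R) @[n --> \oo] --> (0 : R) ->
  (\int[mu]_x (f x)%:E = 0)%E.
Proof.
move=> dF cf intf F0 F0'.
have mf : measurable_fun setT f by exact: continuous_measurable_fun.
pose f_ n (x : R) : \bar R := (f x * \1_(`[- n%:R, n%:R] : set R) x)%:E.
have [_ _ cv] : [/\ mu.-integrable setT (EFin \o f),
    [sequence \int[mu]_x `|f_ n x - (f x)%:E|]_n @ \oo --> 0
  & [sequence \int[mu]_x f_ n x]_n @ \oo --> \int[mu]_x (f x)%:E]%E.
  apply: (dominated_convergence _ _ _ _ (integrable_abse intf)) => //.
  - move=> n; apply/measurable_EFinP; apply: measurable_funM => //.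
  - exact/measurable_EFinP.
  - apply: aeW => x _; apply: cvg_near_cst; near=> n.
    rewrite /f_ indicE mem_set ?mulr1//= in_itv/= -ler_norml.
    by near: n; exact: nbhs_infty_ger.
  - apply: aeW => x n _; rewrite /f_ /= lee_fin normrM ler_piMr// indicE.
    by case: (_ \in _); rewrite ?normr1 ?normr0.
have e : ([sequence \int[mu]_x f_ n x]_n @ \oo --> (0 : \bar R))%E.
  have : (F n%:R - F (- n%:R))%:E @[n --> \oo] --> (0 - 0 : R)%:E.
    by apply: cvg_EFin; [exact: nearW|exact: cvgB].
  rewrite subr0; apply: cvg_trans; apply: near_eq_cvg; near=> n.
  rewrite -(FTC2_global _ dF cf); last first.
    by rewrite gtrN// ltr0n; near: n; exact: nbhs_infty_gt.
  rewrite /f_ integral_mkcond; apply: eq_integral => x _ /=.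
  by rewrite patchE indicE; case: ifPn => _; rewrite ?mulr1 ?mulr0.
exact: cvg_unique cv e.
Unshelve. all: by end_near.
Qed.

Lemma continuous_cos_affine (t c : R) : continuous (fun x : R => cos (t * x + c)).
Proof.
move=> x; apply: continuous_comp; last exact: continuous_cos.
by apply: cvgD; [exact: mulrl_continuous|exact: cvg_cst].
Qed.

Lemma continuous_sin_affine (t c : R) : continuous (fun x : R => sin (t * x + c)).
Proof.
move=> x; apply: continuous_comp; last exact: continuous_sin.
by apply: cvgD; [exact: mulrl_continuous|exact: cvg_cst].
Qed.

Lemma normal_pdf_sqrt_half (x : R) : normal_pdf 0 (Num.sqrt 2^-1) x = (Num.sqrt pi)^-1 * g x.
Proof.
have s2 : Num.sqrt 2^-1 ^+ 2 = 2^-1 :> R by rewrite sqr_sqrtr// invr_ge0.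
rewrite normal_pdfE; last by rewrite gt_eqF// sqrtr_gt0 invr_gt0.
rewrite /normal_peak /normal_fun s2 subr0 /gauss_fun.
congr ((Num.sqrt _)^-1 * expR _); first by field.
by field.
Qed.

Lemma integrable_mull (c : R) (h : R -> R) :
  mu.-integrable setT (EFin \o h) -> mu.-integrable setT (EFin \o (fun x => c * h x)).
Proof.
move=> ih; rewrite (_ : EFin \o _ = (fun x => c%:E * (EFin \o h) x)%E).
  exact: integrableZl.
by apply/funext => x; rewrite /= EFinM.
Qed.

(** From [|x| <= expR (x ^+ 2 / 2)], as [g x] is [expR (- x ^+ 2)]; the factor [Num.sqrt (pi *+ 2)]
    cancels the peak of the standard normal density. This integrable majorant permits
    differentiation under the integral sign. *)
Lemma norm_id_gauss_le (x : R) : `|x| * g x <= Num.sqrt (pi *+ 2) * normal_pdf 0 1 x.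
Proof.
rewrite normal_pdfE ?oner_neq0// /normal_peak /normal_fun expr1n mul1r subr0.
rewrite mulVKf; last by rewrite gt_eqF// sqrtr_gt0 two_pi_gt0.
have -> : g x = expR (- (x ^+ 2 / 2)) * expR (- x ^+ 2 / 2).
  by rewrite -expRD /gauss_fun; congr expR; field.
rewrite mulrA ler_piMl ?expR_ge0// expRN ler_pdivrMr ?expR_gt0// mul1r.
apply: le_trans (expR_ge1Dx _); rewrite -(@real_normK _ x) ?num_real//.
have := sqr_ge0 (`|x| - 1); rewrite sqrrB1 => h.
have := sqr_ge0 (`|x|); lra.
Qed.

Lemma integrable_id_gauss (h : R -> R) : measurable_fun setT h -> (forall x, `|h x| <= 1) ->
  mu.-integrable setT (EFin \o (fun x => x * h x * g x)).
Proof.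
move=> mh h1.
apply: (@le_integrable _ _ _ mu setT measurableT _ (fun x : R => (Num.sqrt (pi *+ 2) * normal_pdf 0 1 x)%:E)) => //.
- apply/measurable_EFinP; apply: measurable_funM; last exact: measurable_gauss_fun.
  exact: measurable_funM.
- move=> x _; rewrite /= lee_fin [leRHS]ger0_norm; last first.
    by rewrite mulr_ge0 ?sqrtr_ge0 ?normal_pdf_ge0.
  rewrite !normrM (ger0_norm (gauss_fun_ge0 x)).
  apply: le_trans (norm_id_gauss_le x).
  by rewrite ler_wpM2r ?gauss_fun_ge0// ler_piMr.
- exact/integrable_mull/integrable_normal_pdf.
Qed.

Lemma integrable_bounded_gauss (h : R -> R) : measurable_fun setT h -> (forall x, `|h x| <= 1) ->
  mu.-integrable setT (EFin \o (fun x => h x * g x)).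
Proof.
move=> mh h1; apply: (@le_integrable _ _ _ mu setT measurableT _ (fun x : R => (g x)%:E)) => //.
- apply/measurable_EFinP; apply: measurable_funM => //; exact: measurable_gauss_fun.
- move=> x _; rewrite /= lee_fin normrM (ger0_norm (gauss_fun_ge0 x)).
  by rewrite ler_piMl ?gauss_fun_ge0.
- exact: integrableT_gauss.
Qed.

(** The characteristic function comes from a differential equation: Fc' = - Fs by differentiation
    under the integral and 2 Fs = t Fc by parts, so that Fc' = - (t / 2) Fc. *)
Let Fc (theta t : R) : R := \int[mu]_x (cos (t * x + theta) * g x).
Let Fs (theta t : R) : R := \int[mu]_x (x * sin (t * x + theta) * g x).

Let mcos t c : measurable_fun setT (fun x : R => cos (t * x + c)).
Proof. by apply: continuous_measurable_fun; exact: continuous_cos_affine. Qed.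

Let msin t c : measurable_fun setT (fun x : R => sin (t * x + c)).
Proof. by apply: continuous_measurable_fun; exact: continuous_sin_affine. Qed.

Let intc theta t : mu.-integrable setT (EFin \o (fun x : R => cos (t * x + theta) * g x)).
Proof. by apply: integrable_bounded_gauss => // x; exact: cos_max. Qed.

Let ints theta t : mu.-integrable setT (EFin \o (fun x : R => x * sin (t * x + theta) * g x)).
Proof. by apply: integrable_id_gauss => // x; exact: sin_max. Qed.

Let is_derive_cos_param theta (x y : R) :
  is_derive y 1 (fun t : R => cos (t * x + theta) * g x) (- (x * sin (y * x + theta) * g x)).
Proof. by apply: is_derive_eq; rewrite /GRing.scale/=; ring. Qed.

Let Fc_derive (theta t : R) : is_derive t 1 (Fc theta) (- Fs theta t).
Proof.
pose f (s x : R) := cos (s * x + theta) * g x.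
have It : `]t - 1, t + 1[%classic t by rewrite /= in_itv/=; apply/andP; split; lra.
have der (s x : R) : derivable (f ^~ x) s 1 by case: (is_derive_cos_param theta x s).
have d1 (s x : R) : partial1of2 f s x = - (x * sin (s * x + theta) * g x).
  by rewrite partial1of2E; case: (is_derive_cos_param theta x s).
pose G (x : R) := Num.sqrt (pi *+ 2) * normal_pdf 0 1 x.
have G0 x : 0 <= G x by rewrite mulr_ge0 ?sqrtr_ge0 ?normal_pdf_ge0.
have iG : mu.-integrable setT (EFin \o G).
  exact/integrable_mull/integrable_normal_pdf.
have ub (s x : R) : `|partial1of2 f s x| <= G x.
  rewrite d1 normrN !normrM (ger0_norm (gauss_fun_ge0 x)).
  apply: le_trans (norm_id_gauss_le x).
  by rewrite ler_wpM2r ?gauss_fun_ge0// ler_piMr// sin_max.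
split.
  exact: (@derivable_under_integral _ _ _ mu f setT measurableT t (t - 1) (t + 1) It
    (fun s _ => intc theta s) (fun s x _ _ => der s x) G G0 iG (fun s x _ _ => ub s x)).
rewrite -derive1E (@differentiation_under_integral _ _ _ mu f setT measurableT t (t - 1) (t + 1) It
    (fun s _ => intc theta s) (fun s x _ _ => der s x) G G0 iG (fun s x _ _ => ub s x)).
rewrite /Fs -mulN1r -RintegralZl//; apply: eq_Rintegral => x _.
by rewrite /= d1 mulN1r.
Qed.

Let gauss_lim (h : R -> R) : (forall x, `|h x| <= 1) -> forall u : nat -> R,
  (forall n, `|u n| = n%:R) -> h (u n) * g (u n) @[n --> \oo] --> (0 : R).
Proof.
move=> h1 u hu; apply: (@squeeze_cvgr _ _ _ _ (fun n => - g n%:R) (fun n => g n%:R)).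
- apply: nearW => n; rewrite -ler_norml normrM (ger0_norm (gauss_fun_ge0 _)).
  have -> : g n%:R = g (u n).
    by rewrite /gauss_fun -(hu n) real_normK ?num_real.
  by rewrite ler_piMl ?gauss_fun_ge0.
- rewrite -oppr0; apply: cvgN.
  exact: (cvg_comp _ _ (@cvgr_idn R) (@cvg_gauss_fun R)).
- exact: (cvg_comp _ _ (@cvgr_idn R) (@cvg_gauss_fun R)).
Qed.

(** Stein's identity: the derivative of [sin (t * x + theta) * g x] integrates to zero. *)
Let stein theta t : 2 * Fs theta t = t * Fc theta t.
Proof.
pose F (x : R) := sin (t * x + theta) * g x.
pose f (x : R) := t * (cos (t * x + theta) * g x) + (-2) * (x * sin (t * x + theta) * g x).
have dF (x : R) : is_derive x 1 F (f x).
  rewrite /F /f /gauss_fun.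
  by apply: is_derive_eq; rewrite /GRing.scale/=; ring.
have cf : continuous f.
  move=> x; rewrite /f; apply: cvgD; apply: cvgM; try exact: cvg_cst.
    by apply: cvgM; [exact: continuous_cos_affine|exact: continuous_gauss_fun].
  apply: cvgM; last exact: continuous_gauss_fun.
  by apply: cvgM; [exact: cvg_id|exact: continuous_sin_affine].
have i1 : mu.-integrable setT (EFin \o (fun x => t * (cos (t * x + theta) * g x))).
  exact: integrable_mull (intc _ _).
have i2 : mu.-integrable setT (EFin \o (fun x => -2 * (x * sin (t * x + theta) * g x))).
  exact: integrable_mull (ints _ _).
have if_ : mu.-integrable setT (EFin \o f).
  apply: (eq_integrable measurableT _ _ _ (integrableD measurableT i1 i2)) => x _.
  by rewrite /= EFinD.
have := integral_derive_eq0 dF cf if_.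
have s1 x : `|sin (t * x + theta)| <= 1 by exact: sin_max.
have l1 := @gauss_lim (fun x => sin (t * x + theta)) s1 (fun n => n%:R) (fun n => normr_nat _ n).
have l2 := @gauss_lim (fun x => sin (t * x + theta)) s1 (fun n => - n%:R).
move=> /(_ l1 (l2 _)) => h.
have {}h : \int[mu]_x f x = 0.
  by rewrite /Rintegral h// => n; rewrite normrN normr_nat.
move: h; rewrite /f RintegralD//.
rewrite (@RintegralZl _ _ _ mu setT _ t measurableT (intc theta t)).
rewrite (@RintegralZl _ _ _ mu setT _ (-2) measurableT (ints theta t)).
by rewrite -/(Fc theta t) -/(Fs theta t) => h; lra.
Qed.

Lemma gauss_cos (theta t : R) :
  \int[mu]_x (cos (t * x + theta) * g x) = Num.sqrt pi * expR (- t ^+ 2 / 4) * cos theta.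
Proof.
rewrite -/(Fc theta t).
have D (s : R) : is_derive s 1 (fun s : R => Fc theta s * expR (s ^+ 2 / 4)) 0.
  have D1 := Fc_derive theta s.
  have st := stein theta s.
  have D2 : is_derive s 1 (fun s : R => expR (s ^+ 2 / 4)) (s / 2 * expR (s ^+ 2 / 4)).
    by apply: is_derive_eq; rewrite /GRing.scale/=; field.
  apply: is_derive_eq; rewrite /GRing.scale/=.
  have -> : Fs theta s = s * Fc theta s / 2 by rewrite -st; field.
  by field.
have := is_derive_0_is_cst t 0 D; rewrite expr0n/= mul0r expR0 mulr1.
have -> : Fc theta 0 = Num.sqrt pi * cos theta.
  rewrite /Fc; under eq_Rintegral do rewrite mul0r add0r.
  rewrite RintegralZl//; last exact: integrableT_gauss.
  by rewrite /Rintegral integralT_gauss/= mulrC.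
move=> h; rewrite mulrAC -h -mulrA -expRD mulNr subrr expR0 mulr1//.
Qed.

Local Notation nu := (normal_prob (0 : R) (Num.sqrt 2^-1)).

Lemma Rintegral_normal_prob (h : R -> R) : measurable_fun setT h -> (forall x, `|h x| <= 1) ->
  \int[nu]_x h x = (Num.sqrt pi)^-1 * \int[mu]_x (h x * g x).
Proof.
move=> mh h1.
have inth : nu.-integrable setT (EFin \o h).
  by apply: (@bmeas_integrable _ _ _ nu h); split=> //; exists 1.
have ihg := integrable_bounded_gauss mh h1.
rewrite -(@RintegralZl _ _ _ mu setT _ _ measurableT ihg) /Rintegral; congr fine.
transitivity (\int[mu]_x ((h x)%:E * (normal_pdf 0 (Num.sqrt 2^-1) x)%:E))%E; last first.
  by apply: eq_integral => x _; rewrite normal_pdf_sqrt_half -EFinM mulrCA.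
(* The Radon-Nikodym derivative is determined only almost everywhere; it is identified with
   [normal_pdf] because both have the same integral over every measurable set. *)
have dom := normal_prob_dominates (0 : R) (Num.sqrt 2^-1).
rewrite -(Radon_Nikodym_change_of_variables dom)//.
apply: ae_eq_integral => //.
- apply: emeasurable_funM; first exact/measurable_EFinP.
  by apply: (measurable_int mu); exact: Radon_Nikodym_integrable.
- apply: emeasurable_funM; first exact/measurable_EFinP.
  by apply/measurable_EFinP; exact: measurable_normal_pdf.
- apply: ae_eqe_mul2l.
  apply: integral_ae_eq => //=.
  + exact: Radon_Nikodym_integrable.
  + by apply/measurable_EFinP; exact: measurable_normal_pdf.
  + by move=> E _ mE; rewrite -Radon_Nikodym_integral.
Qed.

Lemma normal_cos (theta t : R) :
  \int[nu]_x cos (t * x + theta) = expR (- t ^+ 2 / 4) * cos theta.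
Proof.
rewrite Rintegral_normal_prob//; last by move=> x; exact: cos_max.
by rewrite gauss_cos -!mulrA mulKf// gt_eqF// sqrtr_gt0 pi_gt0.
Qed.

Lemma standard_complex_normal_cos (s t theta : R) :
  \int[@standard_complex_normal R]_x cos (s * x.1 + t * x.2 + theta) =
  expR (- (s ^+ 2 + t ^+ 2) / 4) * cos theta.
Proof.
pose h (x : measurableTypeR R * measurableTypeR R) : R := cos (s * x.1 + t * x.2 + theta).
have mh : measurable_fun setT h.
  apply: measurableT_comp; first by apply: continuous_measurable_fun; exact: continuous_cos.
  apply: measurable_funD => //; apply: measurable_funD; apply: measurable_funM => //.
have inth : (@standard_complex_normal R).-integrable setT (EFin \o h).
  by apply: bmeas_integrable; split=> //; exists 1 => x; exact: cos_max.
have ic a c : nu.-integrable setT (EFin \o (fun x : R => cos (a * x + c))).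
  apply: (@bmeas_integrable _ _ _ nu (fun x : R => cos (a * x + c))).
  by split; [exact: mcos | exists 1 => x; exact: cos_max].
rewrite /Rintegral -(integral12_prod_meas1 inth) /fubini_F.
under eq_integral => x _.
  rewrite (_ : (\int[nu]_y _)%E = (expR (- t ^+ 2 / 4) * cos (s * x + theta))%:E); last first.
    rewrite -normal_cos /Rintegral fineK; last first.
      exact: integrable_fin_num (ic t (s * x + theta)).
    by apply: eq_integral => y _; rewrite /h/=; congr (cos _)%:E; ring.
  over.
rewrite -[LHS]/(\int[nu]_x (expR (- t ^+ 2 / 4) * cos (s * x + theta))) RintegralZl//.
by rewrite normal_cos mulrA -expRD; congr (expR _ * _); field.
Qed.

End GaussianCharacteristicFunction.

(** * Weak convergence from characteristic functions *)

Section TrigonometricPolynomials.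
Context {R : realType}.
Implicit Types (f h : R * R -> R).

(** The phase [e] covers sines, and the product-to-sum formula makes the class closed under
    products. *)
Inductive trigp : (R * R -> R) -> Prop :=
| trigp_cos c s t e : trigp (fun x => c * cos (s * x.1 + t * x.2 + e))
| trigp_add f h : trigp f -> trigp h -> trigp (fun x => f x + h x).

Lemma eq_trigp f h : f =1 h -> trigp f -> trigp h.
Proof. by move=> /funext ->. Qed.

Lemma trigp_cst c : trigp (fun=> c).
Proof.
apply: eq_trigp (trigp_cos c 0 0 0) => x.
by rewrite !mul0r !addr0 cos0 mulr1.
Qed.

Lemma trigp_mul f h : trigp f -> trigp h -> trigp (fun x => f x * h x).
Proof.
move=> tf th; elim: tf => [c s t e|f1 f2 _ IH1 _ IH2]; last first.
  by apply: eq_trigp (trigp_add IH1 IH2) => x; rewrite mulrDl.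
elim: th => [c' s' t' e'|h1 h2 _ IH1 _ IH2]; last first.
  by apply: eq_trigp (trigp_add IH1 IH2) => x; rewrite mulrDr.
apply: eq_trigp (trigp_add (trigp_cos (c * c' / 2) (s + s') (t + t') (e + e'))
                           (trigp_cos (c * c' / 2) (s - s') (t - t') (e - e'))) => x.
rewrite (_ : _ + (e + e') = (s * x.1 + t * x.2 + e) + (s' * x.1 + t' * x.2 + e')); last by ring.
rewrite (_ : _ + (e - e') = (s * x.1 + t * x.2 + e) - (s' * x.1 + t' * x.2 + e')); last by ring.
by rewrite cosD cosB; field.
Qed.

Lemma trigp_sub f h : trigp f -> trigp h -> trigp (fun x => f x - h x).
Proof.
move=> tf th; apply: eq_trigp (trigp_add tf (trigp_mul (trigp_cst (-1)) th)) => x.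
by rewrite mulN1r.
Qed.

(* The mean of phi at a binomial (n, u) variable. *)
Fixpoint bern (n : nat) (u : R) (phi : nat -> R) : R :=
  if n is n'.+1 then u * bern n' u (phi \o S) + (1 - u) * bern n' u phi else phi 0%N.

Lemma bern_lin n u a phi psi :
  bern n u (fun k => a * phi k + psi k) = a * bern n u phi + bern n u psi.
Proof.
elim: n phi psi => [//|n IH] phi psi /=.
by rewrite (IH (phi \o S) (psi \o S)) IH; ring.
Qed.

Lemma bern_cst n u c : bern n u (fun=> c) = c.
Proof. by elim: n c => [//|n IH] c /=; rewrite [X in u * X]IH IH; ring. Qed.

Lemma bern_sub n u phi c : bern n u phi - c = bern n u (fun k => phi k - c).
Proof.
have := bern_lin n u 1 phi (fun=> - c); rewrite bern_cst mul1r => <-.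
by congr bern; apply/funext => k; rewrite mul1r.
Qed.

Lemma bern_le n u phi psi : 0 <= u <= 1 -> (forall k, (k <= n)%N -> phi k <= psi k) ->
  bern n u phi <= bern n u psi.
Proof.
move=> /andP[u0 u1]; elim: n phi psi => [|n IH] phi psi h; first exact: h.
rewrite /=; apply: lerD; apply: ler_wpM2l => //; rewrite ?subr_ge0//; apply: IH => k kn.
  exact: h.
by apply: h; exact: leqW.
Qed.

Lemma bern_norm n u phi psi : 0 <= u <= 1 -> (forall k, (k <= n)%N -> `|phi k| <= psi k) ->
  `|bern n u phi| <= bern n u psi.
Proof.
move=> u01 h; rewrite ler_norml; apply/andP; split.
  have := bern_lin n u (-1) psi (fun=> 0); rewrite bern_cst addr0 mulN1r => <-.
  apply: bern_le => // k /h; rewrite ler_norml => /andP[+ _].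
  by rewrite mulN1r addr0.
by apply: bern_le => // k /h; rewrite ler_norml => /andP[].
Qed.

Lemma bern_variance n u c :
  bern n u (fun k => (k%:R - c) ^+ 2) = (n%:R * u - c) ^+ 2 + n%:R * (u * (1 - u)).
Proof.
elim: n c => [|n IH] c /=; first by rewrite !mul0r addr0.
rewrite (_ : _ \o S = (fun k => (k%:R - (c - 1)) ^+ 2)); last first.
  by apply/funext => k /=; rewrite -natr1; congr (_ ^+ 2); ring.
by rewrite !IH -natr1; ring.
Qed.

Lemma trigp_bern n (u : R * R -> R) (phi : nat -> R * R -> R) :
  trigp u -> (forall k, trigp (phi k)) -> trigp (fun x => bern n (u x) (phi ^~ x)).
Proof.
move=> tu; elim: n phi => [|n IH] phi tphi /=; first exact: tphi.
apply: trigp_add; apply: trigp_mul => //.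
- by apply: (IH (fun k => phi k.+1)) => k.
- exact: trigp_sub (trigp_cst 1) tu.
- exact: IH.
Qed.

Lemma bern_dist_le (n : nat) (u : R) : (0 < n)%N -> 0 <= u <= 1 ->
  bern n u (fun k => (k%:R / n%:R - u) ^+ 2) <= n%:R^-1.
Proof.
move=> n0 /andP[u0 u1]; have n0' : 0 < n%:R :> R by rewrite ltr0n.
have -> : (fun k : nat => (k%:R / n%:R - u) ^+ 2) =
    (fun k : nat => n%:R ^- 2 * (k%:R - n%:R * u) ^+ 2 + 0).
  by apply/funext => k; field; rewrite gt_eqF.
rewrite (bern_lin _ _ _ (fun k => (k%:R - n%:R * u) ^+ 2)) bern_cst addr0 bern_variance.
rewrite subrr expr0n/= add0r.
have -> : n%:R ^- 2 * (n%:R * (u * (1 - u))) = n%:R^-1 * (u * (1 - u)).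
  by field; rewrite gt_eqF.
have u2 : u * (1 - u) <= 1 by have := sqr_ge0 (u - 2^-1); lra.
by rewrite ler_piMr// invr_ge0 ltW.
Qed.

End TrigonometricPolynomials.

(** * Bernstein approximation on a square, with a bound on the whole plane *)

Section TrigonometricApproximation.
Context {R : realType}.

Lemma unif_continuous_box (g : R * R -> R) (L e : R) : continuous g -> 0 < e ->
  exists2 del : R, 0 < del & forall x y : R * R, `|x.1| <= L -> `|x.2| <= L ->
    `|x.1 - y.1| < del -> `|x.2 - y.2| < del -> `|g x - g y| <= e.
Proof.
move=> cg e0.
have cK : compact (`[- L, L] `*` `[- L, L] : set (R * R)).
  by apply: compact_setX; exact: segment_compact.
have /compact_near_coveringP cov := cK.
pose P (del : R) (x : R * R) := forall y : R * R,
    `|x.1 - y.1| < del -> `|x.2 - y.2| < del -> `|g x - g y| <= e.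
have : \forall del \near 0^'+, `[- L, L] `*` `[- L, L] `<=` P del.
  apply: cov => x _.
  have e2 : 0 < e / 2 by rewrite divr_gt0.
  have /cvgrPdist_lt/(_ _ e2) := cg x.
  rewrite -nbhs_ballE => -[r /= r0 hr].
  have r2 : 0 < r / 2 by rewrite divr_gt0.
  exists (ball x (r / 2), [set d | 0 < d < r / 2]).
    split; first exact: nbhsx_ballx.
    by apply: filterS2 (nbhs_right_gt (0 : R)) (nbhs_right_lt r2) => d0 /= -> ->.
  move=> [x' d] [/= [b1 b2] /andP[d0 dr]] y y1 y2.
  have h1 : `|g x - g x'| < e / 2.
    by apply: hr; split; [apply: le_ball b1|apply: le_ball b2]; lra.
  have h2 : `|g x - g y| < e / 2.
    apply: hr; split.
    - rewrite /ball/= (_ : x.1 - y.1 = (x.1 - x'.1) + (x'.1 - y.1)); last by ring.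
      rewrite (le_lt_trans (ler_normD _ _))//; move: b1; rewrite /ball/=; lra.
    - rewrite /ball/= (_ : x.2 - y.2 = (x.2 - x'.2) + (x'.2 - y.2)); last by ring.
      rewrite (le_lt_trans (ler_normD _ _))//; move: b2; rewrite /ball/=; lra.
  rewrite (_ : g x' - g y = (g x - g y) - (g x - g x')); last by ring.
  rewrite (le_trans (ler_normB _ _))//; lra.
move=> near_del; near (0 : R)^'+ => del.
exists del; first by near: del; exact: nbhs_right_gt.
have sub : `[- L, L] `*` `[- L, L] `<=` P del by near: del.
by move=> x y x1 x2; apply: sub; split; rewrite /= in_itv/= -ler_norml.
Unshelve. all: by end_near.
Qed.

Lemma sin_sub (a b : R) : sin a - sin b = 2 * (cos ((a + b) / 2) * sin ((a - b) / 2)).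
Proof.
set m := (a + b) / 2; set k := (a - b) / 2.
have -> : sin a = sin (m + k) by congr sin; rewrite /m /k; field.
have -> : sin b = sin (m - k) by congr sin; rewrite /m /k; field.
by rewrite sinD sinB; ring.
Qed.

(** With half-sum m and half-difference k, the difference of the sines is 2 cos m sin k, and cos m
    >= sin k because |m| <= pi / 2 - k. A gap between points thus becomes a gap between sines,
    uniformly up to the ends of the interval, where the derivative vanishes. *)
Lemma sin_gap (a b h : R) : b <= a -> - (pi / 2) <= b -> a <= pi / 2 -> 0 <= h ->
  h <= (a - b) / 2 -> sin h ^+ 2 <= (sin a - sin b) / 2.
Proof.
move=> ba hb ha h0 hab.
set k := (a - b) / 2 in hab *.
have k2 : k <= pi / 2 by rewrite /k; lra.
have s1 : sin h <= sin k.
  have [hk|] := eqVneq h k; first by rewrite hk.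
  move=> hk; have hk' : h < k by rewrite lt_neqAle hk.
  by rewrite ltW// ltr_sin// in_itv/=; apply/andP; split; lra.
have sh0 : 0 <= sin h by apply: sin_ge0_pi; apply/andP; split; lra.
rewrite sin_sub -/k mulrAC divff// mul1r expr2.
apply: ler_pM => //.
apply: le_trans s1 _; rewrite -cosBpihalf -cosN opprB -(cos_norm ((a + b) / 2)).
have c0 : `|(a + b) / 2| <= pi / 2 - k by rewrite /k ler_norml; apply/andP; split; lra.
have [->//|ne] := eqVneq `|(a + b) / 2| (pi / 2 - k).
have c1 : `|(a + b) / 2| < pi / 2 - k by rewrite lt_neqAle ne.
have n0 := normr_ge0 ((a + b) / 2); have p0 := pi_gt0 R.
have k0 : 0 <= k by lra.
by rewrite ltW// ltr_cos// in_itv/=; apply/andP; split; lra.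
Qed.

(** The function [u] maps [[- L, L]] increasingly onto [[0, 1]], so a Bernstein polynomial of [g]
    read through the inverse [psi] is a trigonometric polynomial once evaluated at [u]. Being at
    every point of the plane an average of values of [g], it keeps the bound [M] outside the box
    too. *)
Theorem trigp_approx (g : R * R -> R) (M L e : R) : continuous g ->
  (forall x, `|g x| <= M) -> 0 < L -> 0 < e ->
  exists2 B : R * R -> R, trigp B & (forall x, `|B x| <= M) /\
    forall x : R * R, `|x.1| <= L -> `|x.2| <= L -> `|B x - g x| <= e.
Proof.
move=> cg hM L0 e0.
have e2 : 0 < e / 2 by rewrite divr_gt0.
have M0 : 0 <= M by apply: le_trans (hM (0, 0)).
have [del del0 hdel] := unif_continuous_box L cg e2.
have p0 := pi_gt0 R.
pose c : R := pi / 2 / L.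
have c0 : 0 < c by rewrite divr_gt0// divr_gt0.
pose u (y : R) : R := (1 + sin (c * y)) / 2.
pose psi (s : R) : R := asin (2 * s - 1) / c.
have u01 y : 0 <= u y <= 1.
  by have := sin_geN1 (c * y); have := sin_le1 (c * y); rewrite /u; lra.
have upsi s : 0 <= s <= 1 -> u (psi s) = s.
  move=> /andP[s0 s1]; rewrite /u /psi.
  have -> : c * (asin (2 * s - 1) / c) = asin (2 * s - 1) by field; rewrite gt_eqF.
  rewrite asinK; first by field.
  by rewrite in_itv/=; lra.
have cL y : `|y| <= L -> - (pi / 2) <= c * y <= pi / 2.
  have cLE : c * L = pi / 2 by rewrite /c divfK ?gt_eqF.
  rewrite -ler_norml normrM (gtr0_norm c0) -cLE ler_pM2l//.
have psiL s : 0 <= s <= 1 -> `|psi s| <= L.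
  move=> /andP[s0 s1]; rewrite /psi normrM normfV (gtr0_norm c0) ler_pdivrMr//.
  have -> : L * c = pi / 2 by rewrite /c mulrC divfK ?gt_eqF.
  have s01 : -1 <= 2 * s - 1 <= 1 by lra.
  by rewrite ler_norml asin_geNpi2// asin_lepi2.
(* The minimum with [L] gives [c * del' <= pi / 2], hence [0 < h0 < pi] and [sin h0 > 0]. *)
pose del' := Num.min del L.
have del'0 : 0 < del' by rewrite lt_min del0.
pose h0 := c * del' / 2.
have h00 : 0 < h0 by rewrite divr_gt0// mulr_gt0.
have h0pi : h0 < pi.
  have : c * del' <= pi / 2.
    have -> : pi / 2 = c * L by rewrite /c divfK ?gt_eqF.
    by rewrite ler_pM2l// ge_min lexx orbT.
  rewrite /h0; lra.
pose eta := sin h0 ^+ 2.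
have eta0 : 0 < eta by rewrite exprn_gt0// sin_gt0_pi// h00.
have gap y y' : `|y| <= L -> `|y'| <= L -> del' <= `|y - y'| -> eta <= `|u y - u y'|.
  wlog yy : y y' / y' <= y => [H yL yL' dy|yL yL'].
    have [|/ltW] := lerP y' y; first by move=> ?; exact: H.
    by move=> ?; rewrite distrC; apply: H => //; rewrite distrC.
  rewrite ger0_norm ?subr_ge0// => dy.
  have -> : u y - u y' = (sin (c * y) - sin (c * y')) / 2 by rewrite /u; field.
  have /andP[a1 a2] := cL _ yL; have /andP[b1 b2] := cL _ yL'.
  apply: le_trans (ler_norm _); apply: sin_gap => //.
  - by rewrite ler_pM2l.
  - exact: ltW.
  - by rewrite /h0 -mulrBr ler_pM2r// ler_pM2l.
(* As in Chebyshev's inequality: where a coordinate of [u] moves by at least [eta], [K] times the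
   square of the move is at least the trivial bound [2 * M]. *)
pose K : R := 2 * M / eta ^+ 2.
have K0 : 0 <= K.
  by apply: divr_ge0; [rewrite mulr_ge0|rewrite exprn_ge0// ltW].
have key (x y : R * R) : `|x.1| <= L -> `|x.2| <= L -> `|y.1| <= L -> `|y.2| <= L ->
    `|g y - g x| <= e / 2 + K * ((u y.1 - u x.1) ^+ 2 + (u y.2 - u x.2) ^+ 2).
  move=> x1 x2 y1 y2.
  have e20 : 0 < eta ^+ 2 by rewrite exprn_gt0.
  have far (t : R) : eta <= `|t| -> 2 * M <= K * t ^+ 2.
    move=> ht; have et : eta ^+ 2 <= t ^+ 2.
      by rewrite -[leRHS]real_normK ?num_real// lerXn2r// ?nnegrE// ltW.
    rewrite /K -mulrA [_^-1 * _]mulrC; apply: ler_peMr; first by rewrite mulr_ge0.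
    by rewrite (ler_pdivlMr _ _ e20) mul1r.
  have g2 : `|g y - g x| <= 2 * M.
    by rewrite (le_trans (ler_normB _ _))// mulr_natl mulr2n lerD.
  have q1 : 0 <= K * (u y.1 - u x.1) ^+ 2 by rewrite mulr_ge0// sqr_ge0.
  have q2 : 0 <= K * (u y.2 - u x.2) ^+ 2 by rewrite mulr_ge0// sqr_ge0.
  rewrite mulrDr.
  have [n1|f1] := ltP `|y.1 - x.1| del'; last by have := far _ (gap _ _ y1 x1 f1); lra.
  have [n2|f2] := ltP `|y.2 - x.2| del'; last by have := far _ (gap _ _ y2 x2 f2); lra.
  have : `|g y - g x| <= e / 2.
    apply: hdel => //; [apply: lt_le_trans n1 _|apply: lt_le_trans n2 _];
    by rewrite ge_min lexx.
  lra.
(* Each of the two coordinates contributes a variance of at most [1 / n]. *)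
have [n n0 hn] : exists2 n : nat, (0 < n)%N & K * (n%:R^-1 + n%:R^-1) <= e / 2.
  exists (Num.truncn (2 * K / (e / 2))).+1 => //.
  set n := (Num.truncn _).+1.
  have nb : 2 * K / (e / 2) < n%:R by exact: truncnS_gt.
  have np : 0 < n%:R :> R by rewrite ltr0n.
  have -> : K * (n%:R^-1 + n%:R^-1) = 2 * K / n%:R by ring.
  by rewrite ler_pdivrMr// [leRHS]mulrC -ler_pdivrMr// ltW.
pose nd (k : nat) : R := k%:R / n%:R.
have nd01 k : (k <= n)%N -> 0 <= nd k <= 1.
  move=> kn; rewrite /nd divr_ge0//= ler_pdivrMr ?ltr0n// mul1r ler_nat//.
pose G k l : R := g (psi (nd k), psi (nd l)).
pose B (x : R * R) : R := bern n (u x.1) (fun k => bern n (u x.2) (fun l => G k l)).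
have tu1 : trigp (fun x : R * R => u x.1).
  apply: eq_trigp (trigp_add (trigp_cst 2^-1) (trigp_cos 2^-1 c 0 (- (pi / 2)))) => x.
  by rewrite mul0r addr0 cosBpihalf /u; field.
have tu2 : trigp (fun x : R * R => u x.2).
  apply: eq_trigp (trigp_add (trigp_cst 2^-1) (trigp_cos 2^-1 0 c (- (pi / 2)))) => x.
  by rewrite mul0r add0r cosBpihalf /u; field.
exists B.
  apply: (trigp_bern n (phi := fun k x => bern n (u x.2) (G k))) => // k.
  by apply: (trigp_bern n (phi := fun l _ => G k l)) => // l; exact: trigp_cst.
split=> [x|x x1 x2].
  rewrite -(bern_cst n (u x.1) M); apply: bern_norm => // k _.
  rewrite -(bern_cst n (u x.2) M); apply: bern_norm => // l _; exact: hM.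
rewrite /B bern_sub.
apply: (@le_trans _ _ (bern n (u x.1) (fun k => K * (nd k - u x.1) ^+ 2 + (e / 2 + K * n%:R^-1)))).
  apply: bern_norm => // k kn; rewrite bern_sub.
  apply: (@le_trans _ _ (bern n (u x.2) (fun l => K * (nd l - u x.2) ^+ 2 +
      (e / 2 + K * (nd k - u x.1) ^+ 2)))).
    apply: bern_norm => // l ln.
    have := key x (psi (nd k), psi (nd l)) x1 x2 (psiL _ (nd01 _ kn)) (psiL _ (nd01 _ ln)).
    by rewrite /= !upsi ?nd01// /G mulrDr; lra.
  rewrite (bern_lin _ _ _ (fun l => (nd l - u x.2) ^+ 2)) bern_cst.
  have : K * bern n (u x.2) (fun l => (nd l - u x.2) ^+ 2) <= K * n%:R^-1.
    by rewrite ler_wpM2l// bern_dist_le.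
  lra.
rewrite (bern_lin _ _ _ (fun l => (nd l - u x.1) ^+ 2)) bern_cst.
have : K * bern n (u x.1) (fun l => (nd l - u x.1) ^+ 2) <= K * n%:R^-1.
  by rewrite ler_wpM2l// bern_dist_le.
by move: hn; rewrite mulrDr; lra.
Qed.

End TrigonometricApproximation.

(** * Convergence in distribution from expectations of cosines *)

Section WeakConvergence.
Context {R : realType}.
Local Notation R2 := (measurableTypeR R * measurableTypeR R)%type.

Lemma trigp_bmeas (h : R * R -> R) : trigp h -> bmeas (h : R2 -> R).
Proof.
elim=> [c s t e|f1 f2 _ IH1 _ IH2]; last exact: bmeasD.
apply: bmeasM; first exact: bmeas_cst.
apply: bmeas_cos; apply: measurable_funD => //.
by apply: measurable_funD; apply: measurable_funM.
Qed.

Lemma trigp_approx_seq (g : R * R -> R) (M : R) : continuous g -> (forall x, `|g x| <= M) ->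
  exists B : nat -> R * R -> R, (forall n, trigp (B n)) /\
    forall n (x : R * R), `|x.1| <= n.+1%:R -> `|x.2| <= n.+1%:R ->
      `|B n x - g x| <= n.+1%:R^-1.
Proof.
move=> cg hM.
have H (n : nat) : exists B : R * R -> R, trigp B /\
    forall x : R * R, `|x.1| <= n.+1%:R -> `|x.2| <= n.+1%:R -> `|B x - g x| <= n.+1%:R^-1.
  have n0 : 0 < n.+1%:R :> R by rewrite ltr0n.
  have n1 : 0 < n.+1%:R^-1 :> R by rewrite invr_gt0.
  by have [B tB [_ hB]] := trigp_approx cg hM n0 n1; exists B.
have [B hB] := choice H; exists B; split=> n; first by case: (hB n).
by move=> x; case: (hB n) => _; apply.
Qed.

(** Measurability for the product sigma-algebra holds because [g] is a pointwise limit of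
    trigonometric polynomials. *)
Lemma continuous_bounded_bmeas (g : R * R -> R) (M : R) :
  continuous g -> (forall x, `|g x| <= M) -> bmeas (g : R2 -> R).
Proof.
move=> cg hM; split; last by exists M.
have [B [tB hB]] := trigp_approx_seq cg hM.
apply: (@measurable_fun_cvg _ _ _ _ (fun n => (B n : R2 -> R))).
  by move=> n; case: (trigp_bmeas (tB n)).
move=> x _; apply/cvgrPdist_le => e e0; near=> n.
rewrite distrC (le_trans (hB n x _ _))//.
- rewrite (@le_trans _ _ n%:R) ?ler_nat//.
  by near: n; exact: nbhs_infty_ger.
- rewrite (@le_trans _ _ n%:R) ?ler_nat//.
  by near: n; exact: nbhs_infty_ger.
- rewrite -[leRHS]invrK lef_pV2 ?posrE ?invr_gt0// (@le_trans _ _ n%:R) ?ler_nat//.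
  by near: n; exact: nbhs_infty_ger.
Unshelve. all: by end_near.
Qed.

Lemma measurable_box (L : R) : measurable [set x : R2 | `|x.1| <= L /\ `|x.2| <= L].
Proof.
have H (f : R2 -> R) : measurable_fun setT f -> measurable [set x | f x <= L].
  move=> mf; have := mf measurableT _ (measurable_itv `]-oo, L]); rewrite setTI.
  by rewrite (_ : _ @^-1` _ = [set x | f x <= L]).
by apply: measurableI; apply: H; exact: measurableT_comp.
Qed.

Lemma probability_tight (mu : probability R2 R) (e : R) : 0 < e ->
  exists2 L0 : nat, (0 < L0)%N & forall L : nat, (L0 <= L)%N ->
    fine (mu (~` [set x : R2 | `|x.1| <= L%:R /\ `|x.2| <= L%:R])) <= e.
Proof.
move=> e0; pose K (n : nat) := [set x : R2 | `|x.1| <= n%:R /\ `|x.2| <= n%:R].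
have mK n : measurable (K n) := measurable_box n%:R.
have cvK : mu (K n) @[n --> \oo] --> mu (\bigcup_n K n).
  apply: nondecreasing_cvg_mu => //; first exact: bigcup_measurable.
  move=> n m nm; apply/subsetPset => x [x1 x2].
  by split; [apply: le_trans x1 _ | apply: le_trans x2 _]; rewrite ler_nat.
have UK : \bigcup_n K n = setT.
  rewrite -subTset => x _; pose t := Num.max `|x.1| `|x.2|.
  exists (Num.truncn t).+1 => //; split; apply: le_trans (ltW (truncnS_gt t)).
    by rewrite le_max lexx.
  by rewrite le_max lexx orbT.
move: cvK; rewrite UK probability_setT => /fine_cvgP[_ /cvgrPdist_le/(_ _ e0)] [L0 _ hL0].
exists L0.+1 => // L LL; have := hL0 L (ltnW LL).
rewrite -/(K L) (probability_setC mu (mK L)) fineB ?fin_num_measure//=.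
exact: le_trans (ler_norm _).
Qed.

(** Off the box the approximation error is only known to be at most [2 * M]; the mass there is
    controlled by the second moment bound [C] under each [P n], and by tightness under [mu]. *)
Theorem cvg_of_cos (d : nat -> measure_display) (T : forall n, measurableType (d n))
    (P : forall n, probability (T n) R) (X Y : forall n, T n -> R) (C : R)
    (mu : probability R2 R) :
  (forall n, bmeas (X n)) -> (forall n, bmeas (Y n)) ->
  (forall n, esp (P n) (fun w => X n w ^+ 2 + Y n w ^+ 2) <= C) ->
  (forall s t e : R, esp (P n) (fun w => cos (s * X n w + t * Y n w + e)) @[n --> \oo] -->
     \int[mu]_x cos (s * x.1 + t * x.2 + e)) ->
  forall g : R * R -> R, continuous g -> (exists M, forall x, `|g x| <= M) ->
  esp (P n) (fun w => g (X n w, Y n w)) @[n --> \oo] --> \int[mu]_x g x.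
Proof.
move=> bX bY hC hcos g cg [M hM].
have M0 : 0 <= M by apply: le_trans (hM (0, 0)).
have bcomp (h : R * R -> R) n : bmeas (h : R2 -> R) -> bmeas (fun w => h (X n w, Y n w)).
  move=> [mh [M' hM']]; split; last by exists M'.
  have mXY : measurable_fun setT (fun w => (X n w, Y n w) : R2).
    by apply: measurable_fun_pair; [case: (bX n)|case: (bY n)].
  exact: (measurableT_comp mh mXY).
have bg := continuous_bounded_bmeas cg hM.
have cvtrig (h : R * R -> R) : trigp h ->
    esp (P n) (fun w => h (X n w, Y n w)) @[n --> \oo] --> esp mu h.
  elim=> [c s t e|f1 f2 t1 IH1 t2 IH2].
    have b1 n : bmeas (fun w => cos (s * X n w + t * Y n w + e)).
      apply: bmeas_cos; case: (bX n) (bY n) => mX _ [mY _].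
      by apply: measurable_funD => //; apply: measurable_funD; apply: measurable_funM.
    have b2 : bmeas (fun x : R2 => cos (s * x.1 + t * x.2 + e)).
      apply: eq_bmeas (trigp_bmeas (trigp_cos 1 s t e)) => x; exact: mul1r.
    rewrite espZ//; under eq_fun do rewrite espZ//.
    by apply: cvgM; [exact: cvg_cst|exact: hcos].
  have b1 := trigp_bmeas t1; have b2 := trigp_bmeas t2.
  rewrite (espD _ b1 b2).
  under eq_fun do rewrite (espD _ (bcomp _ _ b1) (bcomp _ _ b2)).
  exact: cvgD.
apply/cvgrPdist_le => e e0.
(* Replacing [g] by [B] costs [2 * eps] under [P n] and again under [mu], and the convergence for
   [B] costs one more [eps]. *)
pose eps := e / 8.
have eps0 : 0 < eps by rewrite divr_gt0.
have M1 : 0 < 2 * M + 1 by lra.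
have [L0 L00 tight] := probability_tight mu (divr_gt0 eps0 M1).
(* [L0] takes care of the tail of [mu]; the other entry makes [(2 * M + 1) / L ^+ 2 * |C|] at most
   [eps]. The added 1 keeps the divisor positive when [M = 0]. *)
pose L := maxn L0 (Num.truncn ((2 * M + 1) * `|C| / eps)).+1.
have L1 : 1 <= L%:R :> R by rewrite ler1n (leq_trans L00)// leq_maxl.
have Lp : 0 < L%:R :> R by apply: lt_le_trans L1.
have LC : (2 * M + 1) * `|C| / eps <= L%:R.
  apply: le_trans (ltW (truncnS_gt _)) _.
  by rewrite ler_nat leq_maxr.
have [B tB [BM hB]] := trigp_approx cg hM Lp eps0.
have bB := trigp_bmeas tB.
have tail (x : R * R) : ~ (`|x.1| <= L%:R /\ `|x.2| <= L%:R) -> `|B x - g x| <= 2 * M.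
  by move=> _; rewrite (le_trans (ler_normB _ _))// mulr_natl mulr2n lerD.
have pt (x : R * R) : `|B x - g x| <= eps + (2 * M + 1) / L%:R ^+ 2 * (x.1 ^+ 2 + x.2 ^+ 2).
  have q0 : 0 <= (2 * M + 1) / L%:R ^+ 2 by rewrite divr_ge0 ?exprn_ge0// ltW.
  have q1 : 0 <= (2 * M + 1) / L%:R ^+ 2 * x.1 ^+ 2 by rewrite mulr_ge0// sqr_ge0.
  have q2 : 0 <= (2 * M + 1) / L%:R ^+ 2 * x.2 ^+ 2 by rewrite mulr_ge0// sqr_ge0.
  have far (t : R) : L%:R < `|t| -> 2 * M <= (2 * M + 1) / L%:R ^+ 2 * t ^+ 2.
    move=> Lt; apply: (@le_trans _ _ (2 * M + 1)); first lra.
    rewrite mulrAC ler_pdivlMr ?exprn_gt0// ler_pM2l//.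
    by rewrite -[leRHS]real_normK ?num_real// lerXn2r ?nnegrE// ltW.
  rewrite mulrDr.
  have [x1|x1] := lerP `|x.1| L%:R; last by have := tail x; have := far _ x1; lra.
  have [x2|x2] := lerP `|x.2| L%:R; last by have := tail x; have := far _ x2; lra.
  by have := hB x x1 x2; lra.
have D1 n : `|esp (P n) (fun w => B (X n w, Y n w)) - esp (P n) (fun w => g (X n w, Y n w))| <= 2 * eps.
  rewrite -espB; [|exact: bcomp|exact: bcomp].
  have b1 : bmeas (fun w => B (X n w, Y n w) - g (X n w, Y n w)) by apply: bmeasB; exact: bcomp.
  have b2 : bmeas (fun w => X n w ^+ 2 + Y n w ^+ 2) by apply: bmeasD; exact: bmeasX.
  apply: le_trans (esp_norm _ b1) _.
  apply: (@le_trans _ _ (esp (P n) (fun w => eps + (2 * M + 1) / L%:R ^+ 2 * (X n w ^+ 2 + Y n w ^+ 2)))).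
    apply: le_esp; [exact: bmeas_norm| |by move=> w; exact: pt].
    by apply: bmeasD; [exact: bmeas_cst|apply: bmeasM => //; exact: bmeas_cst].
  have bq := bmeasM (bmeas_cst (T n) ((2 * M + 1) / L%:R ^+ 2)) b2.
  rewrite (espD _ (bmeas_cst (T n) eps) bq) (espZ _ _ b2) esp_cst.
  rewrite (_ : 2 * eps = eps + eps) ?lerD2l; last by ring.
  apply: (@le_trans _ _ ((2 * M + 1) / L%:R ^+ 2 * `|C|)).
    apply: ler_wpM2l; first by apply: divr_ge0; [exact: ltW|exact: exprn_ge0].
    exact: le_trans (hC n) (ler_norm _).
  rewrite mulrAC ler_pdivrMr ?exprn_gt0//.
  rewrite -ler_pdivrMl// mulrC; apply: le_trans LC _.
  by rewrite expr2 ler_peMr// ltW.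
have D2 : `|esp mu B - esp mu g| <= 2 * eps.
  pose K := [set x : R2 | `|x.1| <= L%:R /\ `|x.2| <= L%:R].
  have mK : measurable K := measurable_box L%:R.
  have bI : bmeas (\1_(~` K) : R2 -> R).
    split; first by apply: measurable_indic; exact: measurableC.
    by exists 1 => x; rewrite indicE; case: (_ \in _); rewrite ?normr1 ?normr0.
  rewrite -espB//; have b1 := bmeasB bB bg.
  apply: le_trans (esp_norm _ b1) _.
  apply: (@le_trans _ _ (esp mu (fun x : R2 => eps + (2 * M + 1) * \1_(~` K) x))).
    apply: le_esp => [||x]; first exact: bmeas_norm.
      by apply: bmeasD; [exact: bmeas_cst|apply: bmeasM => //; exact: bmeas_cst].
    rewrite indicE; have [/set_mem/= nK|] := boolP (x \in ~` K).
      by have := tail x nK; rewrite mulr1; lra.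
    by rewrite notin_setE/= => /contrapT[x1 x2]; have := hB x x1 x2; rewrite mulr0; lra.
  have bq := bmeasM (bmeas_cst R2 (2 * M + 1)) bI.
  rewrite (espD _ (bmeas_cst R2 eps) bq) (espZ _ _ bI) esp_cst.
  rewrite (_ : 2 * eps = eps + eps) ?lerD2l; last by ring.
  have -> : esp mu \1_(~` K) = fine (mu (~` K)).
    by rewrite /esp /Rintegral integral_indic ?setIT//; exact: measurableC.
  by rewrite mulrC -ler_pdivlMr// tight// leq_maxl.
have /cvgrPdist_le/(_ _ eps0) := cvtrig B tB.
apply: filterS => n hn.
rewrite -/(esp mu g).
set a := esp mu g in D2 *; set b := esp mu B in hn D2.
have := D1 n; set a' := esp (P n) (fun w => g _).
set b' := esp (P n) (fun w => B _) in hn *.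
move: hn D2; rewrite !ler_norml /eps => /andP[h1 h2] /andP[h3 h4] /andP[h5 h6].
by apply/andP; split; lra.
Qed.

End WeakConvergence.

(** * The filtration of a Steinhaus function *)

Section UnitCircle.
Context {R : realType}.
Local Notation C := R[i].
Local Notation re := (@complex.Re R).
Local Notation im := (@complex.Im R).

(* Resets the null set of values of f P outside the circle, so that |x_i| = 1
   holds everywhere and not only almost surely. *)
Definition unitize (p : R * R) : C :=
  if p.1 ^+ 2 + p.2 ^+ 2 == 1 then p.1 +i* p.2 else 1.

Lemma normsq_unitize p : normsq (unitize p) = 1.
Proof.
rewrite /unitize; case: eqP => [<-//|_].
by rewrite /normsq expr1n expr0n addr0.
Qed.

Lemma unitize_plane (c : C) : normsq c = 1 -> unitize (plane c) = c.
Proof. by rewrite /unitize /plane /normsq /= => ->; rewrite eqxx; case: c. Qed.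

Lemma cbmeas_unitize : cbmeas unitize.
Proof.
have m1 : measurable_fun setT (fun p : R * R => p.1 ^+ 2 + p.2 ^+ 2).
  by apply: measurable_funD; apply: measurable_funX.
have mb : measurable_fun setT (fun p : R * R => p.1 ^+ 2 + p.2 ^+ 2 == 1).
  by apply: measurable_fun_eqr => //; exact: measurable_cst.
have bound p : `|re (unitize p)| <= 1 /\ `|im (unitize p)| <= 1.
  have := normsq_unitize p; rewrite /normsq => h.
  have h1 := sqr_ge0 (re (unitize p)); have h2 := sqr_ge0 (im (unitize p)).
  by split; rewrite -[leLHS]ger0_norm// -(ler_pXn2r (n := 2)) ?nnegrE ?normr_ge0// expr1n normr_id real_normK ?num_real//; lra.
split; split; try (by exists 1 => p; case: (bound p)).
  rewrite (_ : (fun x => _) = (fun p : R * R => if p.1 ^+ 2 + p.2 ^+ 2 == 1 then p.1 else 1)).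
    by apply: measurable_fun_if => //; apply: measurable_funTS; exact: measurable_fst.
  by apply/funext => p; rewrite /unitize; case: ifP.
rewrite (_ : (fun x => _) = (fun p : R * R => if p.1 ^+ 2 + p.2 ^+ 2 == 1 then p.2 else 0)).
  by apply: measurable_fun_if => //; apply: measurable_funTS; exact: measurable_snd.
by apply/funext => p; rewrite /unitize; case: ifP.
Qed.

Lemma de_moivre (t : R) n : (cos t +i* sin t) ^+ n = (cos (n%:R * t) +i* sin (n%:R * t)) :> C.
Proof.
elim: n => [|n IH]; first by rewrite expr0 mul0r cos0 sin0.
rewrite exprS IH -natr1 mulrDl mul1r [_ * t + t]addrC cosD sinD.
apply: complexP; rewrite ?reM ?imM/=; ring.
Qed.

Lemma Rintegral_uniform (h : R -> R) (F : R -> R) : (forall t, `|h t| <= 1) -> continuous h ->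
  (forall t : R, is_derive t 1 F (h t)) -> F (pi *+ 2) = F 0 ->
  \int[uniform_prob (two_pi_gt0 R)]_t h t = 0.
Proof.
move=> h1 ch dF F2; set U := uniform_prob _.
have mh : measurable_fun setT h by exact: continuous_measurable_fun.
have bh : bmeas (h : measurableTypeR R -> R) by split=> //; exists 1.
have c1 : continuous (fun t : R => 1 + h t).
  by move=> t; apply: cvgD; [exact: cvg_cst|exact: ch].
have dG (t : R) : is_derive t 1 (fun t : R => t + F t) (1 + h t).
  have := dF t => ?; exact: is_deriveD.
have p2 := two_pi_gt0 R.
(* Adding 1 makes the integrand nonnegative, as the integral formula for [uniform_prob] requires. *)
suff : \int[U]_t (1 + h t) = 1.
  rewrite -/(esp U _) (espD U (bmeas_cst _ 1) bh) esp_cst /esp; lra.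
rewrite /Rintegral integral_uniform; last 2 first.
- apply/measurable_EFinP; exact: measurable_funD.
- by move=> t; rewrite lee_fin; have := h1 t; rewrite ler_norml; lra.
rewrite (FTC2_global p2 dG c1) F2 subr0 -EFinM/=.
by rewrite add0r addrK mulVf// gt_eqF.
Qed.

Lemma unit_circle_moment (n : nat) : (0 < n)%N ->
  \int[uniform_prob (two_pi_gt0 R)]_t re (unitize (cos t, sin t) ^+ n) = 0 /\
  \int[uniform_prob (two_pi_gt0 R)]_t im (unitize (cos t, sin t) ^+ n) = 0.
Proof.
move=> n0; have nR : n%:R != 0 :> R by rewrite pnatr_eq0 -lt0n.
have E t : unitize (cos t, sin t) ^+ n = cos (n%:R * t) +i* sin (n%:R * t).
  by rewrite /unitize/= cos2Dsin2 eqxx de_moivre.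
have sin2pi : sin (n%:R * (pi *+ 2)) = 0 :> R /\ cos (n%:R * (pi *+ 2)) = 1 :> R.
  have := de_moivre (pi *+ 2 : R) n; rewrite sin2pi cos2pi.
  have -> : 1 +i* 0 = 1 :> C by [].
  by rewrite expr1n => -[<- <-].
split.
  transitivity (\int[uniform_prob (two_pi_gt0 R)]_t cos (n%:R * t + 0)).
    by apply: eq_Rintegral => t _; rewrite E addr0.
  apply: (@Rintegral_uniform _ (fun t => n%:R^-1 * sin (n%:R * t + 0))).
  - by move=> t; exact: cos_max.
  - exact: continuous_cos_affine.
  - by move=> t; apply: is_derive_eq; rewrite /GRing.scale/=; field.
  - by rewrite !addr0 mulr0 sin0; case: sin2pi => ->.
transitivity (\int[uniform_prob (two_pi_gt0 R)]_t sin (n%:R * t + 0)).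
  by apply: eq_Rintegral => t _; rewrite E addr0.
apply: (@Rintegral_uniform _ (fun t => - n%:R^-1 * cos (n%:R * t + 0))).
- by move=> t; exact: sin_max.
- exact: continuous_sin_affine.
- by move=> t; apply: is_derive_eq; rewrite /GRing.scale/=; field.
- by rewrite !addr0 mulr0 cos0; case: sin2pi => _ ->.
Qed.

End UnitCircle.

Section SteinhausFiltration.
Context {R : realType} d (T : measurableType d) (P : probability T R).
Variables (k : finFieldType) (f : {poly k} -> T -> R[i]).
Hypothesis hf : steinhaus P f.
Variable ps : seq {poly k}.
Hypothesis ps_uniq : uniq ps.
Hypothesis ps_irr : forall Q, Q \in ps -> monic_irreducible Q.
Local Notation re := (@complex.Re R).
Local Notation im := (@complex.Im R).

Let V Q w := plane (f Q w).

Definition cyl (s : seq {poly k}) (B : {poly k} -> set (R * R)) : set T :=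
  \bigcap_(Q in [set` s]) (V Q @^-1` B Q).

(* A pi-system generating the sigma-algebra of the values f P_i with i < j. *)
Definition st_filt (j : nat) : set (set T) :=
  [set A | exists2 B, (forall Q, measurable (B Q)) & A = cyl (take j ps) B].

(** The default 1 beyond the end of [ps] keeps the modulus equal to 1 at every index. *)
Definition st_var (i : nat) (w : T) : R[i] :=
  if (i < size ps)%N then unitize (V (nth (0%R : {poly k}) ps i) w) else 1.

Let V_meas Q : Q \in ps -> measurable_fun setT (V Q).
Proof. by move=> /ps_irr; case: hf => h _ _ _; exact: h. Qed.

Lemma cyl_measurable s B : {subset s <= ps} -> (forall Q, measurable (B Q)) ->
  measurable (cyl s B).
Proof.
move=> sub mB; apply: fin_bigcap_measurable; first exact: finite_seq.
by move=> Q /= /sub Qps; rewrite -[X in measurable X]setTI; exact: (V_meas Qps).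
Qed.

Lemma st_filt_measurable j : st_filt j `<=` measurable.
Proof. by move=> A [B mB ->]; apply: cyl_measurable => // Q /mem_take. Qed.

Lemma st_filt_setI j : setI_closed (st_filt j).
Proof.
move=> _ _ [B mB ->] [B' mB' ->].
exists (fun Q => B Q `&` B' Q); first by move=> Q; exact: measurableI.
by rewrite /cyl -bigcapI.
Qed.

Lemma st_filt_setT j : st_filt j setT.
Proof. by exists (fun=> setT) => //; rewrite /cyl; apply/seteqP; split. Qed.

Lemma st_filt_mono i j : (i <= j)%N -> st_filt i `<=` st_filt j.
Proof.
move=> ij _ [B mB ->].
exists (fun Q => if Q \in take i ps then B Q else setT).
  by move=> Q; case: ifP.
apply/seteqP; split => w h Q /= Qs.
  by case: ifP => // Qi; exact: h.
have := h Q; rewrite /= Qs; apply.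
by move: Qs; rewrite -(subnKC ij) takeD mem_cat => ->.
Qed.

(** Mutual independence is applied to the first [j] irreducibles with and without the new one, [B']
    being [B0] changed at [Q] only. The entries of [ps] being distinct, [Q] is not among the first
    [j]. *)
Lemma st_indep j A B : (j < size ps)%N -> st_filt j A -> measurable B ->
  P (A `&` (V (nth (0%R : {poly k}) ps j) @^-1` B)) = (P A * P (V (nth (0%R : {poly k}) ps j) @^-1` B))%E.
Proof.
move=> jr [B0 mB0 ->] mB; set Q := nth (0%R : {poly k}) ps j.
have Qps : Q \in ps by rewrite mem_nth.
have Qt : Q \notin take j ps.
  have := ps_uniq; rewrite -{1}(cat_take_drop j ps) (drop_nth 0 jr) cat_uniq.
  by move=> /and3P[_ + _]; rewrite /= negb_or => /andP[].
case: hf => _ ind _ _.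
pose B' G := if G == Q then B else B0 G.
have mB' G : measurable (B' G) by rewrite /B'; case: ifP.
have irr G : G \in Q :: take j ps -> monic_irreducible G.
  by rewrite in_cons => /predU1P[->|/mem_take]; exact: ps_irr.
have tu : uniq (take j ps) by exact: take_uniq.
have := ind (Q :: take j ps) B'; rewrite /= Qt tu => /(_ isT irr (fun G _ => mB' G)).
rewrite big_cons {2}/B' eqxx.
move=> H2.
have irr' G : G \in take j ps -> monic_irreducible G.
  by move=> h; apply: irr; rewrite in_cons h orbT.
have H1 := ind (take j ps) B0 tu irr' (fun G _ => mB0 G).
rewrite [X in P X](_ : _ = \bigcap_(i in [set` Q :: take j ps]) ((V i) @^-1` B' i)).
  rewrite H2 muleC; congr (_ * _)%E.
  rewrite [RHS]H1.
  rewrite big_seq [RHS]big_seq; apply: eq_bigr => G Gs.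
  by rewrite /B' ifN//; apply: contraNneq Qt => <-.
apply/seteqP; split => w.
  move=> [h1 h2] G /=; rewrite in_cons /B'; case: eqP => [->//|_ /= Gs].
  exact: h1.
move=> h; split=> [G /= Gs|].
  have := h G; rewrite /= in_cons Gs orbT /B' => /(_ isT).
  by rewrite ifN//; apply: contraNneq Qt => <-.
by have := h Q; rewrite /= mem_head /B' eqxx => /(_ isT).
Qed.

Lemma st_var_unit i w : normsq (st_var i w) = 1.
Proof.
rewrite /st_var; case: ifP => _; first exact: normsq_unitize.
by rewrite /normsq expr1n expr0n addr0.
Qed.

Lemma st_var_adapted i j : (i < j)%N -> cadapted st_filt j (st_var i).
Proof.
move=> ij; have [ir|ir] := boolP (i < size ps)%N; last first.
  rewrite (_ : st_var i = fun=> 1); first exact: cbmeas_cst.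
  by apply/funext => w; rewrite /st_var (negbTE ir).
rewrite (_ : st_var i = fun w => unitize (V (nth (0%R : {poly k}) ps i) w)); last first.
  by apply/funext => w; rewrite /st_var ir.
set Q := nth (0%R : {poly k}) ps i.
have mV : measurable_fun setT (V Q : g_sigma_algebraType (st_filt j) -> R * R).
  move=> _ B mB; rewrite setTI; apply: sub_sigma_algebra.
  exists (fun G => if G == Q then B else setT); first by move=> G; case: ifP.
  have Qj : Q \in take j ps.
    rewrite /Q -(nth_take 0 ij) mem_nth// size_take; case: ifP => //.
  apply/seteqP; split => w /=; first by move=> h G _ /=; case: eqP => [->|].
  by move=> /(_ Q Qj) /=; rewrite eqxx.
have [[m1 [M1 h1]] [m2 [M2 h2]]] := @cbmeas_unitize R.
split; split; [exact: (measurableT_comp m1 mV)|by exists M1 => w; exact: h1| |by exists M2 => w; exact: h2].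
exact: (measurableT_comp m2 mV).
Qed.

Lemma st_var_law (h : R * R -> R) i : (i < size ps)%N -> bmeas h ->
  esp P (fun w => h (V (nth (0%R : {poly k}) ps i) w)) =
  \int[uniform_prob (two_pi_gt0 R)]_t h (cos t, sin t).
Proof.
move=> ir bh; set Q := nth (0%R : {poly k}) ps i; have Qps : Q \in ps by rewrite mem_nth.
case: hf => _ _ law _.
have mV := V_meas Qps.
have mc : measurable_fun setT (fun t : measurableTypeR R => (cos t, sin t) : R * R).
  apply: measurable_fun_pair; apply: continuous_measurable_fun.
    exact: continuous_cos.
  exact: continuous_sin.
have push d' (U : measurableType d') (p : probability U R) (W : U -> R * R) : measurable_fun setT W ->
    esp p (fun w => h (W w)) = fine (\int[pushforward p W]_u (h u)%:E)%E.
  move=> mW; rewrite /esp /Rintegral integral_pushforward//.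
  - by apply/measurable_EFinP; case: bh.
  - apply: (@bmeas_integrable _ _ _ p (fun w => h (W w))).
    case: bh => mh [M hM]; split; last by exists M.
    exact: (measurableT_comp mh mW).
rewrite (push _ _ P _ mV) -/(esp _ _) (push _ _ _ _ mc); congr fine.
apply: eq_measure_integral => A mA _ /=.
by apply: law => //; exact: ps_irr.
Qed.

Lemma st_var_orth j a (H : T -> R) : (j < size ps)%N -> (0 < a)%N -> adapted st_filt j H ->
  esp P (fun w => H w * re (st_var j w ^+ a)) = 0 /\
  esp P (fun w => H w * im (st_var j w ^+ a)) = 0.
Proof.
move=> jr a0 aH; have Qps : nth (0%R : {poly k}) ps j \in ps by rewrite mem_nth.
have [b1 b2] := cbmeasX a (@cbmeas_unitize R).
have [e1 e2] := @unit_circle_moment R a a0.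
have key (h : R * R -> R) : bmeas h -> \int[uniform_prob (two_pi_gt0 R)]_t h (cos t, sin t) = 0 ->
    esp P (fun w => H w * h (V (nth (0%R : {poly k}) ps j) w)) = 0.
  move=> bh h0; rewrite (esp_indep_sigma (@st_filt_setI j) (@st_filt_setT j)
    (@st_filt_measurable j) (V_meas Qps) _ aH bh); last by move=> A B; exact: st_indep.
  by rewrite st_var_law// h0 mulr0.
by rewrite /st_var jr; split; [exact: (key _ b1 e1)|exact: (key _ b2 e2)].
Qed.

End SteinhausFiltration.

(** * Counting irreducible polynomials *)

Section PolyCount.
Variable k : finFieldType.
Implicit Types (F G Q : {poly k}) (s : seq {poly k}).

Definition pdeg (F : {poly k}) : nat := (size F).-1.
Definition mirr (F : {poly k}) : bool := (F \is monic) && irreducibleb F.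

Lemma mirrP Q : reflect (monic_irreducible Q) (mirr Q).
Proof. by apply: (iffP andP) => -[mQ /irreducibleP iQ]. Qed.

Lemma mirr_monic Q : mirr Q -> Q \is monic. Proof. by case/andP. Qed.

Lemma pdeg_mirr_gt0 Q : mirr Q -> (0 < pdeg Q)%N.
Proof.
move=> /mirrP[_ [+ _]]; rewrite /pdeg; by case: (size Q) => [//|[//|n]].
Qed.

Lemma monic_size F : F \is monic -> size F = (pdeg F).+1.
Proof. by move=> /monic_neq0; rewrite /pdeg -size_poly_gt0; case: (size F). Qed.

Lemma pdegM F G : F \is monic -> G \is monic -> pdeg (F * G) = (pdeg F + pdeg G)%N.
Proof.
move=> mF mG; rewrite {1}/pdeg size_Mmonic ?monic_neq0// (monic_size mF) (monic_size mG).
by rewrite addSn addnS.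
Qed.

Lemma pdegX F n : F \is monic -> pdeg (F ^+ n) = (n * pdeg F)%N.
Proof.
move=> mF; elim: n => [|n IH]; first by rewrite expr0 /pdeg size_poly1.
by rewrite exprS pdegM ?monic_exp// IH mulSn.
Qed.

Lemma monic_prod_mirr s : all mirr s -> \prod_(Q <- s) Q \is monic.
Proof.
move=> /allP h; rewrite big_seq; apply: monic_prod => Q /h; exact: mirr_monic.
Qed.

Lemma pdeg_prod s : all mirr s -> pdeg (\prod_(Q <- s) Q) = (\sum_(Q <- s) pdeg Q)%N.
Proof.
elim: s => [|Q s IH] /=; first by rewrite !big_nil /pdeg size_poly1.
by move=> /andP[hQ hs]; rewrite !big_cons pdegM ?(mirr_monic hQ) ?monic_prod_mirr// IH.
Qed.

Lemma monic_factor F : F \is monic -> exists2 s, all mirr s & F = \prod_(Q <- s) Q.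
Proof.
have [n] := ubnP (size F); elim: n F => // n IH F ltF mF.
have [F1|sF] := leqP (size F) 1.
  exists [::] => //; rewrite big_nil.
  have /size1_polyC E := F1; rewrite E.
  have /eqP : lead_coef F == 1 by [].
  by rewrite {1}E lead_coefC => ->; rewrite polyC1.
have [iF|/irreducibleP niF] := boolP (irreducibleb F).
  by exists [:: F]; rewrite ?big_seq1//= /mirr mF iF.
have [G [G1 GF nGF]] : exists G, [/\ size G != 1%N, G %| F & ~~ (G %= F)].
  apply: contrapT => h; apply: niF; split=> // G G1 GF.
  by apply: contrapT => /negP nE; apply: h; exists G.
have F0 := monic_neq0 mF.
have G0 : G != 0 by apply: contraNneq F0 => G0; move: GF; rewrite G0 dvd0p.
pose c := (lead_coef G)^-1; have c0 : c != 0 by rewrite invr_eq0 lead_coef_eq0.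
pose G' := c *: G.
have mG' : G' \is monic by rewrite monicE lead_coefZ mulVf// lead_coef_eq0.
have /dvdpP[H FH] : G' %| F by rewrite dvdpZl.
have mH : H \is monic by rewrite -(monicMr H mG') -FH.
have sG' : size G' = size G by rewrite size_scale.
have sFE : size F = (size H + size G).-1 by rewrite FH size_Mmonic ?monic_neq0// sG'.
have nsF : size G != size F by rewrite dvdp_size_eqp.
have H0 := monic_neq0 mH; move: (H0) (G0); rewrite -!size_poly_gt0 => H0' G0'.
have [ltH ltG] : (size H < n)%N /\ (size G' < n)%N.
  rewrite sG'; move: ltF G1 nsF H0' G0'; rewrite sFE.
  by move: (size (G : seq k)) (size (H : seq k)) => a b; lia.
have [s1 h1 E1] := IH H ltH mH.
have [s2 h2 E2] := IH G' ltG mG'.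
by exists (s1 ++ s2); rewrite ?all_cat ?h1// big_cat/= -E1 -E2.
Qed.

Lemma mirr_coprime Q G : mirr Q -> mirr G -> Q != G -> coprimep Q G.
Proof.
move=> /mirrP[mQ iQ] /mirrP[mG iG] neq; rewrite irreducible_poly_coprime//.
apply: contra neq => /(apply_irredp iG) h.
by rewrite -eqp_monic//; apply: h; case: iQ => + _; case: (size Q) => [|[]].
Qed.

(** Factors other than [Q] are coprime to it and drop out. Multiplicities can thus be read off the
    product alone, which is the uniqueness of factorization. *)
Lemma dvdp_prod_mirr Q s b : mirr Q -> all mirr s ->
  (Q ^+ b %| \prod_(G <- s) G) = (b <= count_mem Q s)%N.
Proof.
move=> iQ; have Q0 := monic_neq0 (mirr_monic iQ).
elim: s b => [|G s IH] b /=.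
  move=> _; rewrite big_nil leqn0; case: b => [|b]; first by rewrite expr0 dvd1p.
  rewrite dvdp1 exprS; apply/negbTE.
  rewrite size_Mmonic ?monic_exp ?mirr_monic// (monic_size (mirr_monic iQ)).
  have := pdeg_mirr_gt0 iQ.
  have : (0 < size (Q ^+ b))%N by rewrite size_poly_gt0 expf_neq0.
  by move: (size _) (pdeg Q) => [//|a] [//|c] _ _; rewrite addSn addnS.
move=> /andP[iG hs]; rewrite big_cons; have [->|neq] := eqVneq G Q.
  case: b => [|b]; first by rewrite expr0 dvd1p.
  by rewrite exprS dvdp_mul2l// IH// add1n ltnS.
rewrite Gauss_dvdpr ?IH//; apply: coprimep_expl; apply: mirr_coprime => //.
by rewrite eq_sym.
Qed.

Definition irrs m : seq {poly k} :=
  map (fun F : {poly_(m.+1) k} => F : {poly k})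
    [seq F : {poly_(m.+1) k} <- enum {: {poly_(m.+1) k}} | mirr (F : {poly k})].

Lemma uniq_irrs m : uniq (irrs m).
Proof.
by rewrite map_inj_uniq; [exact/filter_uniq/enum_uniq | exact: val_inj].
Qed.

Lemma mem_irrs m Q : (Q \in irrs m) = mirr Q && (pdeg Q <= m)%N.
Proof.
apply/mapP/andP => [[F]|[iQ dQ]].
  rewrite mem_filter => /andP[iF _] ->; split=> //.
  by rewrite /pdeg; have := size_npoly F; lia.
have sQ : (size Q <= m.+1)%N by rewrite (monic_size (mirr_monic iQ)) ltnS.
exists (NPoly sQ) => //=.
by rewrite mem_filter mem_enum inE andbT.
Qed.

Definition monics m : seq {poly k} :=
  map (fun F : {poly_(m.+1) k} => F : {poly k}) (enum (monic_of_degree k m)).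

Lemma uniq_monics m : uniq (monics m).
Proof. by rewrite map_inj_uniq ?enum_uniq//; exact: val_inj. Qed.

Lemma mem_monics m F : (F \in monics m) = (F \is monic) && (pdeg F == m).
Proof.
apply/mapP/andP => [[G]|[mF dF]].
  rewrite mem_enum inE => /andP[mG /eqP sG] ->; split=> //.
  by rewrite /pdeg sG.
have sF : (size F <= m.+1)%N by rewrite (monic_size mF) (eqP dF).
exists (NPoly sF) => //=.
by rewrite mem_enum inE/= mF (monic_size mF) (eqP dF) eqxx.
Qed.

Lemma size_monics m : size (monics m) = (#|k| ^ m)%N.
Proof.
rewrite -(card_npoly k m) cardE -(size_map (fun G : {poly_m k} => 'X^m + (G : {poly k}))).
apply/perm_size/uniq_perm; first exact: uniq_monics.
  by rewrite map_inj_uniq ?enum_uniq// => F G /addrI /val_inj.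
move=> F; rewrite mem_monics; apply/andP/mapP => [[mF /eqP dF]|[G _ ->]].
  have sG : (size ((F : {poly k}) - 'X^m)%R <= m)%N.
    apply/leq_sizeP => j; rewrite leq_eqVlt => /predU1P[<-|mj].
      rewrite coefB coefXn eqxx -[X in F`_X]dF.
      by move: mF; rewrite monicE lead_coefE => /eqP ->; rewrite subrr.
    rewrite coefB coefXn (gtn_eqF mj) subr0 nth_default//.
    by rewrite (monic_size mF) dF.
  by exists (NPoly sG); rewrite ?mem_enum//= addrC subrK.
have sE : size ('X^m + (G : {poly k})) = m.+1.
  by rewrite size_polyDl size_polyXn// ltnS size_npoly.
split; last by rewrite /pdeg sE.
rewrite monicE lead_coefDl ?lead_coefXn//.
by rewrite size_polyXn ltnS size_npoly.
Qed.

Lemma count_dvd_monics m Q : Q \is monic ->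
  count (fun F => Q %| F) (monics m) =
  if (pdeg Q <= m)%N then (#|k| ^ (m - pdeg Q))%N else 0%N.
Proof.
move=> mQ; have Q0 := monic_neq0 mQ; case: ifP => [dQ|/negbT ndQ]; last first.
  apply/eqP; rewrite -leqn0 leqNgt -has_count; apply/hasPn => F.
  rewrite mem_monics => /andP[mF /eqP dF]; apply/negP => /dvdp_leq.
  by rewrite monic_neq0// => /(_ isT); rewrite !monic_size// dF ltnS; apply/negP.
rewrite -size_monics -(size_map ( *%R Q)) -size_filter.
apply/perm_size/uniq_perm; first by rewrite filter_uniq// uniq_monics.
  by rewrite map_inj_uniq ?uniq_monics//; exact: mulfI.
move=> F; rewrite mem_filter mem_monics; apply/and3P/mapP.
  move=> [/dvdpP[G ->] mQG]; have mG : G \is monic by rewrite -(monicMr G mQ).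
  rewrite pdegM// => /eqP dG; exists G; last by rewrite mulrC.
  by rewrite mem_monics mG; apply/eqP; lia.
move=> [G]; rewrite mem_monics => /andP[mG /eqP dG] ->.
by rewrite dvdp_mulIl monicMl// pdegM// dG subnKC.
Qed.

Definition npi d : nat := count (fun Q => pdeg Q == d) (irrs d).

Lemma count_irrs m d : (d <= m)%N -> count (fun Q => pdeg Q == d) (irrs m) = npi d.
Proof.
move=> dm; rewrite /npi -!size_filter; apply/perm_size/uniq_perm.
- exact/filter_uniq/uniq_irrs.
- exact/filter_uniq/uniq_irrs.
move=> Q; rewrite !mem_filter !mem_irrs; case: eqP => //= ->.
by rewrite leqnn dm.
Qed.

(** The analogue of log n = sum of Lambda(d) over d | n: an irreducible Q of multiplicity c is
    counted once for each of the divisors Q, ..., Q^c. *)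
Lemma pdegE F m : F \is monic -> pdeg F = m ->
  m = (\sum_(Q <- irrs m) pdeg Q * \sum_(1 <= b < m.+1) (Q ^+ b %| F)%R)%N.
Proof.
move=> mF dF; have [s hs Fs] := monic_factor mF.
have szs : (size s <= m)%N.
  rewrite -dF Fs pdeg_prod// -sum1_size big_seq [leqRHS]big_seq.
  by apply: leq_sum => Q /(allP hs); exact: pdeg_mirr_gt0.
transitivity (\sum_(Q <- irrs m) pdeg Q * count_mem Q s)%N; last first.
  rewrite big_seq [RHS]big_seq; apply: eq_bigr => Q.
  rewrite mem_irrs => /andP[iQ _]; congr (_ * _)%N; rewrite Fs.
  under eq_bigr do rewrite dvdp_prod_mirr//.
  have : (count_mem Q s <= m)%N by rewrite (leq_trans _ szs)// count_size.
  move: (count_mem Q s) => c cm.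
  rewrite (@big_cat_nat _ _ _ c.+1)//= big_nat.
  rewrite (eq_bigr (fun=> 1%N)); last by move=> i /andP[_]; rewrite ltnS => ->.
  rewrite -big_nat sum_nat_const_nat subSS subn0 muln1 big_nat big1 ?addn0// => i.
  by move=> /andP[ci _]; rewrite leqNgt ci.
rewrite -[LHS]dF Fs pdeg_prod//.
have sub : {subset s <= irrs m}.
  move=> Q Qs; rewrite mem_irrs (allP hs _ Qs)/= -dF Fs pdeg_prod//.
  by rewrite (big_rem Q)//= leq_addr.
transitivity (\sum_(Q <- s) \sum_(G <- irrs m) (G == Q) * pdeg Q)%N.
  rewrite big_seq [RHS]big_seq; apply: eq_bigr => Q Qs.
  rewrite (bigD1_seq Q) ?uniq_irrs ?sub//= eqxx mul1n big1 ?addn0// => G /negbTE ->.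
  by rewrite mul0n.
rewrite exchange_big/=; apply: eq_bigr => Q _.
rewrite -sum1_count big_distrr/= [RHS]big_mkcond/=; apply: eq_bigr => G _.
by rewrite eq_sym; case: eqP => [->|]; rewrite ?mul1n ?muln1.
Qed.

(** [pdegE] summed over all monic polynomials of degree [m] and grouped by the degree d of the
    irreducible; Q^b divides q^(m - b d) of them when b d <= m. *)
Lemma sum_pdeg m :
  (m * #|k| ^ m = \sum_(1 <= d < m.+1) (d * npi d *
     \sum_(1 <= b < m.+1) (if b * d <= m then #|k| ^ (m - b * d) else 0)))%N.
Proof.
transitivity (\sum_(F <- monics m) m)%N.
  by rewrite big_const_seq count_predT size_monics iter_addn_0.
transitivity (\sum_(F <- monics m)
    \sum_(Q <- irrs m) pdeg Q * \sum_(1 <= b < m.+1) (Q ^+ b %| F)%R)%N.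
  rewrite big_seq [RHS]big_seq; apply: eq_bigr => F.
  by rewrite mem_monics => /andP[mF /eqP dF]; exact: pdegE.
rewrite exchange_big/=.
pose T d := (\sum_(1 <= b < m.+1) (if b * d <= m then #|k| ^ (m - b * d) else 0))%N.
transitivity (\sum_(Q <- irrs m) pdeg Q * T (pdeg Q))%N.
  rewrite big_seq [RHS]big_seq; apply: eq_bigr => Q.
  rewrite mem_irrs => /andP[/mirr_monic mQ _].
  rewrite -big_distrr/= exchange_big/=; congr (_ * _)%N; apply: eq_bigr => b _.
  by rewrite -pdegX// -count_dvd_monics ?monic_exp// -sum1_count [RHS]big_mkcond.
transitivity (\sum_(Q <- irrs m) \sum_(1 <= d < m.+1) (pdeg Q == d) * (d * T d))%N.
  rewrite big_seq [RHS]big_seq; apply: eq_bigr => Q.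
  rewrite mem_irrs => /andP[/pdeg_mirr_gt0 Q0 Qm].
  rewrite (bigD1_seq (pdeg Q)) ?mem_index_iota ?iota_uniq ?Q0//= eqxx mul1n.
  by rewrite big1 ?addn0// => d; rewrite eq_sym => /negbTE ->.
rewrite exchange_big/= big_nat [RHS]big_nat; apply: eq_bigr => d /andP[d0 dm].
rewrite -big_distrl/= -mulnA mulnCA; congr (_ * _)%N; congr (_ * _)%N.
rewrite -(@count_irrs m)// -sum1_count [RHS]big_mkcond.
by apply: eq_bigr => Q _; case: eqP.
Qed.

(** Gauss's formula. Subtracting q times [sum_pdeg] at m from [sum_pdeg] at m + 1 leaves only the
    terms with b d = m + 1, that is, the divisors d of m + 1. *)
Lemma gauss_irr m : (0 < m)%N ->
  (#|k| ^ m = \sum_(1 <= d < m.+1) (d %| m) * (d * npi d))%N.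
Proof.
case: m => // m _.
pose T n d := (\sum_(1 <= b < n.+1) (if b * d <= n then #|k| ^ (n - b * d) else 0))%N.
have TS d : (0 < d)%N -> (T m.+1 d = (d %| m.+1) + #|k| * T m d)%N.
  move=> d0; rewrite /T big_distrr/= [in LHS](eq_bigr (fun b => (b * d == m.+1) +
      #|k| * (if b * d <= m then #|k| ^ (m - b * d) else 0))%N); last first.
    move=> b _; have [bm|mb|->] := ltngtP (b * d)%N m.+1.
    - have bm' : (b * d <= m)%N by [].
      by rewrite bm' subSn// expnS.
    - by rewrite leqNgt (ltn_trans _ mb)//= muln0.
    - by rewrite ltnn subnn muln0.
  rewrite big_split/= [X in (_ + X)%N]big_nat_recr//=; congr (_ + _)%N; last first.
    by rewrite ifN ?muln0 ?addn0// -ltnNge leq_pmulr.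
  case: (boolP (d %| m.+1)%N) => [/dvdnP[c mE]|ndm].
    have c0 : (0 < c)%N by rewrite lt0n; apply/eqP => c0; rewrite c0 in mE.
    have cm : (c <= m.+1)%N by rewrite mE leq_pmulr.
    rewrite (bigD1_seq c) ?mem_index_iota ?iota_uniq ?c0//= -mE eqxx.
    by rewrite big1 ?addn0// => b bc; rewrite mE eqn_pmul2r// (negbTE bc).
  rewrite big1// => b _; apply/eqP; rewrite eqb0; apply: contra ndm => /eqP <-.
  exact: dvdn_mull.
have T0 : T m m.+1 = 0%N.
  rewrite /T big_nat big1// => b /andP[b0 _]; rewrite ifN// -ltnNge.
  by rewrite (leq_trans (ltnSn m))// leq_pmull.
have := sum_pdeg m.+1; rewrite big_nat.
under eq_bigr => d /andP[d0 _] do rewrite -/(T m.+1 d) TS// mulnDr mulnCA.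
rewrite -big_nat big_split/= -big_distrr/= [in X in (_ + _ * X)%N]big_nat_recr//=.
rewrite T0 muln0 addn0 /T -sum_pdeg mulSn mulnCA -expnS => /addIn ->.
by apply: eq_bigr => d _; rewrite mulnC.
Qed.

Lemma npi_le m : (0 < m)%N -> (m * npi m <= #|k| ^ m)%N.
Proof.
by move=> m0; rewrite (gauss_irr m0) big_nat_recr//= dvdnn mul1n leq_addl.
Qed.

Lemma sum_expn_le q n : (1 < q)%N -> (\sum_(1 <= d < n.+1) q ^ d <= 2 * q ^ n)%N.
Proof.
move=> q1; elim: n => [|n IH]; first by rewrite big_geq.
rewrite big_nat_recr//= mulSn mul1n leq_add2r (leq_trans IH)//.
by rewrite expnS leq_mul2r q1 orbT.
Qed.

(** A proper divisor of [m] is at most [m / 2], and the terms up to there are dominated by a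
    geometric sum. *)
Lemma npi_ge m : (0 < m)%N -> (#|k| ^ m <= m * npi m + 2 * #|k| ^ m./2)%N.
Proof.
move=> m0; rewrite {1}(gauss_irr m0) big_nat_recr//= dvdnn mul1n addnC leq_add2l.
have k1 : (1 < #|k|)%N := finNzRing_gt1 k.
apply: leq_trans (sum_expn_le m./2 k1).
rewrite (@big_cat_nat _ _ _ m./2.+1)//=; last first.
  by case: m m0 => // m _; rewrite ltnS; lia.
rewrite [X in (_ + X)%N](_ : _ = 0)%N ?addn0.
  rewrite big_nat [leqRHS]big_nat; apply: leq_sum => d /andP[d0 _].
  case: (d %| m)%N; last by rewrite mul0n.
  by rewrite mul1n npi_le.
rewrite big_nat big1// => d /andP[md dm].
case: (boolP (d %| m)%N) => // /dvdnP[c mE].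
case: c mE => [|[|c]] mE; [lia|lia|nia].
Qed.

End PolyCount.

(** * Counting sets of given weight *)

Section WeightedSubsets.
Local Close Scope classical_set_scope.
Variables (r q z : nat) (w : 'I_r -> nat).
Implicit Types (I J K L : {set 'I_r}) (i : 'I_r) (m : nat).
Hypothesis w_gtz : forall i, (z < w i)%N.
Hypothesis z_gt0 : (0 < z)%N.
Hypothesis q_gt1 : (1 < q)%N.

Definition wt I : nat := \sum_(i in I) w i.
Definition wsets m : {set {set 'I_r}} := [set I | wt I == m].
Definition wnum m : nat := #|wsets m|.
Definition wnum_in i m : nat := #|[set I in wsets m | i \in I]|.
Definition wcount d : nat := #|[set i | w i == d]|.

Hypothesis wcount_le : forall d, (0 < d)%N -> (d * wcount d <= q ^ d)%N.

Lemma wtU1 i I : i \notin I -> wt (i |: I) = (w i + wt I)%N.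
Proof. exact: big_setU1. Qed.

Lemma wt_eq0 I : (wt I == 0%N) = (I == finset.set0).
Proof.
apply/idP/eqP => [|->]; last by rewrite /wt big_set0.
rewrite /wt sum_nat_eq0 => /forall_inP h; apply/setP => i; rewrite finset.inE.
by apply/negP => /h; rewrite -leqn0 leqNgt (leq_ltn_trans _ (w_gtz i)).
Qed.

Lemma wnum0 : wnum 0 = 1%N.
Proof.
rewrite /wnum (_ : wsets 0 = finset.set1 finset.set0) ?cards1//.
by apply/setP => I; rewrite !finset.inE wt_eq0.
Qed.

Lemma wnum_inE i m : wnum_in i m =
  if (w i <= m)%N then #|[set I in wsets (m - w i) | i \notin I]| else 0%N.
Proof.
case: ifP => [wm|/negbT]; last first.
  rewrite -ltnNge => mw; apply/eqP; rewrite cards_eq0 -finset.subset0; apply/fintype.subsetP => I.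
  rewrite !finset.inE => /andP[/eqP wI iI]; move: mw.
  by rewrite -wI /wt (bigD1 i)//= ltnNge leq_addr.
rewrite /wnum_in -[RHS](@card_in_imset _ _ (fun I => i |: I)).
  apply: eq_card => I; apply/idP/imsetP.
    rewrite !finset.inE => /andP[/eqP wI iI]; exists (I :\ i)%SET.
      rewrite !finset.inE eqxx andbT -(eqn_add2l (w i)) -wtU1 ?finset.inE ?eqxx//.
      by rewrite finset.setD1K// wI subnKC.
    by rewrite finset.setD1K.
  move=> [J]; rewrite !finset.inE => /andP[/eqP wJ iJ] ->.
  by rewrite !finset.inE eqxx wtU1// wJ subnKC// eqxx.
move=> I J; rewrite !finset.inE => /andP[_ iI] /andP[_ iJ] E.
by rewrite -(finset.setU1K iI) -(finset.setU1K iJ) E.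
Qed.

(** Removing [i] turns the sets counted first into the sets of weight [m - w i] that avoid [i]. The
    second term, the sets that contain it, is the correction due to the absence of repeated
    factors. *)
Lemma wnum_in_split i m : (w i <= m)%N ->
  (wnum_in i m + wnum_in i (m - w i) = wnum (m - w i))%N.
Proof.
move=> wm; rewrite [X in (X + _)%N]wnum_inE wm /wnum /wnum_in addnC.
rewrite -[RHS](cardsID [set I : {set 'I_r} | i \in I]); congr (_ + _)%N.
  by apply: eq_card => I; rewrite !finset.inE.
by apply: eq_card => I; rewrite !finset.inE andbC.
Qed.

(** Double counting of the pairs [i \in I] with weight [w i]. Together with [wnum_in_split] it gives
    recursive inequalities for [wnum]. *)
Lemma sum_wnum_in m : (m * wnum m = \sum_i w i * wnum_in i m)%N.
Proof.
transitivity (\sum_(I in wsets m) \sum_(i in I) w i)%N.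
  rewrite /wnum -sum1_card big_distrr/=; apply: eq_bigr => I.
  by rewrite finset.inE muln1 => /eqP.
rewrite (exchange_big_dep xpredT)//=; apply: eq_bigr => i _.
rewrite sum_nat_const mulnC; congr (_ * _)%N; rewrite /wnum_in.
by apply: eq_card => I; rewrite finset.inE unfold_in.
Qed.

Lemma sum_by_weight m (h : nat -> nat) :
  (\sum_(i | w i <= m) w i * h (w i) = \sum_(z.+1 <= d < m.+1) d * wcount d * h d)%N.
Proof.
transitivity (\sum_(i | w i <= m) \sum_(z.+1 <= d < m.+1) (w i == d) * (d * h d))%N.
  apply: eq_bigr => i wm.
  rewrite (bigD1_seq (w i)) ?mem_index_iota ?iota_uniq ?w_gtz//= eqxx mul1n.
  by rewrite big1 ?addn0// => d; rewrite eq_sym => /negbTE ->.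
rewrite exchange_big/= big_nat [RHS]big_nat; apply: eq_bigr => d /andP[zd dm].
rewrite -big_distrl/= -mulnA mulnCA; congr (_ * _)%N; congr (_ * _)%N.
rewrite /wcount -sum1_card [RHS]big_mkcond/= big_mkcond/=.
apply: eq_bigr => i _; rewrite !finset.inE.
by case: (eqVneq (w i) d) => [->|_]; [rewrite -ltnS dm|rewrite if_same].
Qed.

Lemma sum_wnum_le m :
  (m * wnum m <= \sum_(z.+1 <= d < m.+1) d * wcount d * wnum (m - d))%N.
Proof.
rewrite sum_wnum_in -sum_by_weight [leqRHS]big_mkcond/=; apply: leq_sum => i _.
case: ifP => [wm|/negbT wm]; last by rewrite wnum_inE (negbTE wm) muln0.
by rewrite leq_mul2l -wnum_in_split// leq_addr orbT.
Qed.

Lemma wnum_small m : (0 < m <= z)%N -> wnum m = 0%N.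
Proof.
case/andP => m0 mz; have := sum_wnum_le m; rewrite big_geq// leqn0 muln_eq0.
by rewrite gtn_eqF//= => /eqP.
Qed.

Lemma wnum_ub m : (0 < m)%N -> (z * wnum m <= q ^ m)%N.
Proof.
have [n] := ubnP m; elim: n m => // n IH m; rewrite ltnS => mn m0.
have [mz|zm] := leqP m z; first by rewrite wnum_small ?m0// muln0.
rewrite -(leq_pmul2l m0) mulnCA (leq_trans (leq_mul (leqnn z) (sum_wnum_le m)))//.
rewrite big_nat_recr//= mulnDr subnn wnum0 muln1 big_distrr/=.
(* By induction each of the [m - z - 1] terms with [d < m] is at most [q ^ m]. The term [d = m],
   where nothing but the empty set remains, gains no factor [1 / z] and gives [z * q ^ m]. The total
   is below [m * q ^ m]. *)
apply: (@leq_trans (\sum_(z.+1 <= d < m) q ^ m + z * q ^ m)).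
  apply: leq_add; last by rewrite leq_mul2l wcount_le ?orbT.
  rewrite big_nat [leqRHS]big_nat; apply: leq_sum => d /andP[zd dm].
  rewrite mulnCA -{2}(subnKC (ltnW dm)) expnD leq_mul ?wcount_le ?(ltn_trans _ zd)//.
  by rewrite IH ?subn_gt0//; lia.
by rewrite sum_nat_const_nat -mulnDl leq_mul2r; apply/orP; right; lia.
Qed.

Lemma wnum_le m : (wnum m <= q ^ m)%N.
Proof.
case: m => [|m]; first by rewrite wnum0.
by apply: leq_trans (wnum_ub _) => //; rewrite leq_pmull.
Qed.

Lemma wnum_in_le i m : (wnum_in i m <= q ^ (m - z))%N.
Proof.
have [wm|mw] := leqP (w i) m; last by rewrite wnum_inE ifN// -ltnNge.
rewrite (@leq_trans (wnum (m - w i)))//.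
  by rewrite -wnum_in_split// leq_addr.
rewrite (leq_trans (wnum_le _))// leq_exp2l//.
by have := w_gtz i; lia.
Qed.

(** There are at most q^d / d indices of weight d, so each d contributes at most q^(m - d). The
    bound serves twice: for the correction in [sum_wnum_ge] and for the rough polynomials with a
    square factor. *)
Lemma sum_square_le m : (\sum_(i | w i <= m)
    w i * (if w i <= m - w i then q ^ (m - w i - w i) else 0) <= m * q ^ (m - z))%N.
Proof.
rewrite (sum_by_weight m (fun d => if (d <= m - d)%N then q ^ (m - d - d) else 0)%N).
apply: (@leq_trans (\sum_(z.+1 <= d < m.+1) q ^ (m - z))%N); last first.
  by rewrite sum_nat_const_nat leq_mul2r; apply/orP; right; lia.
rewrite big_nat [leqRHS]big_nat; apply: leq_sum => d /andP[zd dm].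
case: ifP => [dd|]; last by rewrite muln0.
rewrite (leq_trans (leq_mul (wcount_le _) (leqnn _))) ?(leq_ltn_trans _ zd)//.
by rewrite -expnD leq_exp2l//; lia.
Qed.

Lemma sum_wnum_ge m :
  (\sum_(z.+1 <= d < m.+1) d * wcount d * wnum (m - d) <=
   m * wnum m + m * q ^ (m - z))%N.
Proof.
rewrite sum_wnum_in -sum_by_weight.
apply: leq_trans (leq_add (leqnn _) (sum_square_le m)).
apply: (@leq_trans (\sum_(i | (w i <= m)%N) (w i * wnum_in i m +
    w i * (if (w i <= m - w i)%N then q ^ (m - w i - w i) else 0)))%N).
  apply: leq_sum => i wm; rewrite -wnum_in_split// mulnDr leq_add2l leq_mul2l.
  apply/orP; right; rewrite wnum_inE; case: ifP => // _.
  apply: leq_trans (wnum_le _); apply: subset_leq_card.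
  by apply/fintype.subsetP => I; rewrite !finset.inE => /andP[].
rewrite big_split/= leq_add2r big_mkcond/=; apply: leq_sum => i _; by case: ifP.
Qed.

(** * Lower bound for the number of sets of given weight *)

Section LowerBound.
Variables (R : realFieldType) (N : nat).
(** The relative deficit of the number of irreducibles of degree d, z < d <= N: as 2 q^(d/2) <= eps
    q^d, there are at least (1 - eps) q^d / d of them. *)
Let eps : R := 2 / 2 ^+ z./2.
Hypothesis wcount_ge :
  forall d, (z < d <= N)%N -> (q ^ d <= d * wcount d + 2 * q ^ d./2)%N.
Hypothesis Nz2 : (N <= z ^ 2)%N.
Hypothesis eps_small : eps * z%:R <= 8^-1.
Hypothesis exp_small : (8 * z ^ 2 <= 2 ^ z)%N.

Let rho m : R := (wnum m)%:R / q%:R ^+ m.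

Let q_gt0 : 0 < q%:R :> R.
Proof. by rewrite ltr0n ltnW. Qed.

Let rho_ge0 m : 0 <= rho m.
Proof. by rewrite divr_ge0// exprn_ge0// ltW. Qed.

Let rhoE j : rho j * q%:R ^+ j = (wnum j)%:R.
Proof. by rewrite /rho divfK// expf_neq0// lt0r_neq0. Qed.

Let rho0 : rho 0 = 1. Proof. by rewrite /rho wnum0 expr0 divr1. Qed.

Let eps_ge0 : 0 <= eps. Proof. by rewrite divr_ge0// exprn_ge0. Qed.

(** [sum_wnum_ge] divided by [q ^ m]; the error [m / q ^ z] is at most 1/8 because [m <= z ^ 2] and
    [8 * z ^ 2 <= 2 ^ z]. *)
Let rho_rec m : (z < m <= N)%N ->
  (1 - eps) * \sum_(z.+1 <= d < m.+1) rho (m - d) <= m%:R * rho m + 8^-1.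
Proof.
move=> /andP[zm mN].
have qm0 : 0 < q%:R ^+ m :> R by rewrite exprn_gt0.
rewrite -(ler_pM2r qm0) [leRHS]mulrDl -(mulrA m%:R) rhoE.
have H := sum_wnum_ge m.
apply: (@le_trans _ _ (m * wnum m + m * q ^ (m - z))%:R).
  apply: le_trans (_ : _ <= (\sum_(z.+1 <= d < m.+1) d * wcount d * wnum (m - d))%:R) _.
    rewrite natr_sum -mulrA mulr_suml mulr_sumr [leLHS]big_nat [leRHS]big_nat.
    apply: ler_sum => d /andP[zd dm].
    have dm' : (d <= m)%N by [].
    rewrite -[X in _ * (_ * q%:R ^+ X)](subnK dm') exprD [rho _ * _]mulrA rhoE.
    rewrite mulrCA mulrC natrM ler_wpM2r//.
    have := wcount_ge (d := d); rewrite zd (leq_trans dm' mN) => /(_ isT).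
    rewrite -(ler_nat R) natrD natrX => h1.
    suff : (2 * q ^ d./2)%:R <= eps * q%:R ^+ d.
      by move: h1; lra.
    rewrite natrM natrX /eps -mulrA ler_pM2l// mulrC ler_pdivlMr ?exprn_gt0//.
    have dE : (d = d./2 + uphalf d)%N by lia.
    rewrite [in leRHS]dE exprD ler_pM2l ?exprn_gt0//.
    apply: (@le_trans _ _ (2 ^+ uphalf d)).
      by rewrite ler_weXn2l ?ler1n//; lia.
    by rewrite lerXn2r ?nnegrE ?ler_nat// ltW.
  by rewrite ler_nat.
rewrite natrD !natrM lerD2l natrX.
have zm' := ltnW zm.
rewrite -[X in 8^-1 * _ ^+ X](subnK zm') exprD mulrCA mulrC ler_pM2l ?exprn_gt0//.
rewrite ler_pdivlMl//.
apply: (@le_trans _ _ (2 ^+ z)).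
  rewrite -natrM -natrX ler_nat (leq_trans _ exp_small)//.
  by rewrite leq_mul2l (leq_trans mN).
by rewrite lerXn2r ?nnegrE ?ler_nat// ltW.
Qed.

(* Strong induction on m: up to small errors m rho(m) is the sum of rho(m - d) over
   z < d <= m, in which d = m contributes 1 and each d < m - z at least 1 / (8 z). *)
Lemma wnum_lb m : (z < m <= N)%N -> (8 * z)%:R^-1 <= rho m.
Proof.
have [n] := ubnP m; elim: n m => // n IH m; rewrite ltnS => mn /andP[zm mN].
have := rho_rec (m := m); rewrite zm mN => /(_ isT) H.
have z0 : 0 < z%:R :> R by rewrite ltr0n.
have z1 : 1 <= z%:R :> R by rewrite ler1n.
have m0 : 0 < m%:R :> R by rewrite ltr0n (leq_ltn_trans _ zm).
have eps8 : eps <= 8^-1.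
  by apply: le_trans eps_small; rewrite ler_peMr.
have S1 : 1 + (m - z.+1 - z)%:R / (8 * z)%:R <= \sum_(z.+1 <= d < m.+1) rho (m - d).
  rewrite big_nat_recr//= subnn rho0 [leRHS]addrC lerD2l.
  have [small|big] := leqP (m - z) z.+1.
    rewrite (_ : m - z.+1 - z = 0)%N ?mul0r ?sumr_ge0//; lia.
  rewrite (@big_cat_nat _ _ _ (m - z))/=; [|lia|lia].
  rewrite ler_wpDr ?sumr_ge0//.
  have -> : (m - z.+1 - z)%:R * (8 * z)%:R^-1 = \sum_(z.+1 <= d < m - z) (8 * z)%:R^-1 :> R.
    rewrite sumr_const_nat -[RHS]mulr_natl; congr (_%:R * _); lia.
  apply: ler_sum_nat => d /andP[zd dm].
  apply: IH; lia.
rewrite -(ler_pM2l m0); apply: le_trans (_ : _ <= (1 - eps) *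
   (1 + (m - z.+1 - z)%:R / (8 * z)%:R) - 8^-1) _; last first.
  rewrite lerBlDr (le_trans _ H)// ler_wpM2l//; lra.
have epsZ := eps_small; rewrite natrM; set Z := z%:R in z0 z1 epsZ *.
have M2 : m%:R <= Z ^+ 2 by rewrite -natrX ler_nat (leq_trans mN).
have Zn0 : Z != 0 by rewrite gt_eqF.
(* Up to m = 2 z + 1 <= 3 z the term 1 is enough, the target m / (8 z) being at most 3/8. Beyond,
   the 2 z + 1 missing terms cost 1/4 + 1/(8 z), which the term 1 absorbs together with the errors
   in [eps]. *)
have [small|big] := leqP m (z.+1 + z).
  have -> : (m - z.+1 - z = 0)%N by apply/eqP; rewrite -subnDA subn_eq0.
  rewrite mul0r addr0 mulr1.
  have : m%:R / (8 * Z) <= 3 / 8.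
    rewrite ler_pdivrMr; last lra.
    have : m%:R <= (z.+1 + z)%:R :> R by rewrite ler_nat.
    rewrite natrD -addn1 natrD -/Z; lra.
  lra.
rewrite (_ : (m - z.+1 - z)%:R = m%:R - 2 * Z - 1); last first.
  rewrite -subnDA natrB 1?ltnW// natrD -addn1 natrD -/Z; ring.
have -> : (m%:R - 2 * Z - 1) / (8 * Z) = m%:R / (8 * Z) - 4^-1 - (8 * Z)^-1.
  by field.
have : (8 * Z)^-1 <= 8^-1 by rewrite lef_pV2 ?posrE; lra.
have : 0 <= (8 * Z)^-1 by rewrite invr_ge0; lra.
have : m%:R / (8 * Z) <= Z / 8.
  rewrite ler_pdivrMr; last lra.
  by apply: le_trans M2 _; rewrite expr2; lra.
set t := m%:R / (8 * Z); set u := (8 * Z)^-1 => h1 h2 h3.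
have : eps * t <= 64^-1.
  apply: le_trans (_ : _ <= eps * (Z / 8)) _; first by rewrite ler_wpM2l.
  rewrite mulrA; lra.
have : 0 <= eps * u by rewrite mulr_ge0.
by move: t u eps8 h1 h2 h3 => t u; lra.
Qed.

End LowerBound.

Definition same_top I K : bool :=
  [exists i : 'I_r, [&& i \in I, i \in K, [forall (j | j \in I), (j <= i)%N]
                     & [forall (j | j \in K), (j <= i)%N]]].

Definition balanced I J K L : bool :=
  [forall l : 'I_r, ((l \in I) + (l \in J) == (l \in K) + (l \in L))%N].

(* With p = ((I, K), (J, L)), the off-diagonal terms in the expansion of
   E |y_i y_j| ^ 2, where y_i gathers the sets with largest element i. *)
Definition offdiag m : {set ({set 'I_r} * {set 'I_r}) * ({set 'I_r} * {set 'I_r})} :=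
  [set p | [&& (p.1.1 \in wsets m) && (p.1.2 \in wsets m),
               (p.2.1 \in wsets m) && (p.2.2 \in wsets m), p.1.1 != p.1.2,
               same_top p.1.1 p.1.2 && same_top p.2.1 p.2.2
             & balanced p.1.1 p.2.1 p.1.2 p.2.2]].

Lemma wtID I K : wt I = (wt (I :&: K) + wt (I :\: K))%N.
Proof. exact: big_setID. Qed.

(* The quadruples of sets are parametrized as I = a U b, K = a U c, J = c U d,
   L = b U d; the conditions on the maxima force a to be nonempty, and I <> K
   forces b to be nonempty. *)
Lemma card_offdiag m :
  (#|offdiag m| <= \sum_(1 <= n < m) (wnum n * wnum (m - n)) ^ 2)%N.
Proof.
pose quad := (({set 'I_r} * {set 'I_r}) * ({set 'I_r} * {set 'I_r}))%type.
pose g (t : quad) : quad := ((t.1.1 :|: t.1.2, t.1.1 :|: t.2.1),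
                             (t.2.1 :|: t.2.2, t.1.2 :|: t.2.2))%SET.
pose T n : {set quad} := finset.setX (finset.setX (wsets n) (wsets (m - n)))
                                     (finset.setX (wsets (m - n)) (wsets n)).
apply: (@leq_trans #|\bigcup_(n in [set n : 'I_m | (0 < n)%N]) (g @: T n)|).
  apply: subset_leq_card; apply/fintype.subsetP => -[[I K] [J L]].
  rewrite !finset.inE/= => /and5P[/andP[/eqP wI /eqP wK] /andP[/eqP wJ /eqP wL] IK].
  move=> /andP[top _] /forallP bal.
  pose a := I :&: K; pose b := I :\: K; pose c := K :\: I; pose e := J :\: c.
  have EI : I = a :|: b by rewrite finset.setID.
  have EK : K = a :|: c by rewrite /a finset.setIC finset.setID.
  (* On [b] the balance forces [l] into [L] and out of [J], on [c] the reverse, and elsewhere [J]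
     and [L] agree; so [e], the fourth part d of the parametrization, is [J :&: L]. *)
  have balb l : [&& (l \in J) == (l \in c) || (l \in e)
                 & (l \in L) == (l \in b) || (l \in e)].
    have := bal l; rewrite !finset.inE.
    by case: (l \in I); case: (l \in J); case: (l \in K); case: (l \in L).
  have EJ : J = c :|: e.
    by apply/setP => l; have /andP[/eqP -> _] := balb l; rewrite finset.in_setU.
  have EL : L = b :|: e.
    by apply/setP => l; have /andP[_ /eqP ->] := balb l; rewrite finset.in_setU.
  have cJ : J :&: c = c.
    by apply/finset.setIidPr; rewrite EJ finset.subsetUl.
  (* With [n = wt a], the three equations give [wt b = wt c = m - n] and [wt e = n], the weights
     prescribed by [T n]. *)
  have w1 : (wt a + wt b = m)%N by rewrite -wtID.
  have w2 : (wt a + wt c = m)%N by rewrite /a finset.setIC -wtID.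
  have w3 : (wt c + wt e = m)%N by rewrite -wJ (wtID J c) cJ.
  have a0 : (0 < wt a)%N.
    rewrite lt0n wt_eq0; case/existsP: top => i /and4P[iI iK _ _].
    by apply/set0Pn; exists i; rewrite finset.inE iI.
  have b0 : (0 < wt b)%N.
    rewrite lt0n; apply: contra IK => b0.
    have c0 : wt c == 0%N by lia.
    by move: b0 c0; rewrite !wt_eq0 => /eqP b0 /eqP c0; rewrite EI EK b0 c0.
  have am : (wt a < m)%N by lia.
  apply/finset.bigcupP; exists (Ordinal am); first by rewrite finset.inE.
  apply/imsetP; exists ((a, b), (c, e)); last by rewrite /g/= -EI -EK -EJ -EL.
  by rewrite !finset.inE/=; apply/andP; split; apply/andP; split; lia.
apply: (@leq_trans (\sum_(n in [set n : 'I_m | (0 < n)%N]) #|T n|)%N).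
  elim/big_rec2: _ => [|n A c _ IH]; first by rewrite cards0.
  apply: (leq_trans (leq_card_setU _ _)); apply: leq_add IH.
  exact: leq_imset_card.
have -> : (\sum_(n in [set n : 'I_m | (0 < n)%N]) #|T n| = \sum_(n < m | (0 < n)%N) #|T n|)%N.
  by apply: eq_bigl => n; rewrite finset.inE.
rewrite -(big_mkord (fun n => 0 < n)%N (fun n => #|T n|)) big_mkcond/=.
case: m @T => [|m] T; first by rewrite big_geq.
rewrite big_ltn//= add0n leq_eqVlt; apply/orP; left; apply/eqP.
apply: eq_big_nat => n /andP[n0 _]; rewrite n0 !cardsX /wnum.
by rewrite expnS expn1 mulnAC !mulnA.
Qed.

Lemma offdiag_le m : (z ^ 4 * #|offdiag m| <= m * q ^ (2 * m))%N.
Proof.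
apply: leq_trans (leq_mul (leqnn _) (card_offdiag m)) _.
rewrite big_distrr/=; apply: (@leq_trans (\sum_(1 <= n < m) q ^ (2 * m))).
  rewrite big_nat [leqRHS]big_nat; apply: leq_sum => n /andP[n0 nm].
  rewrite (_ : z ^ 4 = (z * z) ^ 2)%N; last by rewrite mulnn -expnM.
  rewrite -expnMn mulnACA (mulnC 2) expnM leq_sqr.
  rewrite -{2}(subnKC (ltnW nm)) expnD leq_mul ?wnum_ub//.
  by rewrite subn_gt0.
by rewrite sum_nat_const_nat leq_mul2r leq_subr orbT.
Qed.

End WeightedSubsets.

(** * Sums of monomials over sets of given weight *)

Section Chaos.
Local Close Scope classical_set_scope.
Context {R : realType} d (T : measurableType d) (P : probability T R).
Local Notation C := R[i].
Local Notation re := (@complex.Re R).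
Local Notation im := (@complex.Im R).
Variables (r : nat) (F : nat -> set (set T)) (x : nat -> T -> C).
Hypothesis F_measurable : forall j, (F j `<=` measurable)%classic.
Hypothesis F_mono : forall i j, (i <= j)%N -> (F i `<=` F j)%classic.
Hypothesis x_unit : forall j w, normsq (x j w) = 1.
Hypothesis x_adapted : forall i j, (i < j)%N -> cadapted F j (x i).
Hypothesis x_orth : forall j a H, (j < r)%N -> (0 < a)%N -> adapted F j H ->
  esp P (fun w => H w * re (x j w ^+ a)) = 0 /\
  esp P (fun w => H w * im (x j w ^+ a)) = 0.
Variables (wgt : 'I_r -> nat) (m : nat).
Hypothesis m_gt0 : (0 < m)%N.
Implicit Types (I J K L : {set 'I_r}).

(** An exponent function on all of [nat], as [monomial] takes it; it vanishes from [r] on. *)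
Definition ind I (i : nat) : bool := [exists l : 'I_r, (l == i :> nat) && (l \in I)].
Definition istop (j : nat) I : bool := ind I j && [forall (i | i \in I), (i <= j)%N].
Let mono I w : C := monomial x r (ind I) w.
Let fam (j : nat) I : bool := (I \in wsets wgt m) && istop j I.

Lemma ind_ord I (l : 'I_r) : ind I l = (l \in I).
Proof.
apply/existsP/idP => [[i /andP[/eqP /val_inj <-]//]|lI].
by exists l; rewrite eqxx.
Qed.

Lemma agree_ind I K : agree r (ind I) (ind K) = (I == K).
Proof.
apply/forallP/eqP => [h|-> //]; apply/setP => i.
by have := h i; rewrite !ind_ord; case: (i \in I); case: (i \in K).
Qed.

Lemma agree_ind2 I J K L : agree r (fun i => ind I i + ind J i)%N
  (fun i => ind K i + ind L i)%N = balanced I J K L.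
Proof. by apply: eq_forallb => i; rewrite !ind_ord. Qed.

Lemma balanced_eq I J L : balanced I J I L = (J == L).
Proof.
apply/forallP/eqP => [h|->//]; apply/setP => i.
by have := h i; rewrite eqn_add2l; case: (i \in J); case: (i \in L).
Qed.

Lemma istop_ord_inj I (j j' : 'I_r) : istop j I -> istop j' I -> j = j'.
Proof.
rewrite /istop !ind_ord => /andP[jI /forall_inP h] /andP[jI' /forall_inP h'].
by apply/val_inj/eqP; rewrite eqn_leq h// h'.
Qed.

Lemma sum_istop (V : nmodType) (A : pred {set 'I_r}) (G : {set 'I_r} -> V) :
  (forall I, A I -> I != finset.set0) ->
  \sum_(j < r) \sum_(I | A I && istop j I) G I = \sum_(I | A I) G I.
Proof.
move=> A0; rewrite (exchange_big_dep A)/=; last by move=> j I _ /andP[].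
apply: eq_bigr => I AI.
have /finset.set0Pn[i iI] := A0 I AI.
case: (@arg_maxnP _ i (fun i => i \in I) val iI) => j jI hj.
rewrite (big_pred1 j)// => j' /=; rewrite AI /=.
have tj : istop j I by rewrite /istop ind_ord jI; apply/forall_inP.
by apply/idP/eqP => [h|->//]; exact: istop_ord_inj h tj.
Qed.

Lemma wsets_neq0 I : I \in wsets wgt m -> I != finset.set0.
Proof.
apply: contraL => /eqP ->; rewrite finset.inE /wt big_set0.
by rewrite eq_sym -lt0n.
Qed.

Lemma monomialD n e e' w :
  monomial x n (fun i => e i + e' i)%N w = monomial x n e w * monomial x n e' w.
Proof. by rewrite /monomial -big_split/=; apply: eq_bigr => i _; rewrite exprD. Qed.

Lemma monomial_istop (j : 'I_r) I w : istop j I ->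
  mono I w = x j w * monomial x j (ind I) w.
Proof.
rewrite /istop => /andP[jI /forall_inP h].
rewrite /mono /monomial (@big_cat_nat _ _ _ j.+1)//= big_nat_recr//= jI expr1.
rewrite [X in _ * X]big_nat_cond [X in _ * X]big1 ?mulr1 1?mulrC// => i; rewrite andbT => /andP[ji _].
rewrite (_ : ind I i = false) ?expr0//; apply: contraTF ji => /existsP[l /andP[/eqP <- /h]].
by rewrite -leqNgt.
Qed.

(* Grouping the sets by their largest element j turns the sum into a martingale:
   the increment is g_j = x_j y_j, and y_j only involves the x_i with i < j. *)
Let y (j : nat) w : C := \sum_(I | fam j I) monomial x j (ind I) w.
Let g (j : nat) w : C := \sum_(I | fam j I) mono I w.
Let n (j : nat) w : R := normsq (y j w).
Let c (j : nat) : R := \sum_(I | fam j I) 1.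
Let O (j j' : nat) : R := \sum_(p : {set 'I_r} * {set 'I_r} | fam j p.1 && fam j' p.2)
  \sum_(p' : {set 'I_r} * {set 'I_r} | fam j p'.1 && fam j' p'.2)
   ((p.1 != p'.1) && balanced p.1 p.2 p'.1 p'.2)%:R.

Let gE (j : 'I_r) w : g j w = x j w * y j w.
Proof.
by rewrite /y mulr_sumr; apply: eq_bigr => I /andP[_ tI]; exact: monomial_istop.
Qed.

Let nE (j : 'I_r) w : n j w = normsq (g j w).
Proof. by rewrite gE normsqM x_unit mul1r. Qed.

Let y_adapted j : cadapted F j (y j).
Proof. by apply: cbmeas_sum => I _; exact: monomial_adapted. Qed.

Let y_cbmeas j : cbmeas (y j).
Proof. exact: (cadapted_cbmeas F_measurable (y_adapted j)). Qed.

Let n_bmeas j : bmeas (n j).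
Proof. exact: bmeas_normsq. Qed.

Let esp_n (j : 'I_r) : esp P (n j) = c j.
Proof.
rewrite (eq_esp _ (nE j)) (esp_normsq_sum F_measurable x_unit x_adapted x_orth).
apply: eq_bigr => I fI; rewrite (bigD1 I)//= agree_ind eqxx big1 ?addr0// => K /andP[_ KI].
by rewrite agree_ind eq_sym (negbTE KI).
Qed.

(** In the expansion over quadruples (I, J, K, L), I = K forces J = L by balance, and these terms
    number [c j * c j']; all the others make up [O j j']. *)
Let esp_nn (j j' : 'I_r) : esp P (fun w => n j w * n j' w) = c j * c j' + O j j'.
Proof.
rewrite (@eq_esp _ _ _ _ _ (fun w => normsq (\sum_(p : {set 'I_r} * {set 'I_r} | fam j p.1 && fam j' p.2)
   monomial x r (fun i => ind p.1 i + ind p.2 i)%N w))); last first.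
  move=> w; rewrite !nE -normsqM /g big_distrlr/= pair_big/=; congr normsq.
  by apply: eq_bigr => p _; rewrite monomialD.
rewrite (esp_normsq_sum F_measurable x_unit x_adapted x_orth).
have -> : c j * c j' = \sum_(p : {set 'I_r} * {set 'I_r} | fam j p.1 && fam j' p.2) 1.
  by rewrite /c big_distrlr/= pair_big/=; apply: eq_bigr => p _; rewrite mulr1.
rewrite /O -big_split/=; apply: eq_bigr => -[I J]/= fp.
rewrite (bigD1 (I, J))//= [X in _ = _ + X](bigD1 (I, J))//= eqxx /= add0r.
rewrite agree_ind2 balanced_eq eqxx; congr (_ + _).
apply: eq_bigr => -[K L] /andP[_ neq]; rewrite agree_ind2 /=.
case: eqP => [e|//]; rewrite -e balanced_eq /= in neq *.
by rewrite xpair_eqE eqxx /= eq_sym in neq; rewrite (negbTE neq).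
Qed.

Let O_ge0 j j' : 0 <= O j j'.
Proof. by rewrite sumr_ge0// => p _; rewrite sumr_ge0. Qed.

Let sum_istop2 I K : (\sum_(j < r) (istop j I && istop j K) <= same_top I K)%N.
Proof.
have [/forallP h|] := boolP [forall j : 'I_r, ~~ (istop j I && istop j K)].
  by rewrite big1// => j _; rewrite (negbTE (h j)).
rewrite negb_forall => /existsP[j]; rewrite negbK => /andP[jI jK].
rewrite (bigD1 j)//= jI jK big1 => [|j' /negP nj]; last first.
  by case: (boolP (istop j' I)) => //= h; case: nj; rewrite (istop_ord_inj h jI).
rewrite (_ : same_top I K)//; apply/existsP; exists j.
by move: jI jK; rewrite /istop !ind_ord => /andP[-> ->] /andP[-> ->].
Qed.

Let sum_O : \sum_(j < r) \sum_(j' < r) O j j' <= #|offdiag wgt m|%:R.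
Proof.
pose quad := (({set 'I_r} * {set 'I_r}) * ({set 'I_r} * {set 'I_r}))%type.
pose B (p : quad) : nat := [&& (p.1.1 \in wsets wgt m) && (p.1.2 \in wsets wgt m),
   (p.2.1 \in wsets wgt m) && (p.2.2 \in wsets wgt m), p.1.1 != p.1.2 &
   balanced p.1.1 p.2.1 p.1.2 p.2.2].
have OE (j j' : 'I_r) : O j j' = (\sum_(p : quad) B p * (istop j p.1.1 && istop j p.1.2) *
     (istop j' p.2.1 && istop j' p.2.2))%N%:R.
  rewrite /O pair_big_dep/= natr_sum big_mkcond/=.
  (* [O] groups I with J and K with L, whereas [offdiag] groups I with K and J with L; the swap
     exchanges the two middle entries. *)
  pose sw (p : quad) : quad := ((p.1.1, p.2.1), (p.1.2, p.2.2)).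
  have swK : involutive sw by move=> [[? ?] [? ?]].
  rewrite [LHS](reindex_inj (inv_inj swK)); apply: eq_bigr => -[[I K] [J L]] _ /=.
  rewrite /B /fam /=.
    rewrite !mulnb; case: (I \in wsets wgt m); case: (K \in wsets wgt m);
  case: (J \in wsets wgt m); case: (L \in wsets wgt m); rewrite ?andbF//=;
  case: (istop j I); case: (istop j K); case: (istop j' J); case: (istop j' L);
  by rewrite ?andbF ?andbT.
under eq_bigr do under eq_bigr do rewrite OE.
under eq_bigr do rewrite -natr_sum.
rewrite -natr_sum ler_nat.
under eq_bigr do rewrite exchange_big/=.
rewrite exchange_big/= -sum1_card [leqRHS]big_mkcond/=; apply: leq_sum => p _.
under eq_bigr do rewrite -big_distrr/=.
rewrite -big_distrl/= -big_distrr/=.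
apply: leq_trans (leq_mul (leq_mul (leqnn _) (sum_istop2 _ _)) (sum_istop2 _ _)) _.
rewrite finset.inE /B !mulnb; case: (p.1.1 \in wsets wgt m); case: (p.1.2 \in wsets wgt m);
case: (p.2.1 \in wsets wgt m); case: (p.2.2 \in wsets wgt m) => //=;
case: (same_top p.1.1 p.1.2); case: (same_top p.2.1 p.2.2);
by case: (p.1.1 != p.1.2); case: (balanced _ _ _ _).
Qed.

(** [V a] is the total of the |y_j|^2 on the scale [a], to be compared with 1; [Q a] is the total of
    the |y_j|^4 on the scale [a ^+ 2]. *)
Let V (a : R) w : R := a^-1 * \sum_(j < r) n j w.
Let Q (a : R) w : R := a^-1 ^+ 2 * \sum_(j < r) n j w ^+ 2.
Let rho : R := #|wsets wgt m|%:R.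
Let off : R := #|offdiag wgt m|%:R.

Let n_ge0 j w : 0 <= n j w. Proof. exact: normsq_ge0. Qed.

Let sum_c : \sum_(j < r) c j = rho.
Proof.
by rewrite /c sum_istop => [|I /wsets_neq0//]; rewrite /rho -sum1_card natr_sum.
Qed.

Let bsum_n : bmeas (fun w => \sum_(j < r) n j w).
Proof. exact: bmeas_sum. Qed.

Let V_bmeas a : bmeas (V a).
Proof. by apply: bmeasM bsum_n; exact: bmeas_cst. Qed.

Let Q_bmeas a : bmeas (Q a).
Proof.
by apply: bmeasM; [exact: bmeas_cst|apply: bmeas_sum => j _; exact: bmeasX].
Qed.

Let esp_V a : esp P (V a) = rho / a.
Proof.
rewrite /V espZ ?esp_sum//; under eq_bigr do rewrite esp_n.
by rewrite sum_c mulrC.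
Qed.

Let esp_V1 a : 0 < a ->
  esp P (fun w => (V a w - 1) ^+ 2) <= (1 - rho / a) ^+ 2 + off / a ^+ 2.
Proof.
move=> a0.
rewrite (@eq_esp _ _ _ _ _ (fun w => (a^-1 ^+ 2 * \sum_(j < r) \sum_(j' < r) n j w * n j' w
   - 2 * V a w) + 1)); last first.
  by move=> w; rewrite -big_distrlr/= /V; ring.
have b2 : bmeas (fun w => \sum_(j < r) \sum_(j' < r) n j w * n j' w).
  by apply: bmeas_sum => j _; apply: bmeas_sum => j' _; exact: bmeasM.
have b3 : bmeas (fun w => 2 * V a w) by apply: bmeasM => //; exact: bmeas_cst.
have b4 : bmeas (fun w => a^-1 ^+ 2 * \sum_(j < r) \sum_(j' < r) n j w * n j' w).
  by apply: bmeasM => //; exact: bmeas_cst.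
rewrite espD; [|exact: bmeasB|exact: bmeas_cst].
rewrite espB// [X in X - _]espZ// [X in _ - X]espZ// esp_cst esp_V esp_sum; last first.
  by move=> j _; apply: bmeas_sum => j' _; exact: bmeasM.
under eq_bigr => j _.
  rewrite esp_sum; last by move=> j' _; exact: bmeasM.
  under eq_bigr do rewrite esp_nn.
  rewrite big_split/= -mulr_sumr sum_c.
  over.
rewrite big_split/= -mulr_suml sum_c.
have -> : a^-1 ^+ 2 * (rho * rho + \sum_(j < r) \sum_(j' < r) O j j') - 2 * (rho / a) + 1 =
   (1 - rho / a) ^+ 2 + (\sum_(j < r) \sum_(j' < r) O j j') / a ^+ 2.
  by field; rewrite gt_eqF.
by rewrite lerD2l ler_pM2r ?invr_gt0 ?exprn_gt0.
Qed.

(** The diagonal case of [esp_nn] gives c_j^2 + O_jj. As c_j is at most the number of sets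
    containing j, hence at most [B], the squares sum to at most [B * rho]. *)
Let esp_Q a B : 0 < a -> (forall j : 'I_r, (wnum_in wgt j m <= B)%N) ->
  esp P (Q a) <= (B%:R * rho + off) / a ^+ 2.
Proof.
move=> a0 hB; rewrite /Q espZ; last by apply: bmeas_sum => j _; exact: bmeasX.
rewrite esp_sum => [|j _]; last exact: bmeasX.
rewrite [leRHS]mulrC exprVn ler_pM2l ?invr_gt0 ?exprn_gt0//.
have -> : \sum_(j < r) esp P (fun w => n j w ^+ 2) =
    \sum_(j < r) (c j * c j + O j j).
  by apply: eq_bigr => j _; rewrite -esp_nn.
rewrite big_split/=; apply: lerD.
  rewrite -sum_c mulr_sumr; apply: ler_sum => j _.
  apply: ler_wpM2r; first by rewrite sumr_ge0.
  apply: le_trans (_ : (wnum_in wgt j m)%:R <= _); last by rewrite ler_nat.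
  rewrite /c /wnum_in -sum1_card natr_sum [leLHS]big_mkcond [leRHS]big_mkcond/=.
  apply: ler_sum => I _; rewrite finset.inE /fam /istop ind_ord.
  by case: (I \in _); case: (j \in I) => //=; case: ifP.
apply: le_trans sum_O; apply: ler_sum => j _.
by rewrite (bigD1 j)//= lerDl sumr_ge0.
Qed.

Definition chaos w : C := \sum_(I in wsets wgt m) monomial x r (ind I) w.

Theorem chaos_cos (a delta eta s t theta lam : R) B : lam = s ^+ 2 + t ^+ 2 ->
  0 < a -> 0 < eta -> rho <= a -> (forall j : 'I_r, (wnum_in wgt j m <= B)%N) ->
  (1 - rho / a) ^+ 2 + off / a ^+ 2 <= delta -> (B%:R * rho + off) / a ^+ 2 <= delta ->
  `|esp P (fun w => cos (s * (re (chaos w) / Num.sqrt a) +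
      t * (im (chaos w) / Num.sqrt a) + theta)) -
    expR (- lam / 4) * cos theta| <=
  lam / 4 * (eta + delta / eta) + eta * lam / 2 + (lam ^+ 2 / (2 * eta) + 2 * lam ^+ 2) * delta.
Proof.
move=> lamE a0 eta0 rhoa hB hd1 hd2.
have lam0 : 0 <= lam by rewrite lamE addr_ge0 ?sqr_ge0.
have sa0 : 0 < Num.sqrt a by rewrite sqrtr_gt0.
have sa2 : Num.sqrt a ^+ 2 = a by rewrite sqr_sqrtr// ltW.
(* Chosen so that the real part of [alpha * chaos w] is the linear form inside the cosine. *)
pose alpha : C := (s / Num.sqrt a) +i* (- t / Num.sqrt a).
have alpha2 : normsq alpha = lam / a.
  by rewrite /normsq /= -[in RHS]sa2 lamE; field; rewrite gt_eqF.
pose Y j w := alpha * y j w.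
have Y_ad j : (j < r)%N -> cadapted F j (Y j).
  by move=> _; apply: cbmeasM (y_adapted j); exact: cbmeas_cst.
have k0 : 0 <= lam / 4 by rewrite divr_ge0.
have xY (j : 'I_r) w : x j w * Y j w = alpha * g j w by rewrite gE /Y; ring.
have nY j w : normsq (Y j w) = lam / a * n j w by rewrite /Y normsqM alpha2.
have := martingale_cos F_measurable F_mono x_unit x_adapted x_orth theta Y_ad k0.
rewrite (@eq_esp _ _ _ P _ (fun w => cos (s * (re (chaos w) / Num.sqrt a) +
      t * (im (chaos w) / Num.sqrt a) + theta))); last first.
  move=> w; congr (cos (_ + _)).
  rewrite big_mkord; under eq_bigr do rewrite xY.
  rewrite -re_sum -mulr_sumr /g sum_istop => [|I /wsets_neq0//].
  by rewrite -/(chaos w) reM /=; ring.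
rewrite mulNr => /le_trans; apply.
(* The three terms bound the deviation of the quadratic variation from [lam / 4], the quadratic part
   of the cubes, and all fourth powers. *)
pose W w := lam / 2 * `|V a w - 1| + eta * lam / 2 * V a w +
   (lam ^+ 2 / (2 * eta) + 2 * lam ^+ 2) * Q a w.
have bV1 : bmeas (fun w => V a w - 1) by apply: bmeasB => //; exact: bmeas_cst.
have bW1 : bmeas (fun w => lam / 2 * `|V a w - 1|).
  by apply: bmeasM (bmeas_norm bV1); exact: bmeas_cst.
have bW2 : bmeas (fun w => eta * lam / 2 * V a w) by apply: bmeasM => //; exact: bmeas_cst.
have bW3 : bmeas (fun w => (lam ^+ 2 / (2 * eta) + 2 * lam ^+ 2) * Q a w).
  by apply: bmeasM => //; exact: bmeas_cst.
have bW12 := bmeasD bW1 bW2.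
have bW : bmeas W by exact: bmeasD.
have bY j : cbmeas (Y j) by apply: cbmeasM (y_cbmeas j); exact: cbmeas_cst.
have bX j : bmeas (fun w => re (x j w * Y j w)).
  by case: (cbmeasM (x_cbmeas F_measurable x_adapted j) (bY j)).
have bD j : bmeas (fun w => normsq (Y j w) / 4).
  by apply: bmeasM (bmeas_normsq (bY j)) _; exact: bmeas_cst.
apply: (@le_trans _ _ (esp P W)).
  apply: le_esp => //.
    apply: bmeasD.
      apply: bmeasM; first exact: bmeas_cst.
      apply/bmeas_norm/bmeasB; last exact: bmeas_cst.
      by apply: bmeas_sum => j _.
    apply: bmeas_sum => j _; apply: bmeasD (bmeasX 2 (bD j)).
    by apply: bmeasD (bmeasX 4 (bX j)); exact: bmeasX 3 (bmeas_norm (bX j)).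
  move=> w; rewrite /W -addrA; apply: lerD.
    rewrite big_mkord (eq_bigr (fun j : 'I_r => lam / 4 / a * n j w)); last first.
      by move=> j _; rewrite nY; ring.
    rewrite -mulr_sumr (_ : _ - _ = lam / 4 * (V a w - 1)); last by rewrite /V; ring.
    by rewrite normrM (ger0_norm k0) le_eqVlt; apply/orP; left; apply/eqP; field.
  rewrite big_mkord /V /Q !mulrA !mulr_sumr -big_split/=; apply: ler_sum => j _.
  rewrite nY; set v := n j w; have v0 : 0 <= v := n_ge0 j w.
  set X := re _.
  have X2 : X ^+ 2 <= lam / a * v.
    rewrite -nY -[normsq _]mul1r -(x_unit j w) -normsqM /normsq.
    by rewrite lerDl sqr_ge0.
  set u := lam / a * v in X2 *.
  have u0 : 0 <= u by rewrite mulr_ge0// divr_ge0// ltW.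
  have X4 : X ^+ 4 <= u ^+ 2.
    by rewrite (exprM X 2 2) ler_pXn2r ?nnegrE ?sqr_ge0.
  (* The cube is replaced by even powers through [2 * eta * b <= b ^+ 2 + eta ^+ 2] with [b = |X|],
     so that no third moment is needed. *)
  have X3 : `|X| ^+ 3 <= (eta * u + u ^+ 2 / eta) / 2.
    have E2 : `|X| ^+ 2 = X ^+ 2 by rewrite real_normK ?num_real.
    apply: (@le_trans _ _ ((eta * X ^+ 2 + X ^+ 4 / eta) / 2)).
      rewrite (_ : X ^+ 4 = `|X| ^+ 4) -?E2; last by rewrite (exprM `|X| 2 2) E2 -exprM.
      set b := `|X|; rewrite -subr_ge0.
      have -> : (eta * b ^+ 2 + b ^+ 4 / eta) / 2 - b ^+ 3 = b ^+ 2 * (b - eta) ^+ 2 / (2 * eta).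
        by field; rewrite gt_eqF.
      by apply: divr_ge0; apply: mulr_ge0; rewrite ?sqr_ge0 ?(ltW eta0).
    by rewrite ler_pM2r// lerD ?ler_pM2l// ler_pM2r ?invr_gt0.
  rewrite [leRHS](_ : _ = (eta * u + u ^+ 2 / eta) / 2 + 2 * u ^+ 2); last first.
    by rewrite /u /v; field; rewrite !gt_eqF.
  rewrite -addrA; apply: lerD => //.
  have := sqr_ge0 u; rewrite expr_div_n; lra.
rewrite /W espD// espD// (espZ P _ (bmeas_norm bV1)) (espZ P _ (V_bmeas a)) (espZ P _ (Q_bmeas a)).
rewrite esp_V; apply: lerD; first apply: lerD.
- rewrite (_ : lam / 4 * _ = lam / 2 * ((eta + delta / eta) / 2)); last by field; rewrite gt_eqF.
  apply: ler_wpM2l; first by rewrite divr_ge0.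
  apply: le_trans (esp_abs_le P eta0 bV1) _.
  rewrite ler_pM2r// lerD2l ler_pM2r ?invr_gt0//.
  exact: le_trans (esp_V1 a0) hd1.
- rewrite -[leRHS]mulr1; apply: ler_wpM2l.
    by rewrite divr_ge0// mulr_ge0// ltW.
  by rewrite ler_pdivrMr// mul1r.
- apply: ler_wpM2l; last exact: le_trans (esp_Q a0 hB) hd2.
  have l2 := exprn_ge0 2 lam0; have e2 : 0 <= 2 * eta by rewrite mulr_ge0// ltW.
  by apply: addr_ge0; [exact: divr_ge0|exact: mulr_ge0].
Qed.

End Chaos.

(** * Rough polynomials *)

Section RoughPolynomials.
Local Close Scope classical_set_scope.
Variables (k : finFieldType) (N z : nat).
Hypotheses (z_gt0 : (0 < z)%N) (zN : (z < N)%N).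
Implicit Types (Q : {poly k}) (s : seq {poly k}) (F G : {poly_(N.+1) k}).

Lemma count_factors s s' Q : all (@mirr k) s -> all (@mirr k) s' -> mirr Q ->
  \prod_(G <- s) G = \prod_(G <- s') G -> count_mem Q s = count_mem Q s'.
Proof.
move=> hs hs' iQ E; apply/eqP; rewrite eqn_leq; apply/andP; split.
  by rewrite -(dvdp_prod_mirr _ iQ hs') -E dvdp_prod_mirr.
by rewrite -(dvdp_prod_mirr _ iQ hs) E dvdp_prod_mirr.
Qed.

Definition large_irrs : seq {poly k} := [seq Q <- irrs k N | (z < pdeg Q)%N].
Local Notation ps := large_irrs.
Local Notation r := (size ps).
Definition large_deg (i : 'I_r) : nat := pdeg (nth 0 ps i).
Local Notation w := large_deg.

Lemma large_irrs_uniq : uniq ps.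
Proof. exact/filter_uniq/uniq_irrs. Qed.

Lemma mem_large_irrs Q : (Q \in ps) = [&& (z < pdeg Q)%N, mirr Q & (pdeg Q <= N)%N].
Proof. by rewrite mem_filter mem_irrs. Qed.

Lemma large_irrs_mirr Q : Q \in ps -> mirr Q.
Proof. by rewrite mem_large_irrs => /and3P[]. Qed.

Lemma all_large_mirr s : all (mem ps) s -> all (@mirr k) s.
Proof. by apply: sub_all => Q; exact: large_irrs_mirr. Qed.

Lemma large_deg_gt i : (z < w i)%N.
Proof. by have := mem_nth 0 (ltn_ord i); rewrite mem_large_irrs => /and3P[]. Qed.

Lemma wcount_large d : wcount w d = if (z < d <= N)%N then npi k d else 0%N.
Proof.
transitivity (count (fun Q => pdeg Q == d) ps).
  rewrite -sum1_count (big_nth 0) big_mkord /wcount -sum1_card.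
  by apply: eq_bigl => i; rewrite finset.inE.
rewrite /ps count_filter; case: ifP => [/andP[zd dN]|h].
  rewrite -(count_irrs k dN); apply: eq_in_count => Q _ /=.
  by case: eqP => // ->; rewrite zd.
apply/eqP; rewrite -leqn0 leqNgt -has_count; apply/hasPn => Q.
rewrite mem_irrs => /andP[_ dQ]; apply/negP => /andP[/eqP E zQ].
by move: h; rewrite -E zQ dQ.
Qed.

Lemma wcount_large_le d : (0 < d)%N -> (d * wcount w d <= #|k| ^ d)%N.
Proof. by move=> d0; rewrite wcount_large; case: ifP => _; [exact: npi_le|rewrite muln0]. Qed.

Lemma wcount_large_ge d : (z < d <= N)%N -> (#|k| ^ d <= d * wcount w d + 2 * #|k| ^ d./2)%N.
Proof.
move=> h; rewrite wcount_large h; apply: npi_ge.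
by case/andP: h => + _; exact: leq_ltn_trans.
Qed.

Lemma prod_count_large (A : comNzRingType) (h : {poly k} -> A) s : all (mem ps) s ->
  \prod_(Q <- s) h Q = \prod_(0 <= i < r) h (nth 0 ps i) ^+ count_mem (nth 0 ps i) s.
Proof.
rewrite -(big_nth 0 xpredT (fun Q => h Q ^+ count_mem Q s)).
elim: s => [_|Q s IH /= /andP[Qps hs]].
  by rewrite big_nil big1// => Q _; rewrite expr0.
rewrite big_cons IH// -[X in X * _](_ : \prod_(G <- ps) h G ^+ (Q == G) = h Q); last first.
  rewrite (bigD1_seq Q) ?large_irrs_uniq//= eqxx expr1 big1 ?mulr1// => G.
  by rewrite eq_sym => /negbTE ->; rewrite expr0.
by rewrite -big_split/=; apply: eq_bigr => G _; rewrite -exprD.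
Qed.

Lemma Pminus_gt (F : {poly k}) : F \is monic -> (z < pdeg F)%N ->
  reflect (forall Q, mirr Q -> Q %| F -> (z < pdeg Q)%N) (z < Pminus F)%N.
Proof.
move=> mF zF; rewrite /Pminus (big_morph (fun n => z < n)%N (op1 := andb) (id1 := true)); last 2 first.
- by move=> x y; rewrite leq_min.
- exact: zF.
rewrite big_andE; apply: (iffP forall_inP) => [h Q iQ dQ|h Q /and3P[mQ iQ dQ]].
  have sQ : (size Q <= size F)%N by rewrite dvdp_leq ?monic_neq0.
  have := h (npolyp (size F) Q); rewrite npolypK//; apply.
  by rewrite dQ andbT; exact: iQ.
by apply: h => //; apply/andP.
Qed.

Lemma rough_factor F : F \in rough k N z ->
  exists2 s, all (mem ps) s & (F : {poly k}) = \prod_(Q <- s) Q.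
Proof.
rewrite !finset.inE => /andP[/andP[mF /eqP sF] zF].
have dF : pdeg F = N by rewrite /pdeg sF.
have [s hs Fs] := monic_factor mF; exists s => //.
apply/allP => Q Qs; have iQ := allP hs _ Qs; rewrite inE mem_large_irrs iQ /=.
have QF : Q %| F by rewrite Fs (big_rem Q)//= dvdp_mulr.
apply/andP; split; first by apply: (Pminus_gt mF _ zF) => //; rewrite dF.
by rewrite -dF /pdeg -!subn1 leq_sub2r// dvdp_leq ?monic_neq0.
Qed.

Lemma prod_rough s : all (mem ps) s -> (\sum_(Q <- s) pdeg Q)%N = N ->
  npolyp N.+1 (\prod_(Q <- s) Q) \in rough k N z /\
  (npolyp N.+1 (\prod_(Q <- s) Q) : {poly k}) = \prod_(Q <- s) Q.
Proof.
move=> hs sN; have hs' := all_large_mirr hs.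
have mP := monic_prod_mirr hs'; have dP := pdeg_prod hs'.
have szP : size (\prod_(Q <- s) Q) = N.+1 by rewrite (monic_size mP) dP sN.
have E : npolyp N.+1 (\prod_(Q <- s) Q) = \prod_(Q <- s) Q :> {poly k}.
  by rewrite npolypK ?szP.
split=> //; rewrite !finset.inE E mP szP eqxx /=.
apply/Pminus_gt => //; first by rewrite dP sN.
move=> Q iQ; rewrite -[Q in Q %| _]expr1 dvdp_prod_mirr// -has_count has_pred1.
by move=> /(allP hs); rewrite inE mem_large_irrs => /and3P[].
Qed.

(* The empty list, without meaning, when F is not rough. *)
Definition factors F : seq {poly k} :=
  if pselect (exists2 s, all (mem ps) s & (F : {poly k}) = \prod_(Q <- s) Q) is left e
  then s2val (cid2 e) else [::].

Definition mult F (i : nat) : nat := count_mem (nth 0 ps i) (factors F).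

Lemma factorsP F : F \in rough k N z ->
  all (mem ps) (factors F) /\ (F : {poly k}) = \prod_(Q <- factors F) Q.
Proof.
move=> /rough_factor h; rewrite /factors; case: pselect => // e.
by case: (cid2 e).
Qed.

Lemma mult_prod F : F \in rough k N z ->
  (F : {poly k}) = \prod_(0 <= i < r) nth 0 ps i ^+ mult F i.
Proof. by move=> /factorsP[h {1}->]; exact: (prod_count_large id). Qed.

Lemma mult_inj F G : F \in rough k N z -> G \in rough k N z ->
  agree r (mult F) (mult G) -> F = G.
Proof.
move=> hF hG /forallP h; apply: val_inj; rewrite /= (mult_prod hF) (mult_prod hG).
by rewrite !big_mkord; apply: eq_bigr => i _; rewrite (eqP (h i)).
Qed.

Lemma mult_unique F s (i : 'I_r) : F \in rough k N z -> all (mem ps) s ->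
  (F : {poly k}) = \prod_(Q <- s) Q -> mult F i = count_mem (nth 0 ps i) s.
Proof.
move=> /factorsP[h E] hs Es; apply: count_factors; try exact: all_large_mirr.
  by apply/large_irrs_mirr/mem_nth.
by rewrite -E.
Qed.

Lemma sum_mult F : F \in rough k N z -> (\sum_(i < r) mult F i * w i)%N = N.
Proof.
move=> hF; have [hs E] := factorsP hF.
have dF : pdeg F = N by move: hF; rewrite !finset.inE /pdeg => /andP[/andP[_ /eqP ->]].
rewrite -[RHS]dF E pdeg_prod ?all_large_mirr//.
move: hs; rewrite /mult; elim: (factors F) => [_|Q s IH /= /andP[Qps hs]].
  by rewrite big_nil big1.
rewrite big_cons -IH//; under eq_bigr do rewrite mulnDl.
rewrite big_split/=; congr (_ + _)%N.
rewrite -(big_mkord xpredT (fun i => (Q == nth (0%R : {poly k}) ps i) * pdeg (nth (0%R : {poly k}) ps i))%N).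
rewrite -(big_nth (0%R : {poly k}) xpredT (fun G : {poly k} => (Q == G) * pdeg G)%N).
rewrite (bigD1_seq Q) ?large_irrs_uniq//= eqxx mul1n big1 ?addn0// => G.
by rewrite eq_sym => /negbTE ->.
Qed.

Definition sqfree F : bool := [forall i : 'I_r, (mult F i <= 1)%N].

Definition poly_of_set (I : {set 'I_r}) : {poly_(N.+1) k} :=
  npolyp N.+1 (\prod_(Q <- [seq nth 0 ps (i : 'I_r) | i <- enum I]) Q).

Let set_seq (I : {set 'I_r}) := [seq nth 0 ps (i : 'I_r) | i <- enum I].

Lemma poly_of_setP I : I \in wsets w N ->
  poly_of_set I \in rough k N z /\ (forall i : 'I_r, mult (poly_of_set I) i = (i \in I)).
Proof.
rewrite finset.inE => /eqP wI.
have hs : all (mem ps) (set_seq I).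
  by apply/allP => _ /mapP[i _ ->]; rewrite inE mem_nth.
have [h1 h2] : poly_of_set I \in rough k N z /\
    (poly_of_set I : {poly k}) = \prod_(Q <- set_seq I) Q.
  apply: prod_rough => //; rewrite big_map -wI /wt.
  by rewrite big_enum.
split=> // i; rewrite (mult_unique i h1 hs h2) count_uniq_mem; last first.
  rewrite map_inj_in_uniq ?enum_uniq// => a b _ _ /eqP.
  by rewrite nth_uniq ?large_irrs_uniq// => /eqP /val_inj.
congr nat_of_bool; apply/mapP/idP => [[j + /eqP]|iI]; last by exists i; rewrite ?mem_enum.
by rewrite mem_enum nth_uniq ?large_irrs_uniq// => jI /eqP /val_inj ->.
Qed.

Lemma poly_of_set_inj : {in wsets w N &, injective poly_of_set}.
Proof.
move=> I J /poly_of_setP[_ hI] /poly_of_setP[_ hJ] E; apply/setP => i.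
by have := hI i; rewrite E hJ; case: (i \in I); case: (i \in J).
Qed.

Lemma sqfree_imset : [set F in rough k N z | sqfree F] = [set poly_of_set I | I in wsets w N].
Proof.
apply/setP => F; apply/idP/imsetP.
  rewrite finset.inE => /andP[hF /forallP sF].
  pose I := [set i : 'I_r | mult F i == 1%N].
  have EI (i : 'I_r) : mult F i = (i \in I).
    by rewrite finset.inE; have := sF i; case: (mult F i) => [|[]].
  have wI : I \in wsets w N.
    rewrite finset.inE -[X in _ == X](sum_mult hF) /wt big_mkcond/=; apply/eqP.
    by apply: eq_bigr => i _; rewrite EI; case: ifP; rewrite ?mul1n.
  exists I => //; have [h1 h2] := poly_of_setP wI.
  by apply: mult_inj => //; apply/forallP => i; rewrite h2 EI.
case=> I wI ->; have [h1 h2] := poly_of_setP wI; rewrite finset.inE h1.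
by apply/forallP => i; rewrite h2; case: (_ \in _).
Qed.

Lemma card_sqfree : #|[set F in rough k N z | sqfree F]| = #|wsets w N|.
Proof. by rewrite sqfree_imset card_in_imset//; exact: poly_of_set_inj. Qed.

(** Such a polynomial is divisible by the square of an irreducible Q of degree greater than z, and
    Q^2 has q^(N - 2 deg Q) monic multiples of degree N when 2 deg Q <= N. The factor [w i >= 1] is
    inserted to match [sum_square_le]. *)
Lemma card_nonsqfree :
  (#|[set F in rough k N z | ~~ sqfree F]| <= N * #|k| ^ (N - z))%N.
Proof.
have q1 : (1 < #|k|)%N := finNzRing_gt1 k.
apply: leq_trans _ (sum_square_le large_deg_gt z_gt0 q1 wcount_large_le N).
have H (i : 'I_r) : (#|[set F in rough k N z | (1 < mult F i)%N]| <=
    if (2 * w i <= N)%N then #|k| ^ (N - 2 * w i) else 0)%N.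
  have iQ : mirr (nth 0 ps i) by apply/large_irrs_mirr/mem_nth.
  rewrite -(pdegX 2 (mirr_monic iQ)) -(count_dvd_monics N (monic_exp 2 (mirr_monic iQ))).
  rewrite /monics count_map -size_filter cardE; apply: uniq_leq_size; first exact: enum_uniq.
  move=> F; rewrite mem_enum mem_filter mem_enum finset.inE => /andP[hF mF].
  have [hs E] := factorsP hF; apply/andP; split.
    by rewrite /= E dvdp_prod_mirr ?all_large_mirr.
  by move: hF; rewrite finset.inE => /andP[].
apply: (@leq_trans (\sum_(i < r) #|[set F in rough k N z | (1 < mult F i)%N]|)).
  rewrite -sum1_card; under [leqRHS]eq_bigr do rewrite -sum1_card big_mkcond/=.
  rewrite exchange_big/= big_mkcond/=; apply: leq_sum => F _; rewrite finset.inE.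
  case: ifP => // /andP[hF sF].
  have [i mF] : exists i : 'I_r, (1 < mult F i)%N.
    by move: sF; rewrite /sqfree negb_forall => /existsP[l]; rewrite -ltnNge; exists l.
  by rewrite (bigD1 i)//= finset.inE hF mF.
rewrite [leqRHS]big_mkcond/=; apply: leq_sum => i _; apply: leq_trans (H i) _.
have wi := leq_ltn_trans (leq0n z) (large_deg_gt i).
case: ifP => // h2; rewrite ifT; last by lia.
rewrite ifT; last by lia.
by rewrite -subnDA addnn -mul2n leq_pmull.
Qed.

End RoughPolynomials.

(** * From squarefree to all rough polynomials *)

Section CosineLipschitz.
Context {R : realType}.

Lemma norm_sin_le (x : R) : `|sin x| <= `|x|.
Proof.
wlog x0 : x / 0 <= x => [h|].
  have [/h//|xlt0] := lerP 0 x; have := h (- x).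
  by rewrite oppr_ge0 (ltW xlt0) sinN !normrN => /(_ isT).
rewrite (ger0_norm x0) ler_norml sin_le_id// andbT.
have [x1|x1] := lerP 1 x.
  by have := sin_max x; rewrite ler_norml => /andP[h _]; lra.
apply: le_trans (sin_ge_deg3 x0).
have : x ^+ 3 <= x by rewrite -[leRHS]mulr1 exprS ler_wpM2l// expr_le1// ltW.
lra.
Qed.

Lemma cos_lipschitz (a b : R) : `|cos a - cos b| <= `|a - b|.
Proof.
rewrite -(sinDpihalf a) -(sinDpihalf b) sin_sub normrM (ger0_norm (ler0n _ 2)).
have -> : (a + pi / 2 - (b + pi / 2)) / 2 = (a - b) / 2 by field.
apply: (@le_trans _ _ (2 * `|(a - b) / 2|)); last first.
  by rewrite normrM (ger0_norm (_ : 0 <= 2^-1)) ?invr_ge0// mulrC divfK.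
rewrite ler_pM2l// normrM -[leRHS]mul1r; apply: ler_pM => //; first exact: cos_max.
exact: norm_sin_le.
Qed.

End CosineLipschitz.

Section RoughSum.
Local Close Scope classical_set_scope.
Context {R : realType} d (T : measurableType d) (P : probability T R).
Local Notation C := R[i].
Local Notation re := (@complex.Re R).
Local Notation im := (@complex.Im R).
Variables (k : finFieldType) (f : {poly k} -> T -> C).
Hypothesis hf : steinhaus P f.
Variables (N z : nat).
Hypotheses (z_gt0 : (0 < z)%N) (zN : (z < N)%N).
Local Notation ps := (large_irrs k N z).
Local Notation r := (size ps).
Local Notation w := (@large_deg k N z).
Local Notation x := (st_var f ps).
Implicit Types (F G : {poly_(N.+1) k}).

Let ps_irr (Q : {poly k}) : Q \in ps -> monic_irreducible Q.
Proof. by move=> /large_irrs_mirr /mirrP. Qed.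
Let Fm j := st_filt_measurable hf ps_irr (j := j).
Let xo j a H := st_var_orth hf (large_irrs_uniq k N z) ps_irr (j := j) (a := a) (H := H).
Let xu := st_var_unit f ps.
Let xa i j := @st_var_adapted R d T k f ps i j.
Let q1 : (1 < #|k|)%N := finNzRing_gt1 k.

Definition rough_sum (t : T) : C :=
  \sum_(F in rough k N z) monomial x r (mult z F) t.

Let nonsq := [set F in rough k N z | ~~ sqfree z F].
Let rest (t : T) : C := \sum_(F in nonsq) monomial x r (mult z F) t.

Let agree_mult F G : F \in rough k N z -> G \in rough k N z ->
  agree r (mult z F) (mult z G) = (F == G).
Proof.
move=> hF hG; apply/idP/eqP => [|->]; first exact: mult_inj.
by apply/forallP.
Qed.

Let esp_normsq_subset (A : {set {poly_(N.+1) k}}) : A \subset rough k N z ->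
  esp P (fun t => normsq (\sum_(F in A) monomial x r (mult z F) t)) = #|A|%:R.
Proof.
move=> /fintype.subsetP sA; rewrite (esp_normsq_sum Fm xu xa xo) -sum1_card natr_sum.
apply: eq_bigr => F FA; rewrite (bigD1 F)//= agree_mult ?sA// eqxx big1 ?addr0// => G /andP[GA GF].
by rewrite agree_mult ?sA// eq_sym (negbTE GF).
Qed.

Lemma esp_rough_sum : esp P (fun t => normsq (rough_sum t)) = #|rough k N z|%:R.
Proof. exact: esp_normsq_subset. Qed.

Lemma rough_sum_cbmeas : cbmeas rough_sum.
Proof. by apply: cbmeas_sum => F _; exact: (monomial_cbmeas Fm xa). Qed.

Lemma chaos_cbmeas : cbmeas (chaos x w N).
Proof. by apply: cbmeas_sum => F _; exact: (monomial_cbmeas Fm xa). Qed.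

Let rough_sumE t : rough_sum t = chaos x w N t + rest t.
Proof.
rewrite /rough_sum (bigID (sqfree z))/=; congr (_ + _); last first.
  by apply: eq_bigl => F; rewrite [in RHS]finset.inE.
rewrite (eq_bigl (fun F => F \in [set F in rough k N z | sqfree z F])); last first.
  by move=> F; rewrite [in RHS]finset.inE.
rewrite sqfree_imset// big_imset/=; last exact: poly_of_set_inj.
apply: eq_bigr => I wI; have [_ h] := poly_of_setP zN wI.
by rewrite /monomial !big_mkord; apply: eq_bigr => i _; rewrite h ind_ord.
Qed.

Let card_split : #|rough k N z| = (#|wsets w N| + #|nonsq|)%N.
Proof.
rewrite -(card_sqfree k zN) -[LHS](cardsID [set F | sqfree z F]).
by congr (_ + _)%N; apply: eq_card => F; rewrite !finset.inE// andbC.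
Qed.

Let rho : R := #|wsets w N|%:R.
Let a : R := #|rough k N z|%:R.
Let q : R := #|k|%:R.

Let q_gt1 : 1 < q. Proof. by rewrite ltr1n. Qed.
Let q_gt0 : 0 < q. Proof. exact: lt_trans q_gt1. Qed.

Hypotheses (Nz2 : (N <= z ^ 2)%N) (exp_small : (8 * z ^ 2 <= 2 ^ z)%N).
Hypothesis eps_small : 2 / 2 ^+ z./2 * z%:R <= 8^-1 :> R.

(** Since [a >= q ^+ N / (8 * z%:R)], the first term bounds the proportion of non-squarefree
    polynomials, at most N q^(N - z) in number, and the second the off-diagonal quadruples, at most
    N q^(2 N) / z^4 in number, relative to [a ^+ 2]. *)
Let delta : R := 8 * z%:R ^+ 3 / 2 ^+ z + 64 * N%:R / z%:R ^+ 2.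

Let z0 : 0 < z%:R :> R. Proof. by rewrite ltr0n. Qed.

Let rho_ge : q ^+ N / (8 * z%:R) <= rho.
Proof.
have := wnum_lb (R := R) (@large_deg_gt k N z) z_gt0 q1 (@wcount_large_le k N z)
  (@wcount_large_ge k N z) Nz2 eps_small exp_small (m := N).
rewrite zN leqnn => /(_ isT); rewrite -/rho ler_pdivlMr ?exprn_gt0//.
by rewrite natrM mulrC.
Qed.

Let rho_gt0 : 0 < rho.
Proof. by apply: lt_le_trans rho_ge; rewrite divr_gt0 ?exprn_gt0// mulr_gt0. Qed.

Let aE : a = rho + #|nonsq|%:R. Proof. by rewrite /a card_split natrD. Qed.
Let rho_le_a : rho <= a. Proof. by rewrite aE lerDl. Qed.
Let a_ge : q ^+ N / (8 * z%:R) <= a. Proof. exact: le_trans rho_ge _. Qed.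
Let a_gt0 : 0 < a. Proof. exact: lt_le_trans rho_gt0 _. Qed.

Let ratio : (#|k| ^ (N - z))%:R / a <= 8 * z%:R / 2 ^+ z.
Proof.
rewrite ler_pdivrMr//; apply: le_trans (ler_wpM2l _ a_ge); last by rewrite divr_ge0 ?mulr_ge0.
have -> : 8 * z%:R / 2 ^+ z * (q ^+ N / (8 * z%:R)) = q ^+ N / 2 ^+ z.
  by field; rewrite ?expf_neq0 ?andbT ?gt_eqF.
rewrite ler_pdivlMr ?exprn_gt0// natrX -/q -[in leRHS](subnK (ltnW zN)) exprD.
by rewrite ler_pM2l ?exprn_gt0// ler_pXn2r ?nnegrE ?(ltW q_gt0)// ler_nat.
Qed.

Let delta2_ge0 : 0 <= 64 * N%:R / z%:R ^+ 2 :> R.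
Proof. by rewrite divr_ge0 ?mulr_ge0 ?exprn_ge0. Qed.

Let nonsq_le : #|nonsq|%:R / a <= 8 * z%:R ^+ 3 / 2 ^+ z.
Proof.
apply: (@le_trans _ _ (N%:R * ((#|k| ^ (N - z))%:R / a))).
  rewrite mulrA ler_pM2r ?invr_gt0// -natrM ler_nat.
  exact: card_nonsqfree.
apply: le_trans (ler_wpM2l (ler0n _ _) ratio) _.
rewrite mulrA ler_pM2r ?invr_gt0 ?exprn_gt0// mulrCA ler_pM2l//.
by rewrite [leRHS]exprSr ler_pM2r// -natrX ler_nat.
Qed.

Let off_le : #|offdiag w N|%:R / a ^+ 2 <= 64 * N%:R / z%:R ^+ 2.
Proof.
have h := offdiag_le (@large_deg_gt k N z) z_gt0 q1 (@wcount_large_le k N z) N.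
have {}h : z%:R ^+ 4 * #|offdiag w N|%:R <= N%:R * (q ^+ N) ^+ 2.
  by move: h; rewrite -(ler_nat R) !natrM !natrX -exprM [(2 * N)%N]mulnC.
have a2 : (q ^+ N / (8 * z%:R)) ^+ 2 <= a ^+ 2.
  by rewrite ler_pXn2r ?nnegrE ?(ltW a_gt0)// divr_ge0 ?exprn_ge0 ?mulr_ge0// ltW.
rewrite ler_pdivrMr ?exprn_gt0//; apply: le_trans (ler_wpM2l delta2_ge0 a2).
rewrite -(ler_pM2l (exprn_gt0 4 z0)); apply: le_trans h _.
rewrite le_eqVlt; apply/orP; left; apply/eqP; field.
by rewrite gt_eqF.
Qed.

Let hd1 : (1 - rho / a) ^+ 2 + #|offdiag w N|%:R / a ^+ 2 <= delta.
Proof.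
apply: lerD off_le; apply: le_trans nonsq_le.
have a_neq0 : a != 0 by rewrite gt_eqF.
have -> : 1 - rho / a = #|nonsq|%:R / a.
  by rewrite -[X in X - _](divff a_neq0) -mulrBl {1}aE addrAC subrr add0r.
rewrite -[leRHS]mulr1 expr2; apply: ler_wpM2l; first by rewrite divr_ge0// ltW.
by rewrite ler_pdivrMr// mul1r aE lerDr ltW.
Qed.

Let hd2 : ((#|k| ^ (N - z))%:R * rho + #|offdiag w N|%:R) / a ^+ 2 <= delta.
Proof.
rewrite mulrDl; apply: lerD off_le.
apply: (@le_trans _ _ ((#|k| ^ (N - z))%:R / a)).
  rewrite expr2 invfM mulrA mulrAC ler_pM2r ?invr_gt0// -mulrA -[leRHS]mulr1.
  by apply: ler_wpM2l => //; rewrite ler_pdivrMr// mul1r.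
apply: le_trans ratio _.
rewrite ler_pM2r ?invr_gt0 ?exprn_gt0// ler_pM2l//.
by rewrite -natrX ler_nat -[leqLHS]expn1 leq_pexp2l.
Qed.

(** [chaos_cos] treats the squarefree part. By [cos_lipschitz], adding [rest] moves the cosine by at
    most the linear form of [rest], whose first moment gives the last term through [esp_abs_le]. *)
Theorem rough_sum_cos (s t theta eta lam : R) : lam = s ^+ 2 + t ^+ 2 -> 0 < eta ->
  `|esp P (fun u => cos (s * (re (rough_sum u) / Num.sqrt a) +
      t * (im (rough_sum u) / Num.sqrt a) + theta)) - expR (- lam / 4) * cos theta| <=
  lam / 4 * (eta + delta / eta) + eta * lam / 2 + (lam ^+ 2 / (2 * eta) + 2 * lam ^+ 2) * delta +
  (eta + lam * delta / eta) / 2.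
Proof.
move=> lamE eta0; have lam0 : 0 <= lam by rewrite lamE addr_ge0 ?sqr_ge0.
have hB i : (wnum_in w i N <= #|k| ^ (N - z))%N.
  exact: wnum_in_le (@large_deg_gt k N z) z_gt0 q1 (@wcount_large_le k N z) i N.
have Fmono i j := @st_filt_mono R d T k f ps i j.
have := chaos_cos Fm Fmono xu xa xo (ltn_trans z_gt0 zN) theta lamE a_gt0 eta0 rho_le_a hB hd1 hd2.
set A := esp P _; set B := esp P _ => h.
rewrite (_ : B - _ = (A - expR (- lam / 4) * cos theta) + (B - A)); last by ring.
apply: le_trans (ler_normD _ _) (lerD h _).
have [c1 c2] := chaos_cbmeas; have [r1 r2] := rough_sum_cbmeas.
have lin (Z : T -> C) : cbmeas Z ->
    bmeas (fun u => s * (re (Z u) / Num.sqrt a) + t * (im (Z u) / Num.sqrt a)).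
  move=> [z1 z2]; apply: bmeasD; apply: bmeasM; try exact: bmeas_cst;
  by apply: bmeasM => //; exact: bmeas_cst.
have bcos (Z : T -> C) : cbmeas Z ->
    bmeas (fun u => cos (s * (re (Z u) / Num.sqrt a) + t * (im (Z u) / Num.sqrt a) + theta)).
  move=> /lin hZ; apply: bmeas_cos.
  by case: (bmeasD hZ (bmeas_cst T theta)).
have hrest : cbmeas rest by apply: cbmeas_sum => F _; exact: (monomial_cbmeas Fm xa).
pose D u := s * (re (rest u) / Num.sqrt a) + t * (im (rest u) / Num.sqrt a).
have bD : bmeas D := lin _ hrest.
have br := bcos _ rough_sum_cbmeas; have bc := bcos _ chaos_cbmeas.
apply: (@le_trans _ _ (esp P (fun u => `|D u|))).
  rewrite /A /B -espB//; apply: le_trans (esp_norm _ (bmeasB br bc)) _.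
  apply: le_esp; [exact/bmeas_norm/bmeasB|exact: bmeas_norm|move=> u].
  apply: le_trans (cos_lipschitz _ _) _; rewrite rough_sumE reD imD /D.
  by rewrite le_eqVlt; apply/orP; left; apply/eqP; congr `|_|; ring.
apply: le_trans (esp_abs_le P eta0 bD) _.
rewrite ler_pM2r// lerD2l ler_pM2r ?invr_gt0//.
have sa0 : 0 < Num.sqrt a by rewrite sqrtr_gt0.
have sa2 : Num.sqrt a ^+ 2 = a by rewrite sqr_sqrtr// ltW.
have brn := bmeas_normsq hrest.
apply: (@le_trans _ _ (esp P (fun u => lam / a * normsq (rest u)))).
  apply: le_esp; [exact: bmeasX|by apply: bmeasM => //; exact: bmeas_cst|move=> u].
  rewrite (_ : lam / a = (s ^+ 2 + t ^+ 2) / Num.sqrt a ^+ 2); last by rewrite sa2 lamE.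
  rewrite /D /normsq -subr_ge0.
  (* Cauchy-Schwarz in the plane, by Lagrange's identity. *)
  have -> : (s ^+ 2 + t ^+ 2) / Num.sqrt a ^+ 2 * (re (rest u) ^+ 2 + im (rest u) ^+ 2) -
    (s * (re (rest u) / Num.sqrt a) + t * (im (rest u) / Num.sqrt a)) ^+ 2 =
    ((s * im (rest u) - t * re (rest u)) / Num.sqrt a) ^+ 2 by field; rewrite gt_eqF.
  exact: sqr_ge0.
rewrite espZ// esp_normsq_subset; last by apply/fintype.subsetP => F; rewrite finset.inE => /andP[].
rewrite mulrAC -mulrA ler_wpM2l//; apply: le_trans nonsq_le _.
by rewrite lerDl.
Qed.

End RoughSum.

(** * From the Steinhaus function to variables of modulus one everywhere *)

Section AlmostSure.
Context {R : realType} d (T : measurableType d) (P : probability T R).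
Local Notation C := R[i].
Local Notation re := (@complex.Re R).
Local Notation im := (@complex.Im R).
Local Notation R2 := (measurableTypeR R * measurableTypeR R)%type.

(** No bound is imposed, because the values of [f] at irreducibles lie on the circle only almost
    surely. *)
Definition cmeas (Z : T -> C) : Prop :=
  measurable_fun setT (fun u => re (Z u)) /\ measurable_fun setT (fun u => im (Z u)).

Lemma cmeas_cst c : cmeas (fun=> c).
Proof. by split; exact: measurable_cst. Qed.

Lemma cmeasD Y Z : cmeas Y -> cmeas Z -> cmeas (fun u => Y u + Z u).
Proof.
move=> [a b] [c e]; split.
  by under eq_fun do rewrite reD; exact: measurable_funD.
by under eq_fun do rewrite imD; exact: measurable_funD.
Qed.

Lemma cmeasM Y Z : cmeas Y -> cmeas Z -> cmeas (fun u => Y u * Z u).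
Proof.
move=> [a b] [c e]; split.
  by under eq_fun do rewrite reM; apply: measurable_funB; exact: measurable_funM.
by under eq_fun do rewrite imM; apply: measurable_funD; exact: measurable_funM.
Qed.

Lemma cmeasX Z n : cmeas Z -> cmeas (fun u => Z u ^+ n).
Proof.
move=> h; elim: n => [|n IH]; first by under eq_fun do rewrite expr0; exact: cmeas_cst.
by under eq_fun do rewrite exprS; exact: cmeasM.
Qed.

Lemma cmeas_sum (I : Type) (s : seq I) (A : pred I) (G : I -> T -> C) :
  (forall i, A i -> cmeas (G i)) -> cmeas (fun u => \sum_(i <- s | A i) G i u).
Proof.
move=> h; elim: s => [|i s IH]; first by under eq_fun do rewrite big_nil; exact: cmeas_cst.
under eq_fun do rewrite big_cons.
by case: (boolP (A i)) => // /h hi; exact: cmeasD.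
Qed.

Lemma cmeas_prod (I : Type) (s : seq I) (A : pred I) (G : I -> T -> C) :
  (forall i, A i -> cmeas (G i)) -> cmeas (fun u => \prod_(i <- s | A i) G i u).
Proof.
move=> h; elim: s => [|i s IH]; first by under eq_fun do rewrite big_nil; exact: cmeas_cst.
under eq_fun do rewrite big_cons.
by case: (boolP (A i)) => // /h hi; exact: cmeasM.
Qed.

Variables (k : finFieldType) (f : {poly k} -> T -> C).
Hypothesis hf : steinhaus P f.

Lemma st_unit_ae Q : monic_irreducible Q -> {ae P, forall u, normsq (f Q u) = 1}.
Proof.
move=> iQ; case: hf => mf _ law _.
pose B : set (R * R) := [set p | p.1 ^+ 2 + p.2 ^+ 2 != 1].
have mB : measurable B.
  have m1 : measurable_fun setT (fun p : R * R => p.1 ^+ 2 + p.2 ^+ 2).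
    by apply: measurable_funD; apply: measurable_funX.
  have := m1 measurableT _ (measurableC (measurable_set1 1)); rewrite setTI.
  by congr measurable; apply/seteqP; split => p /=; move/eqP.
exists ((fun u => plane (f Q u)) @^-1` B); split.
- by rewrite -[X in measurable X]setTI; exact: mf.
- rewrite (law _ iQ _ mB) /unit_circle_law /pushforward.
  rewrite (_ : _ @^-1` _ = set0) ?measure0//.
  by apply/seteqP; split => // t; rewrite /B /= cos2Dsin2 eqxx.
- by move=> u /= h; apply/eqP.
Qed.

Lemma st_unit_ae_seq (s : seq {poly k}) : (forall Q, Q \in s -> monic_irreducible Q) ->
  {ae P, forall u Q, Q \in s -> normsq (f Q u) = 1}.
Proof.
elim: s => [_|Q s IH h]; first exact: aeW.
have h1 := st_unit_ae (h Q (mem_head _ _)).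
have h2 : {ae P, forall u G, G \in s -> normsq (f G u) = 1}.
  by apply: IH => G Gs; apply: h; rewrite in_cons Gs orbT.
apply: filterS2 h1 h2 => u e1 e2 G.
by rewrite in_cons => /predU1P[->//|]; exact: e2.
Qed.

Lemma steinhaus_prod (s : seq {poly k}) u : all (@mirr k) s ->
  f (\prod_(Q <- s) Q) u = \prod_(Q <- s) f Q u.
Proof.
move=> /allP hs; case: hf => _ _ _ mul.
(* The multiplicativity in [steinhaus] concerns distinct irreducibles with positive exponents, so a
   list with repetitions is regrouped by multiplicity, for the polynomials and for the values
   alike. *)
have E (A : comNzRingType) (h : {poly k} -> A) :
    \prod_(Qa <- [seq (Q, count_mem Q s) | Q <- undup s]) h Qa.1 ^+ Qa.2 = \prod_(Q <- s) h Q.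
  by rewrite big_map/= -(big_undup_iterop_count _ s).
rewrite -[X in f X](E _ id) -[RHS](E _ (fun Q => f Q u)) mul//.
  by rewrite -map_comp (eq_map (g := id))// map_id undup_uniq.
move=> _ /mapP[Q + ->] /=; rewrite mem_undup => Qs; split; first exact/mirrP/hs.
by rewrite -has_count has_pred1.
Qed.

Variables (N z : nat).
Hypothesis zN : (z < N)%N.
Local Notation ps := (large_irrs k N z).
Local Notation r := (size ps).

Let ps_irr (Q : {poly k}) : Q \in ps -> monic_irreducible Q.
Proof. by move=> /large_irrs_mirr /mirrP. Qed.

Lemma steinhaus_rough (F : {poly_(N.+1) k}) u : F \in rough k N z ->
  f F u = \prod_(0 <= i < r) f (nth 0 ps i) u ^+ mult z F i.
Proof.
move=> /(factorsP zN)[hs {1}->]; rewrite steinhaus_prod ?(all_large_mirr hs)//.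
exact: (prod_count_large (fun Q => f Q u)).
Qed.

Lemma rough_sum_ae : {ae P, forall u, \sum_(F in rough k N z) f F u = rough_sum f N z u}.
Proof.
apply: filterS (st_unit_ae_seq ps_irr) => u h.
apply: eq_bigr => F hF; rewrite steinhaus_rough// /monomial.
rewrite big_nat [RHS]big_nat; apply: eq_bigr => i /andP[_ ir].
by rewrite /st_var ir unitize_plane// h// mem_nth.
Qed.

Lemma steinhaus_sum_cmeas : cmeas (fun u => \sum_(F in rough k N z) f F u).
Proof.
rewrite (_ : (fun u => _) = (fun u => \sum_(F in rough k N z)
    \prod_(i < r) f (nth 0 ps i) u ^+ mult z F i)); last first.
  by apply/funext => u; apply: eq_bigr => F hF; rewrite steinhaus_rough// big_mkord.
apply: cmeas_sum => F _; apply: cmeas_prod => i _; apply: cmeasX.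
case: hf => mf _ _ _; have := mf _ (ps_irr (mem_nth 0 (ltn_ord i))).
move=> m; split; [exact: (measurableT_comp measurable_fst m)|exact: (measurableT_comp measurable_snd m)].
Qed.

(** Transfers the problem from [f] to the variables [st_var], which agree with it almost surely at
    the large irreducibles. *)
Lemma expectation_rough_sum (g : R * R -> R) (c : R) :
  continuous g -> (exists M, forall x, `|g x| <= M) ->
  ('E_P[fun u => g (plane (c%:C * \sum_(F in rough k N z) f F u)%R)])%E =
  (esp P (fun u => g (re (rough_sum f N z u) * c, im (rough_sum f N z u) * c)))%:E.
Proof.
move=> cg [M hM]; have [mg _] := continuous_bounded_bmeas cg hM.
have pE (v : C) : plane (c%:C * v) = (re v * c, im v * c).
  by rewrite /plane reM imM /= !mul0r subr0 addr0 ![c * _]mulrC.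
have mcomp (Z : T -> C) : cmeas Z -> measurable_fun setT (fun u => g (re (Z u) * c, im (Z u) * c)).
  move=> [m1 m2]; apply: (@measurableT_comp _ _ _ T R2 R g setT (fun u => (re (Z u) * c, im (Z u) * c)) mg).
  by apply: measurable_fun_pair; apply: measurable_funM => //; exact: measurable_cst.
have [[m1 _] [m2 _]] := rough_sum_cbmeas hf N z.
have b2 : bmeas (fun u => g (re (rough_sum f N z u) * c, im (rough_sum f N z u) * c)).
  by split; [exact: mcomp|exists M => u; exact: hM].
rewrite -(bmeas_expectation P b2) unlock; apply: ae_eq_integral => //.
- apply/measurable_EFinP; under eq_fun do rewrite pE; exact: mcomp steinhaus_sum_cmeas.
- by apply/measurable_EFinP; exact: mcomp.
- by apply: filterS rough_sum_ae => u e _; rewrite pE e.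
Qed.

End AlmostSure.

(** * Thresholds for z, and the limit *)

Lemma pow4_le_exp2 z : (16 <= z)%N -> (z ^ 4 <= 2 ^ z)%N.
Proof.
elim: z => // z IH; rewrite leq_eqVlt => /predU1P[<- //|]; rewrite ltnS => z16.
rewrite [leqRHS]expnS; apply: leq_trans _ (leq_mul (leqnn 2) (IH z16)).
(* For [z >= 16], (1 + 1/z)^2 <= 6/5, and (6/5)^2 < 2. *)
have h : (10 * z.+1 ^ 2 <= 12 * z ^ 2)%N by rewrite !expnS !expn0; nia.
have := leq_mul h h; rewrite !(expnM _ 2 2).
by move: (z.+1 ^ 2)%N (z ^ 2)%N => u v; nia.
Qed.

(** This is the hypothesis [eps * z <= 1 / 8] of the lower bound. The induction runs on m = z / 2
    and starts from 16 * 19 <= 2^9. *)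
Lemma exp2_half_ge z : (18 <= z)%N -> (16 * z <= 2 ^ z./2)%N.
Proof.
move=> z18; have h m : (9 <= m)%N -> (16 * (2 * m + 1) <= 2 ^ m)%N.
  elim: m => // m IH; rewrite leq_eqVlt => /predU1P[<- //|]; rewrite ltnS expnS => m9.
  by have := IH m9; move: (2 ^ m)%N; lia.
have := h z./2; have := odd_double_half z; lia.
Qed.

Theorem theorem2p4 (R : realType) (k : nat -> finFieldType) (N z : nat -> nat)
    (d : nat -> measure_display) (T : forall n, measurableType (d n))
    (P : forall n, probability (T n) R)
    (f : forall n, {poly k n} -> T n -> R[i])
    (hN1 : forall n, (1 <= N n)%N)
    (hz : forall n,
      Num.sqrt ((N n)%:R : R) <= (z n)%:R /\ (z n <= N n - 1)%N)
    (hN : N @ \oo --> \oo)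
    (hNz : (fun n => Num.sqrt ((N n)%:R : R) / (z n)%:R) @ \oo --> (0 : R))
    (hf : forall n, steinhaus (P n) (f n)) :
  cvg_in_distribution P
    (fun n w =>
      ((Num.sqrt (#|rough (k n) (N n) (z n)|%:R : R))^-1)%:C *
        \sum_(F in rough (k n) (N n) (z n)) f n F w)
    (@standard_complex_normal R).
Proof.
have zN n : (z n < N n)%N by have [_] := hz n; have := hN1 n; lia.
have Nz2 n : (N n <= z n ^ 2)%N.
  have [h _] := hz n; rewrite -(ler_nat R) natrX -(@sqr_sqrtr _ (N n)%:R)//.
  by rewrite ler_pXn2r ?nnegrE ?sqrtr_ge0.
have z_gt0 n : (0 < z n)%N by have := leq_trans (hN1 n) (Nz2 n); rewrite expn_gt0 orbF.
pose u n : R := Num.sqrt (N n)%:R / (z n)%:R.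
pose a n : R := #|rough (k n) (N n) (z n)|%:R.
pose X n w := complex.Re (rough_sum (f n) (N n) (z n) w) / Num.sqrt (a n).
pose Y n w := complex.Im (rough_sum (f n) (N n) (z n) w) / Num.sqrt (a n).
have bX n : bmeas (X n).
  by apply: bmeasM (bmeas_cst _ _); case: (rough_sum_cbmeas (hf n) (N n) (z n)).
have bY n : bmeas (Y n).
  by apply: bmeasM (bmeas_cst _ _); case: (rough_sum_cbmeas (hf n) (N n) (z n)).
have a_ge0 n : 0 <= a n by [].
(* By orthogonality the second moment is exactly 1, or 0 in the degenerate case [a n = 0]. *)
have bXY n : esp (P n) (fun w => X n w ^+ 2 + Y n w ^+ 2) <= 1.
  rewrite (@eq_esp _ _ _ _ _ (fun w => (a n)^-1 * normsq (rough_sum (f n) (N n) (z n) w))).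
    rewrite espZ; last exact/bmeas_normsq/rough_sum_cbmeas.
    rewrite esp_rough_sum// -/(a n); have [->|a0] := eqVneq (a n) 0; first by rewrite mulr0.
    by rewrite mulVf.
  by move=> w; rewrite /X /Y /normsq !exprMn exprVn sqr_sqrtr// -mulrDl mulrC.
(* [N <= z ^ 2] carries the divergence of N over to z; 20 lies beyond the thresholds 16 and 18. *)
have z_large : \forall n \near \oo, (20 <= z n)%N.
  have : \forall n \near \oo, (400 <= N n)%N by exact: hN (nbhs_infty_ge 400).
  apply: filterS => n h; rewrite leqNgt; apply/negP => h'.
  by have := leq_trans h (Nz2 n); move: h'; rewrite !expnS expn0; nia.
pose delta n : R := 8 * (z n)%:R ^+ 3 / 2 ^+ z n + 64 * (N n)%:R / (z n)%:R ^+ 2.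
(* From z^3 / 2^z <= 1 / z <= [u n], as z^4 <= 2^z and N >= 1. *)
have delta_le : \forall n \near \oo, delta n <= 8 * u n + 64 * u n ^+ 2.
  apply: filterS z_large => n z20; have z0 : 0 < (z n)%:R :> R by rewrite ltr0n.
  rewrite /delta; apply: lerD; last first.
    by rewrite /u expr_div_n sqr_sqrtr// mulrA.
  rewrite -mulrA ler_pM2l//; apply: (@le_trans _ _ (z n)%:R^-1).
    rewrite -[leRHS]div1r ler_pdivlMr// mulrAC ler_pdivrMr ?exprn_gt0// mul1r -exprSr.
    by rewrite -!natrX ler_nat pow4_le_exp2// (leq_trans _ z20).
  rewrite /u -[leLHS]mul1r ler_pM2r ?invr_gt0// -[leLHS]sqrtr1.
  by rewrite ler_sqrt// ler1n.
move=> g cg [M hM].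
rewrite (_ : (fun n => _) = (fun n => (esp (P n) (fun w => g (X n w, Y n w)))%:E)); last first.
  by apply/funext => n; rewrite (expectation_rough_sum (hf n) (zN n) _ cg)//; exists M.
have bg := continuous_bounded_bmeas cg hM.
have fin := integrable_fin_num measurableT (bmeas_integrable (@standard_complex_normal R) bg).
rewrite -(fineK fin).
apply: cvg_EFin; first by near=> n.
apply: (cvg_of_cos bX bY bXY _ cg); last by exists M.
move=> s t e; rewrite standard_complex_normal_cos.
set lam := s ^+ 2 + t ^+ 2; have lam0 : 0 <= lam by rewrite addr_ge0 ?sqr_ge0.
apply/cvgrPdist_le => eps eps0.
(* The terms free of [delta] sum to [eta * (3 * lam / 4 + 1 / 2)], at most
   [eta * (lam + 1) = eps / 2]; [K] collects the coefficients of [delta]. *)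
pose eta := eps / (2 * (lam + 1)).
have eta0 : 0 < eta by rewrite divr_gt0// mulr_gt0// ltr_wpDl.
pose K := lam / (4 * eta) + lam ^+ 2 / (2 * eta) + 2 * lam ^+ 2 + lam / (2 * eta).
have K0 : 0 <= K.
  have c0 (c : nat) (v : R) : 0 <= v -> 0 <= v / (c%:R * eta).
    by move=> v0; rewrite divr_ge0// mulr_ge0// ltW.
  have l2 := sqr_ge0 lam; rewrite /K; apply: addr_ge0 (c0 2 _ lam0).
  by apply: addr_ge0; [exact: addr_ge0 (c0 4 _ lam0) (c0 2 _ l2)|exact: mulr_ge0].
have cvK : (fun n => K * (8 * u n + 64 * u n ^+ 2)) @ \oo --> (0 : R).
  have -> : 0 = K * (8 * 0 + 64 * (0 * 0)) :> R by rewrite !mulr0 addr0 mulr0.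
  apply: cvgMr; apply: cvgD; first exact: cvgMr hNz.
  by apply: cvgMr; exact: (cvgM hNz hNz).
have e2 : 0 < eps / 2 by rewrite divr_gt0.
have small : \forall n \near \oo, K * (8 * u n + 64 * u n ^+ 2) <= eps / 2.
  move/cvgrPdist_le : cvK => /(_ _ e2); apply: filterS => n; rewrite sub0r normrN.
  exact/le_trans/ler_norm.
near=> n; rewrite distrC.
have z20 : (20 <= z n)%N by near: n.
have z4 : (z n ^ 4 <= 2 ^ z n)%N by rewrite pow4_le_exp2// (leq_trans _ z20).
have es : (8 * z n ^ 2 <= 2 ^ z n)%N.
  by apply: leq_trans z4; rewrite (expnD _ 2 2) leq_mul2r; apply/orP; right; nia.
have hs : 2 / 2 ^+ (z n)./2 * (z n)%:R <= 8^-1 :> R.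
  have := exp2_half_ge (leq_trans (isT : 18 <= 20)%N z20).
  rewrite -(ler_nat R) natrM natrX => h.
  by rewrite mulrAC ler_pdivrMr ?exprn_gt0//; lra.
have := rough_sum_cos (hf n) (z_gt0 n) (zN n) (Nz2 n) es hs e (erefl lam) eta0.
move=> /le_trans; apply; rewrite -/(delta n).
have -> : lam / 4 * (eta + delta n / eta) + eta * lam / 2 +
    (lam ^+ 2 / (2 * eta) + 2 * lam ^+ 2) * delta n + (eta + lam * delta n / eta) / 2 =
    eta * (3 * lam / 4 + 2^-1) + K * delta n.
  by rewrite /K; field; rewrite gt_eqF.
rewrite [leRHS]splitr; apply: lerD.
  apply: (@le_trans _ _ (eta * (lam + 1))); first by rewrite ler_pM2l//; lra.
  rewrite /eta le_eqVlt; apply/orP; left; apply/eqP; field.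
  by rewrite gt_eqF// ltr_wpDl.
have small_n : K * (8 * u n + 64 * u n ^+ 2) <= eps / 2 by near: n.
apply: le_trans small_n; rewrite ler_wpM2l//.
by near: n.
Unshelve. all: by end_near. Qed.
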